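(* Let $\omega_{\mathcal Q}$ be the reduced symplectic form on $\mathcal Q:=\mu_{\operatorname{O}}^{-1}(0)/\operatorname{U}_1(\mathcal H_+)=\operatorname{Sp}_{1,2}(\mathcal V,\Omega)/\operatorname{U}_1(\mathcal H_+)$, i.e. the 2-form determined by $\pi^*\omega_{\mathcal Q}=\iota^*\omega_{\mathcal M}$, where $\iota:\mu_{\operatorname{O}}^{-1}(0)\hookrightarrow\operatorname{GL}_{1,2}(\mathcal V)$ is the inclusion and $\pi:\mu_{\operatorname{O}}^{-1}(0)\to\mathcal Q$ the projection. Then $\omega_{\mathcal Q}$ is invariant under the left action of $\operatorname{Sp}_{1,2}(\mathcal V,\Omega)$ and, under the identification $\mathcal Q\simeq\mathfrak D_{\rm res}(\mathcal H)$, it coincides (modulo a multiplicative constant) with the Kirillov–Kostant–Souriau symplectic form of $\mathfrak D_{\rm res}(\mathcal H)$ after identification of $\mathfrak D_{\rm res}(\mathcal H)$ with an affine coadjoint orbit of $\operatorname{Sp}_{\rm res}(\mathcal V,\Omega)$. More precisely, for $\tilde U,\tilde V\in T_Z\mathfrak D_{\rm res}(\mathcal H)$ with $Z=h\bar g^{-1}$, $\begin{pmatrix}g&h\\\bar h&\bar g\end{pmatrix}\in\operatorname{Sp}_{1,2}(\mathcal V,\Omega)$, one has $$\omega_{\mathcal Q}(Z)(\tilde U,\tilde V)=2\,\Im\operatorname{Tr}\left((\operatorname{id}_{\mathcal H_-}-\bar ZZ)^{-1}\tilde U^*(\operatorname{id}_{\mathcal H_+}-Z\bar Z)^{-1}\tilde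 V\right).$$
   Context: $\mathcal V$ is a real infinite-dimensional separable Hilbert space with inner product $\langle\cdot,\cdot\rangle_{\mathcal V}$, and $J$ is a bounded real-linear operator on $\mathcal V$ with $J^2=-\operatorname{id}_{\mathcal V}$ and $\langle Ju,Jv\rangle_{\mathcal V}=\langle u,v\rangle_{\mathcal V}$; $\Omega(u,v)=\langle u,Jv\rangle_{\mathcal V}$. $\mathcal H=\mathcal V\otimes\mathbb C$ is the complexification with its induced Hermitian scalar product $\langle\cdot,\cdot\rangle_{\mathcal H}$, $J$ is extended $\mathbb C$-linearly to $\mathcal H$, and $\mathcal H=\mathcal H_+\oplus\mathcal H_-$ where $\mathcal H_\pm$ is the eigenspace of $J$ for $\pm i$, so $J=\begin{pmatrix}i&0\\0&-i\end{pmatrix}$. Complex conjugation of $\mathcal H$ with respect to $\mathcal V$ exchanges $\mathcal H_\pm$; for a bounded operator $A$, $\bar Au:=\overline{A\bar u}$, $A^*$ is the Hermitian adjoint and $A^T:=(\bar A)^*$. $L^1$, $L^2$ denote trace class and Hilbert-Schmidt operators. With block matrices relative to $\mathcal H_+\oplus\mathcal H_-$, $$\mathfrak{gl}_{1,2}(\mathcal V)=\left\{\begin{pmatrix}A_1&A_2\\ \bar A_2&\bar A_1\end{pmatrix}\ \middle|\ A_1\in L^1(\mathcal H_+),\ A_2\in L^2(\mathcal H_-,\mathcal H_+)\right\},$$ with norm $\|A_1\|_1+\|A_2\|_2$; $\operatorname{GL}_{1,2}(\mathcal V)$ is the group of invertible elements of $\operatorname{id}_{\mathcal H}+\mathfrak{gl}_{1,2}(\mathcal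 V)$ (open in it), with tangent spaces identified with $\mathfrak{gl}_{1,2}(\mathcal V)$ and with constant weak symplectic form $\omega_{\mathcal M}(V_1,V_2)=\operatorname{Tr}V_1^*JV_2$. $\operatorname{O}_{1,2}(\mathcal V)=\{a\in\operatorname{GL}_{1,2}(\mathcal V)\mid a^*a=\operatorname{id}_{\mathcal H}\}$ has Lie algebra $\mathfrak o_{1,2}(\mathcal V)=\{A\in\mathfrak{gl}_{1,2}(\mathcal V)\mid A^*+A=0\}$, and the momentum map of its right action is $\mu_{\operatorname{O}}:\operatorname{GL}_{1,2}(\mathcal V)\to\mathfrak o_{1,2}(\mathcal V)^*$, $\langle\mu_{\operatorname{O}}(M)|A\rangle=-\frac12\operatorname{Tr}((M^*JM-J)A)$. Its zero level set is $\operatorname{Sp}_{1,2}(\mathcal V,\Omega)=\{a\in\operatorname{GL}_{1,2}(\mathcal V)\mid a^*Ja=J\}$. $\operatorname{U}_1(\mathcal H_+)$ is the group of unitary operators $u$ on $\mathcal H_+$ with $u-\operatorname{id}_{\mathcal H_+}\in L^1(\mathcal H_+)$, embedded in $\operatorname{Sp}_{1,2}(\mathcal V,\Omega)$ via $u\mapsto\begin{pmatrix}u&0\\0&\bar u\end{pmatrix}$ and acting by right multiplication. The restricted Siegel disc is $\mathfrak D_{\rm res}(\mathcal H)=\{Z\in L^2(\mathcal H_-,\mathcal H_+)\mid Z^T=Z,\ \operatorname{id}_{\mathcal H_-}-Z^*Z\succ0\}$ ($A\succ0$ meaning $\langle Au,u\rangle_{\mathcal H}>0$ for all $u\neq0$),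 open in the Hilbert space $\{V\in L^2(\mathcal H_-,\mathcal H_+)\mid V^T=V\}$, which is its tangent space at each point. The identification $\mathcal Q\simeq\mathfrak D_{\rm res}(\mathcal H)$ is the diffeomorphism $\left[\begin{pmatrix}g&h\\\bar h&\bar g\end{pmatrix}\right]\mapsto h\bar g^{-1}$; the left action of $\operatorname{Sp}_{1,2}(\mathcal V,\Omega)$ on $\mathcal Q$ by left multiplication corresponds to $Z\mapsto(gZ+h)(\bar hZ+\bar g)^{-1}$. Affine coadjoint orbit and KKS form. $\operatorname{Sp}_{\rm res}(\mathcal V,\Omega)$ is the group of bounded invertible operators $a=\begin{pmatrix}g&h\\\bar h&\bar g\end{pmatrix}$ on $\mathcal H$ with $a^*Ja=J$ and $h\in L^2(\mathcal H_-,\mathcal H_+)$; it acts transitively on $\mathfrak D_{\rm res}(\mathcal H)$ by $a\cdot Z=(gZ+h)(\bar hZ+\bar g)^{-1}$. Its Lie algebra $\mathfrak{sp}_{\rm res}$ consists of the bounded operators $A=\begin{pmatrix}A_1&A_2\\\bar A_2&\bar A_1\end{pmatrix}$ with $A_1^*=-A_1$, $A_2^T=A_2$, $A_2\in L^2$; $\mathfrak{sp}_{1,2}:=\mathfrak{sp}_{\rm res}\cap\mathfrak{gl}_{1,2}(\mathcal V)$. For an operator with trace class diagonal blocks, $\operatorname{Tr}_{\rm res}$ denotes the sum of the traces of its two diagonal blocks; $\mathfrak{sp}_{1,2}$ is paired with $\mathfrak{sp}_{\rm res}$ by $(\mu,A)\mapsto\operatorname{Tr}_{\rm res}(\mu A)$.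 For a real $\gamma\neq0$, the affine coadjoint action of $\operatorname{Sp}_{\rm res}(\mathcal V,\Omega)$ on $\mathfrak{sp}_{1,2}$ is $a\cdot\mu=a\mu a^{-1}+\gamma(aJa^{-1}-J)$ (this is the coadjoint action of the universal central extension of $\operatorname{Sp}_{\rm res}(\mathcal V,\Omega)$ on elements $(\mu,\gamma)$), with infinitesimal action $A\cdot\mu=[A,\mu+\gamma J]$. The orbit $\mathcal O_\gamma$ of $0$ is identified with $\mathfrak D_{\rm res}(\mathcal H)$ by the equivariant map $a\cdot 0_{\mathfrak D_{\rm res}}\mapsto\gamma(aJa^{-1}-J)$, and its Kirillov–Kostant–Souriau form is $\omega_\gamma(\mu)(A\cdot\mu,B\cdot\mu)=\operatorname{Tr}_{\rm res}([\mu+\gamma J,A]B)$ for $\mu\in\mathcal O_\gamma$, $A,B\in\mathfrak{sp}_{\rm res}$ (up to the usual sign convention).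
   Formalization: The displayed formula is proved with −2 Im Tr(...) in place of +2 Im Tr(...): with the stated conventions, at Z=0 and Ṽ=iŨ the reduced form equals −2‖Ũ‖², so the printed sign is wrong. *)

(* Defs.v *)
From HB Require Import structures.
From mathcomp Require Import all_boot all_order all_algebra.
From mathcomp Require Export sesquilinear.
From mathcomp Require Export complex.
From mathcomp Require Import all_classical all_reals all_analysis.

Set Implicit Arguments.
Unset Strict Implicit.
Unset Printing Implicit Defensive.
Import Order.TTheory GRing.Theory Num.Theory numFieldNormedType.Exports.

Local Open Scope classical_set_scope.
Local Open Scope ring_scope.
Local Open Scope complex_scope.

(* The complexification of V; the pair (u, v) stands for u + i v. *)
Definition cplx (R : rcfType) (V : lmodType R) : Type := (V * V)%type.

Section Complexification.
Context {R : rcfType} {V : lmodType R}.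

HB.instance Definition _ := GRing.Zmodule.copy (cplx V) (V * V)%type.

Definition cplx_scale (c : R[i]) (x : cplx V) : cplx V :=
  (complex.Re c *: x.1 - complex.Im c *: x.2,
   complex.Re c *: x.2 + complex.Im c *: x.1).

Lemma cplx_scaleA a b x :
  cplx_scale a (cplx_scale b x) = cplx_scale (a * b) x.
Proof.
case: a b x => [a1 a2] [b1 b2] [u v]; rewrite /cplx_scale /=.
rewrite !(scalerDr, scalerN, scalerA, scalerBl, scalerDl) ?opprD.
by congr pair; [rewrite [- _ - _]addrC addrACA | rewrite [_ - _]addrC addrACA].
Qed.

Lemma cplx_scale1 x : cplx_scale 1 x = x.
Proof. by case: x => u v; rewrite /cplx_scale /= !scale1r !scale0r subr0 addr0. Qed.

Lemma cplx_scaleDr : right_distributive cplx_scale +%R.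
Proof.
move=> [a b] [u v] [u' v']; rewrite /cplx_scale /=.
by congr pair; rewrite !scalerDr ?opprD addrACA.
Qed.

Lemma cplx_scaleDl x : {morph cplx_scale^~ x : a b / a + b}.
Proof.
case: x => u v [a b] [a' b']; rewrite /cplx_scale /=.
by congr pair; rewrite !scalerDl ?opprD addrACA.
Qed.

HB.instance Definition _ := GRing.Zmodule_isLmodule.Build R[i] (cplx V)
  cplx_scaleA cplx_scale1 cplx_scaleDr cplx_scaleDl.

End Complexification.

(* Operators are plain maps of [cplx V] into itself; [bop] singles out the
   bounded C-linear ones. *)
Notation op V := (cplx V -> cplx V).

Section Operators.
Context {R : realType} {V : completeNormedModType R}.
Variable ip : {dot V for idfun}.
Local Notation H := (cplx V).

(* Linear in the first, antilinear in the second argument. *)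
Definition herm (x y : H) : R[i] :=
  (ip x.1 y.1 + ip x.2 y.2) +i* (ip x.2 y.1 - ip x.1 y.2).

Definition hnorm (x : H) : R := Num.sqrt (complex.Re (herm x x)).

Definition bop (A : op V) : Prop :=
  linear A /\ exists M : R, forall x, hnorm (A x) <= M * hnorm x.

Definition cconj (x : H) : H := (x.1, - x.2).

Definition cbar (A : op V) : op V := cconj \o A \o cconj.

Definition adj (A : op V) : op V :=
  xget (fun=> 0) [set B | bop B /\ forall x y, herm (A x) y = herm x (B y)].

Definition trp (A : op V) : op V := adj (cbar A).

(* The inverse of A as an operator on the range of the projection P (an
   operator on the range of P being extended by 0 to the kernel of P). *)
Definition invop (P A : op V) : op V :=
  xget (fun=> 0) [set B | [/\ bop B, P \o B \o P = B, A \o B = P & B \o A = P]].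

Definition onb (e : nat -> H) : Prop :=
  (forall i j, herm (e i) (e j) = (i == j)%:R) /\
  (forall x, (forall i, herm x (e i) = 0) -> x = 0).

Definition basis_sum_to (f : H -> R) (t : R) : Prop :=
  forall e, onb e -> series (fun n => f (e n)) @ \oo --> t.

Definition basis_sum (f : H -> R) : R := xget 0 (basis_sum_to f).

Definition tr (A : op V) : R[i] :=
  basis_sum (fun x => complex.Re (herm (A x) x)) +i*
  basis_sum (fun x => complex.Im (herm (A x) x)).

Definition hilbert_schmidt (A : op V) : Prop :=
  bop A /\ exists t, basis_sum_to (fun x => hnorm (A x) ^+ 2) t.

Definition hsnorm (A : op V) : R :=
  Num.sqrt (basis_sum (fun x => hnorm (A x) ^+ 2)).

(* A = sum_n <., x_n> y_n with sum_n |x_n| |y_n| = s. On a Hilbert space the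
   operators having such an expansion (the nuclear operators) are the trace
   class ones, and the infimum of the possible s is Tr |A|. *)
Definition nuclear_expansion (A : op V) (s : R) : Prop :=
  exists x y : nat -> H,
    series (fun n => hnorm (x n) * hnorm (y n)) @ \oo --> s /\
    forall u, hnorm (A u - \sum_(0 <= k < n) herm u (x k) *: y k)
                @[n --> \oo] --> (0 : R).

Definition trace_class (A : op V) : Prop :=
  bop A /\ exists s, nuclear_expansion A s.

Definition trnorm (A : op V) : R := inf (nuclear_expansion A).

(* The curve c takes its values in S and c'(0) = v for the norm N, with v in
   T. It is used with c t - c 0 and v in a space on which N is finite. *)
Definition velocity (S T : set (op V)) (N : op V -> R)
    (c : R -> op V) (v : op V) : Prop :=
  [/\ forall t, S (c t), T v &
      N ((t^-1)%:C *: (c t - c 0) - v) @[t --> (0 : R)^'] --> (0 : R)].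

Variable J : {linear V -> V}.

Definition JC (x : H) : H := (J x.1, J x.2).

(* The projections onto the eigenspaces H_+ and H_- of J for i and - i, along
   each other. An operator from H_- to H_+ is encoded by its extension by 0,
   i.e. as an operator A on H such that A = Pp \o A \o Pm, and so on; with this
   convention [Pp], [Pm] are the identities of H_+, H_-, and traces and norms
   are computed in H. *)
Definition Pp (x : H) : H := 2^-1 *: (x - 'i%C *: JC x).
Definition Pm (x : H) : H := 2^-1 *: (x + 'i%C *: JC x).

Definition blk (P Q A : op V) : op V := P \o A \o Q.

(* A has the block form ((A1, A2), (conj A2, conj A1)). *)
Definition real_blocks (A : op V) : Prop :=
  blk Pm Pp A = cbar (blk Pp Pm A) /\ blk Pm Pm A = cbar (blk Pp Pp A).

Definition gl12 : set (op V) :=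
  [set A | [/\ bop A, real_blocks A, trace_class (blk Pp Pp A)
             & hilbert_schmidt (blk Pp Pm A)]].

Definition norm12 (A : op V) : R :=
  trnorm (blk Pp Pp A) + hsnorm (blk Pp Pm A).

Definition invertible (a : op V) : Prop :=
  exists b, [/\ bop b, a \o b = idfun & b \o a = idfun].

Definition GL12 : set (op V) := [set a | gl12 (a - idfun) /\ invertible a].

Definition omegaM (A B : op V) : R[i] := tr (adj A \o JC \o B).

Definition o12 : set (op V) := [set A | gl12 A /\ adj A + A = 0].

Definition muO (M A : op V) : R[i] :=
  - 2^-1 * tr (((adj M \o JC \o M) - JC) \o A).

Definition muO_zero : set (op V) :=
  [set M | GL12 M /\ forall A, o12 A -> muO M A = 0].

Definition Sp12 : set (op V) := [set a | GL12 a /\ adj a \o JC \o a = JC].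

Definition U1 : set (op V) :=
  [set u | [/\ bop u, blk Pp Pp u = u, adj u \o u = Pp, u \o adj u = Pp
             & trace_class (u - Pp)]].

(* The class of a modulo U1, embedded as u |-> diag (u, conj u). *)
Definition pi_Q (a : op V) : set (op V) :=
  [set b | exists2 u, U1 u & b = a \o (u + cbar u)].

(* The tangent space of the disc at each of its points. *)
Definition sym_hs : set (op V) :=
  [set U | [/\ hilbert_schmidt U, blk Pp Pm U = U & trp U = U]].

Definition siegel_disc : set (op V) :=
  [set Z | sym_hs Z /\
    forall u, JC u = - 'i%C *: u -> u <> 0 -> 0 < herm (u - adj Z (Z u)) u].

Definition disc_velocity (z : R -> op V) (U : op V) : Prop :=
  velocity siegel_disc sym_hs hsnorm z U.

(* The identification of the quotient with the disc, [a] |-> h (conj g)^-1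
   where a = ((g, h), (conj h, conj g)). *)
Definition chart (a : op V) : op V :=
  blk Pp Pm a \o invop Pm (blk Pm Pm a).

Definition mobius (a Z : op V) : op V :=
  ((blk Pp Pp a \o Z) + blk Pp Pm a)
    \o invop Pm ((blk Pm Pp a \o Z) + blk Pm Pm a).

(* Forms on the quotient are written in the global chart: a form takes a point
   of the quotient (a class) and two elements of [sym_hs]. *)
Definition form_at (w : op V -> op V -> R) : Prop :=
  [/\ forall (r : R) U U' W, sym_hs U -> sym_hs U' -> sym_hs W ->
        w (r%:C *: U + U') W = r * w U W + w U' W,
      forall U W, sym_hs U -> sym_hs W -> w U W = - w W U
    & exists M : R, forall U W, sym_hs U -> sym_hs W ->
        `|w U W| <= M * hsnorm U * hsnorm W].

(* pi^* omega = iota^* omegaM; tangent vectors are velocities of curves, and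
   tangent maps send the velocity of a curve to that of its image. *)
Definition reduced_form (omega : set (op V) -> op V -> op V -> R) : Prop :=
  (forall a, muO_zero a -> form_at (omega (pi_Q a))) /\
  (forall (alpha beta : R -> op V) (a A B U W : op V),
     alpha 0 = a -> beta 0 = a ->
     velocity muO_zero gl12 norm12 alpha A ->
     velocity muO_zero gl12 norm12 beta B ->
     disc_velocity (chart \o alpha) U ->
     disc_velocity (chart \o beta) W ->
     (omega (pi_Q a) U W)%:C = omegaM A B).

Definition Sp12_invariant (omega : set (op V) -> op V -> op V -> R) : Prop :=
  forall (b a : op V) (z w : R -> op V) (U W U' W' : op V),
    Sp12 b -> muO_zero a -> z 0 = chart a -> w 0 = chart a ->
    disc_velocity z U -> disc_velocity w W ->
    disc_velocity (mobius b \o z) U' -> disc_velocity (mobius b \o w) W' ->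
    omega (pi_Q (b \o a)) U' W' = omega (pi_Q a) U W.

Definition Spres : set (op V) :=
  [set a | [/\ bop a /\ real_blocks a, invertible a, adj a \o JC \o a = JC
             & hilbert_schmidt (blk Pp Pm a)]].

Definition spres : set (op V) :=
  [set A | [/\ bop A /\ real_blocks A,
               adj (blk Pp Pp A) = - blk Pp Pp A,
               trp (blk Pp Pm A) = blk Pp Pm A
             & hilbert_schmidt (blk Pp Pm A)]].

Definition sp12 : set (op V) := spres `&` gl12.

Definition tr_res (A : op V) : R[i] := tr (blk Pp Pp A) + tr (blk Pm Pm A).

Definition comm (A B : op V) : op V := (A \o B) - (B \o A).

(* gamma (a J a^-1 - J), the point a . 0 of the affine coadjoint orbit. *)
Definition orbit_point (gamma : R) (a : op V) : op V :=
  gamma%:C *: ((a \o JC \o invop idfun a) - JC).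

Definition affine_orbit (gamma : R) : set (op V) :=
  [set mu | exists2 a, Spres a & mu = orbit_point gamma a].

(* The graph of the identification a . 0 |-> gamma (a J a^-1 - J) of the disc
   with the orbit. *)
Definition disc_orbit (gamma : R) (Z mu : op V) : Prop :=
  exists2 a, Spres a & mobius a (fun=> 0) = Z /\ mu = orbit_point gamma a.

(* The infinitesimal affine coadjoint action of A at mu. *)
Definition inf_act (gamma : R) (A mu : op V) : op V :=
  comm A (mu + gamma%:C *: JC).

Definition kks (gamma : R) (mu A B : op V) : R[i] :=
  tr_res (comm (mu + gamma%:C *: JC) A \o B).

(* r is the value at (U, W) of the Kirillov-Kostant-Souriau form pulled back to
   the disc at the point Z: the tangent map of the identification sends U and W
   to A . mu and B . mu. *)
Definition kks_disc (gamma : R) (Z U W : op V) (r : R[i]) : Prop :=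
  exists (z w m n : R -> op V) (mu A B : op V),
    [/\ (forall t, disc_orbit gamma (z t) (m t)) /\
        (forall t, disc_orbit gamma (w t) (n t)),
        [/\ z 0 = Z, w 0 = Z, m 0 = mu & n 0 = mu],
        disc_velocity z U /\ disc_velocity w W,
        [/\ spres A, spres B,
            velocity (affine_orbit gamma) sp12 norm12 m (inf_act gamma A mu)
          & velocity (affine_orbit gamma) sp12 norm12 n (inf_act gamma B mu)]
      & r = kks gamma mu A B].

End Operators.

(* Main.v *)
(* Write a in Sp_{1,2} as ((g, h), (conj h, conj g)) and let Z = h (conj g)^-1.
   With d = ((1, 0), (0, -1)), so that J = i d, the condition a^* J a = J reads
   a^* d a = d and gives a^-1 = d a^* d. A tangent vector U at Z is encoded by
   xi(U) = g^* U conj g, a symmetric Hilbert-Schmidt operator from H_- to H_+.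
   Put X = ((0, xi), (conj xi, 0)) / 2. The curve a c(t), where c(t) is the
   Cayley transform (1 - t X)^-1 (1 + t X), stays in Sp_{1,2}, has velocity 2 a X
   and its chart has velocity U. Hence
     omega_Q(U, W) = Tr (2 a X)^* J (2 a Y) = - 2 Im Tr (xi(U)^* xi(W)),
   which is the stated formula because the inverse of 1 - Z^* Z on H_- is
   B B^* with B = conj g.
   Differentiating (Z + 1) (conj h Z + conj g)^-1 shows that xi is unchanged
   when (a, U) is moved by an element of Sp_{1,2}: the form is invariant.
   On the orbit, E = a d a^-1 determines Z by E (Z + 1) = - (Z + 1) on H_-;
   differentiating this relation along E' = [A, E] gives xi(U) = the off-diagonal
   block of a^-1 A a, and the Kirillov-Kostant-Souriau form is
   4 gamma Im Tr (xi(U)^* xi(W)). Traces only ever occur for products of two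
   Hilbert-Schmidt operators, where they reduce by polarisation to the
   Hilbert-Schmidt norm; that norm does not depend on the basis. *)

Require Import Defs.
From HB Require Import structures.
From mathcomp Require Import all_boot all_order all_algebra.
From mathcomp Require Import all_classical all_reals all_analysis.
From mathcomp Require Import ring lra.

Set Implicit Arguments.
Unset Strict Implicit.
Unset Printing Implicit Defensive.
Import Order.TTheory GRing.Theory Num.Theory numFieldNormedType.Exports.

Local Open Scope classical_set_scope.
Local Open Scope ring_scope.
Local Open Scope complex_scope.

(** [adj], [invop], [basis_sum] and hence [tr] are choices with a default value, so every object of
    the statement must be shown to exist before it can be computed. One variational argument,
    [lax_milgram], supplies the Riesz theorem, adjoints and inverses. A trace is always carried
    together with the convergence of its series in all bases. The Cayley transform is preferred to
    the exponential because it is rational: it needs one resolvent and leaves an exact quadratic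
    remainder, bounded in the nuclear and Hilbert-Schmidt senses at once. The curves in the
    invariance statement and in [kks_disc] are arbitrary. They are differentiated in operator norm
    only, which both velocity norms dominate up to a constant, and through product relations such as
    E (Z + 1) = - (Z + 1), so that no inverse is differentiated along them. The factor between the
    two forms is - 2 / (4 gamma) = - 1 / (2 gamma). *)

Lemma cvg0P (R : realType) (f : nat -> R) :
  (f @ \oo --> (0 : R)) <->
  forall e, 0 < e -> exists N, forall n, (N <= n)%N -> `|f n| <= e.
Proof.
split=> [/cvgrPdist_le h e e0|h].
  have [N _ hN] := h _ e0; exists N => n Nn.
  by have := hN n Nn; rewrite /= sub0r normrN.
apply/cvgrPdist_le => e e0; have [N hN] := h _ e0; exists N => // n Nn /=.
by rewrite sub0r normrN hN.
Qed.

Lemma invS_small (R : realType) (e : R) : 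
  0 < e -> exists N, forall n, (N <= n)%N -> n.+1%:R^-1 <= e.
Proof.
move=> e0; have /cvg0P/(_ _ e0)[N hN] := @cvg_harmonic R.
by exists N => n /hN; rewrite ger0_norm //= invr_ge0.
Qed.

(** Replaces a passage to the limit wherever an estimate holds up to an arbitrarily small multiple
    of a fixed constant. *)
Lemma le_eps (R : realType) (a c : R) : 0 <= c -> (forall e, 0 < e -> a <= c * e) -> a <= 0.
Proof.
move=> c0 h; rewrite leNgt; apply/negP => a0.
have := h (a / (c + 1) / 2) _; rewrite !divr_gt0 ?ltr_wpDl // => /(_ isT).
apply/negP; rewrite -ltNge mulrA ltr_pdivrMr // mulrA ltr_pdivrMr ?ltr_wpDl //; nra.
Qed.

Section Hilbert.
Context (R : realType) (V : completeNormedModType R) (ip : {dot V for idfun}).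
Context (ip_norm : forall u : V, ip u u = `|u| ^+ 2).
Local Notation H := (cplx V).
Local Notation C := R[i].
Local Notation herm := (herm ip).
Local Notation hnorm := (hnorm ip).
Local Notation Re := complex.Re.
Local Notation Im := complex.Im.

(** * The Hermitian product and the norm of the complexification *)

Lemma ipC u v : ip u v = ip v u.
Proof. by rewrite hermC expr0 mul1r. Qed.

Lemma ipZl (a : R) u v : ip (a *: u) v = a * ip u v.
Proof. by rewrite linearZl_LR. Qed.

Lemma ipZr (a : R) u v : ip u (a *: v) = a * ip u v.
Proof. by rewrite ipC ipZl ipC. Qed.

Lemma scaleE (c : C) (x : H) :
  c *: x = (Re c *: x.1 - Im c *: x.2, Re c *: x.2 + Im c *: x.1).
Proof. by []. Qed.

Lemma eqC (a b : C) : Re a = Re b -> Im a = Im b -> a = b.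
Proof. by case: a b => [? ?] [? ?] /= -> ->. Qed.

Lemma ReD (a b : C) : Re (a + b) = Re a + Re b. Proof. by case: a b => [? ?] []. Qed.
Lemma ImD (a b : C) : Im (a + b) = Im a + Im b. Proof. by case: a b => [? ?] []. Qed.
Lemma ReN (a : C) : Re (- a) = - Re a. Proof. by case: a. Qed.
Lemma ImN (a : C) : Im (- a) = - Im a. Proof. by case: a. Qed.
Lemma ReM (a b : C) : Re (a * b) = Re a * Re b - Im a * Im b.
Proof. by case: a b => [? ?] []. Qed.
Lemma ImM (a b : C) : Im (a * b) = Re a * Im b + Im a * Re b.
Proof. by case: a b => [? ?] []. Qed.
Lemma ReJ (a : C) : Re (conjc a) = Re a. Proof. by case: a. Qed.
Lemma ImJ (a : C) : Im (conjc a) = - Im a. Proof. by case: a. Qed.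
Lemma Rei : Re ('i%C : C) = 0. Proof. by []. Qed.
Lemma Imi : Im ('i%C : C) = 1. Proof. by []. Qed.
Definition ReImE := (ReD, ImD, ReN, ImN, ReM, ImM, ReJ, ImJ, Rei, Imi).

Lemma conjcD (a b : C) : conjc (a + b) = conjc a + conjc b.
Proof. exact: rmorphD. Qed.
Lemma conjcM (a b : C) : conjc (a * b) = conjc a * conjc b.
Proof. exact: rmorphM. Qed.
Lemma conjcN (a : C) : conjc (- a) = - conjc a.
Proof. exact: rmorphN. Qed.

Lemma hermE x y :
  herm x y = (ip x.1 y.1 + ip x.2 y.2) +i* (ip x.2 y.1 - ip x.1 y.2).
Proof. by []. Qed.

Lemma hermDl x y z : herm (x + y) z = herm x z + herm y z.
Proof. by apply: eqC; rewrite !hermE /= !linearDl /=; ring. Qed.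

Lemma hermZl c x y : herm (c *: x) y = c * herm x y.
Proof.
by case: c => a b; apply: eqC; rewrite !hermE /= !(linearBl, linearDl) /= !ipZl; ring.
Qed.

Lemma hermJ x y : herm x y = conjc (herm y x).
Proof. by apply: eqC; rewrite !hermE /= !(ipC x.1) !(ipC x.2) //; ring. Qed.

Lemma hermDr x y z : herm x (y + z) = herm x y + herm x z.
Proof. by rewrite hermJ hermDl conjcD -!hermJ. Qed.

Lemma hermZr c x y : herm x (c *: y) = conjc c * herm x y.
Proof. by rewrite hermJ hermZl conjcM -hermJ. Qed.

Lemma hermNl x y : herm (- x) y = - herm x y.
Proof. by rewrite -scaleN1r hermZl mulN1r. Qed.

Lemma hermNr x y : herm x (- y) = - herm x y.
Proof. by rewrite hermJ hermNl conjcN -hermJ. Qed.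

Lemma hermBl x y z : herm (x - y) z = herm x z - herm y z.
Proof. by rewrite hermDl hermNl. Qed.

Lemma hermBr x y z : herm x (y - z) = herm x y - herm x z.
Proof. by rewrite hermDr hermNr. Qed.

Lemma herm0l x : herm 0 x = 0.
Proof. by rewrite -(scale0r 0) hermZl mul0r. Qed.

Lemma herm0r x : herm x 0 = 0.
Proof. by rewrite hermJ herm0l conjc0. Qed.

Lemma herm_suml I (r : seq I) (P : pred I) (F : I -> H) y :
  herm (\sum_(i <- r | P i) F i) y = \sum_(i <- r | P i) herm (F i) y.
Proof.
elim/big_ind2: _ => [|x1 s1 x2 s2 <- <-|//]; first exact: herm0l.
exact: hermDl.
Qed.

Lemma herm_sumr I (r : seq I) (P : pred I) (F : I -> H) x :
  herm x (\sum_(i <- r | P i) F i) = \sum_(i <- r | P i) herm x (F i).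
Proof.
elim/big_ind2: _ => [|x1 s1 x2 s2 <- <-|//]; first exact: herm0r.
exact: hermDr.
Qed.

Lemma hnorm_ge0 x : 0 <= hnorm x.
Proof. exact: sqrtr_ge0. Qed.

Lemma hnorm_sqrE x : hnorm x ^+ 2 = `|x.1| ^+ 2 + `|x.2| ^+ 2.
Proof.
by rewrite sqr_sqrtr hermE /= !ip_norm //; apply: addr_ge0; rewrite exprn_ge0.
Qed.

Lemma herm_sqr x : herm x x = (hnorm x ^+ 2)%:C.
Proof. by rewrite hnorm_sqrE hermE !ip_norm ipC subrr. Qed.

#[local] Opaque Defs.herm.

Lemma hnorm_eq0 x : hnorm x = 0 -> x = 0.
Proof.
move=> x0; have := hnorm_sqrE x; rewrite x0 expr0n /= => /esym/eqP.
rewrite paddr_eq0 ?exprn_ge0 // !expf_eq0 /= !normr_eq0.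
by case: x {x0} => [x1 x2] /= /andP[/eqP -> /eqP ->].
Qed.

Lemma hnorm0 : hnorm 0 = 0.
Proof. by rewrite /hnorm herm0l sqrtr0. Qed.


(** The modulus as an element of [R]; the norm of [R[i]] takes its values in [R[i]]. *)
Definition cnorm (c : C) : R := Num.sqrt (Re c ^+ 2 + Im c ^+ 2).

Lemma cnorm_ge0 c : 0 <= cnorm c. Proof. exact: sqrtr_ge0. Qed.

Lemma cnorm_sqr c : cnorm c ^+ 2 = Re c ^+ 2 + Im c ^+ 2.
Proof. by rewrite sqr_sqrtr // addr_ge0 ?sqr_ge0. Qed.

Lemma le_sqr (a b : R) : 0 <= b -> a ^+ 2 <= b ^+ 2 -> a <= b.
Proof.
move=> b0 ab; case: (leP 0 a) => [a0|/ltW/le_trans]; last exact.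
by rewrite -(ler_pXn2r (n:=2)) // nnegrE.
Qed.

Lemma eq_sqr (a b : R) : 0 <= a -> 0 <= b -> a ^+ 2 = b ^+ 2 -> a = b.
Proof. by move=> a0 b0 ab; apply/le_anti/andP; split; apply: le_sqr; rewrite ?ab. Qed.

Lemma cnormR (a : R) : cnorm a%:C = `|a|.
Proof. by rewrite /cnorm /= expr0n addr0 sqrtr_sqr. Qed.

Lemma cnormi : cnorm 'i%C = 1.
Proof. by rewrite /cnorm /= expr0n expr1n add0r sqrtr1. Qed.

Lemma cnormN a : cnorm (- a) = cnorm a.
Proof. by rewrite /cnorm !ReImE !sqrrN. Qed.

Lemma cnormJ a : cnorm (conjc a) = cnorm a.
Proof. by rewrite /cnorm !ReImE !sqrrN. Qed.

Lemma mulJ c : c * conjc c = (cnorm c ^+ 2)%:C.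
Proof. by rewrite cnorm_sqr; case: c => a b; apply: eqC => /=; ring. Qed.

Lemma Re_le_cnorm c : `|Re c| <= cnorm c.
Proof.
apply: le_sqr; rewrite ?cnorm_ge0 // real_normK ?num_real // cnorm_sqr.
by rewrite lerDl sqr_ge0.
Qed.

Lemma cnorm_eq0 c : cnorm c = 0 -> c = 0.
Proof.
move=> c0; have := cnorm_sqr c; rewrite c0 expr0n /= => /esym/eqP.
rewrite paddr_eq0 ?sqr_ge0 // !expf_eq0 /=.
by case: c {c0} => a b /= /andP[/eqP -> /eqP ->].
Qed.

Lemma hnormZ c x : hnorm (c *: x) = cnorm c * hnorm x.
Proof.
apply: eq_sqr; rewrite ?mulr_ge0 ?cnorm_ge0 ?hnorm_ge0 //.
apply: complexI; rewrite -herm_sqr hermZl hermZr herm_sqr mulrA mulJ exprMn.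
by apply: eqC => /=; ring.
Qed.

Lemma hnormN x : hnorm (- x) = hnorm x.
Proof. by rewrite -scaleN1r hnormZ cnormN (cnormR 1) normr1 mul1r. Qed.

Lemma hnormBC x y : hnorm (x - y) = hnorm (y - x).
Proof. by rewrite -hnormN opprB. Qed.

Lemma hnormD_sqr x y :
  hnorm (x + y) ^+ 2 = hnorm x ^+ 2 + hnorm y ^+ 2 + 2 * Re (herm x y).
Proof.
apply: complexI; rewrite -herm_sqr hermDl !hermDr !herm_sqr (hermJ y x).
by case: (herm x y) => a b; apply: eqC => /=; ring.
Qed.

Lemma parallelogram x y :
  hnorm (x + y) ^+ 2 + hnorm (x - y) ^+ 2 = 2 * (hnorm x ^+ 2 + hnorm y ^+ 2).
Proof. by rewrite !hnormD_sqr hermNr hnormN /=; case: (herm x y) => a b /=; ring. Qed.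

Lemma Re_herm_le x y : Re (herm x y) <= hnorm x * hnorm y.
Proof.
have [->|x0] := eqVneq x 0; first by rewrite herm0l hnorm0 mul0r.
have nx0 : hnorm x != 0 by apply: contra_neq x0 => /hnorm_eq0.
have nxp : 0 < hnorm x by rewrite lt0r nx0 hnorm_ge0.
have := sqr_ge0 (hnorm ((hnorm y)%:C *: x - (hnorm x)%:C *: y)).
rewrite hnormD_sqr hnormN hermNr !hnormZ !cnormR !ger0_norm ?hnorm_ge0 //.
rewrite hermZl hermZr conjc_real !ReImE /= => h.
case: (ltrP 0 (hnorm y)) => [yp|]; last first.
  move=> y0; have y00 : hnorm y = 0 by apply/eqP; rewrite eq_le y0 hnorm_ge0.
  have -> : y = 0 := hnorm_eq0 y00.
  by rewrite herm0r hnorm0 mulr0.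
have {h} : 0 <= 2 * (hnorm x * hnorm y) * (hnorm x * hnorm y - Re (herm x y)).
  move: h; set a := hnorm x; set b := hnorm y => h; apply: le_trans h _.
  by rewrite le_eqVlt; apply/orP; left; apply/eqP; ring.
by rewrite pmulr_rge0 ?mulr_gt0 // subr_ge0.
Qed.

(** Multiplying [x] by the conjugate of [herm x y] makes the product real, which reduces the claim
    to [Re_herm_le]. *)
Lemma cauchy_schwarz x y : cnorm (herm x y) <= hnorm x * hnorm y.
Proof.
have [->|h0] := eqVneq (cnorm (herm x y)) 0; first by rewrite mulr_ge0 ?hnorm_ge0.
have hp : 0 < cnorm (herm x y) by rewrite lt0r h0 cnorm_ge0.
have := Re_herm_le (conjc (herm x y) *: x) y.
rewrite hermZl mulrC mulJ /= hnormZ cnormJ -mulrA expr2.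
by rewrite ler_pM2l.
Qed.

Lemma hnormD x y : hnorm (x + y) <= hnorm x + hnorm y.
Proof.
apply: le_sqr; rewrite ?addr_ge0 ?hnorm_ge0 // hnormD_sqr.
have := Re_herm_le x y; set a := hnorm x; set b := hnorm y; nra.
Qed.

Lemma hnormB x y : hnorm (x - y) <= hnorm x + hnorm y.
Proof. by rewrite -(hnormN y) hnormD. Qed.

Lemma hnorm_sum n (F : nat -> H) :
  hnorm (\sum_(0 <= k < n) F k) <= \sum_(0 <= k < n) hnorm (F k).
Proof.
elim: n => [|n ih]; first by rewrite !big_nil hnorm0.
by rewrite !big_nat_recr //=; apply: le_trans (hnormD _ _) _; rewrite lerD2r.
Qed.

Lemma herm_eqr x y : (forall z, herm z x = herm z y) -> x = y.
Proof.
move=> h; apply/eqP; rewrite -subr_eq0; apply/eqP; apply: hnorm_eq0.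
apply/eqP; rewrite -sqrf_eq0; apply/eqP/complexI.
by rewrite -herm_sqr hermBr h subrr.
Qed.

Lemma Re_herm_eqr x y : (forall z, Re (herm z x) = Re (herm z y)) -> x = y.
Proof.
move=> h; apply: herm_eqr => z; apply: eqC => //.
have := h ('i%C *: z); rewrite !hermZl !ReImE /=; lra.
Qed.

Lemma hnorm_fst x : `|x.1| <= hnorm x.
Proof. by apply: le_sqr (hnorm_ge0 _) _; rewrite hnorm_sqrE lerDl exprn_ge0. Qed.

Lemma hnorm_snd x : `|x.2| <= hnorm x.
Proof. by apply: le_sqr (hnorm_ge0 _) _; rewrite hnorm_sqrE lerDr exprn_ge0. Qed.

Lemma hnorm_le x : hnorm x <= `|x.1| + `|x.2|.
Proof.
apply: le_sqr; rewrite ?addr_ge0 // hnorm_sqrE sqrrD.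
by rewrite -subr_ge0 (_ : _ - _ = `|x.1| * `|x.2| *+ 2) ?mulrn_wge0 ?mulr_ge0 //; ring.
Qed.

(** * Completeness, the Lax-Milgram and Riesz theorems *)

Lemma cauchy_limit (u : nat -> V) :
  (forall e, 0 < e -> exists N, forall n m, (N <= n)%N -> (N <= m)%N -> `|u n - u m| <= e) ->
  exists l, forall e, 0 < e -> exists N, forall n, (N <= n)%N -> `|u n - l| <= e.
Proof.
move=> uC; have /cauchy_cvgP/cvgrPdist_le ul : cauchy (u @ \oo).
  apply: cauchy_exP => e e0; have [N hN] := uC (e / 2) (divr_gt0 e0 (ltr0Sn _ _)).
  exists (u N); exists N => // n Nn /=; rewrite -ball_normE /=.
  by apply: le_lt_trans (hN _ _ _ Nn) _ => //; lra.
exists (lim (u @ \oo)) => e /ul[N _ hN]; exists N => n /hN /=.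
by rewrite distrC.
Qed.

Lemma hcomplete (u : nat -> H) :
  (forall e, 0 < e -> exists N, forall n m, (N <= n)%N -> (N <= m)%N -> hnorm (u n - u m) <= e) ->
  exists l, forall e, 0 < e -> exists N, forall n, (N <= n)%N -> hnorm (u n - l) <= e.
Proof.
move=> uC.
have [|l1 h1] := @cauchy_limit (fun n => (u n).1).
  move=> e /uC[N hN]; exists N => n m Nn Nm.
  exact: le_trans (hnorm_fst (u n - u m)) (hN _ _ Nn Nm).
have [|l2 h2] := @cauchy_limit (fun n => (u n).2).
  move=> e /uC[N hN]; exists N => n m Nn Nm.
  exact: le_trans (hnorm_snd (u n - u m)) (hN _ _ Nn Nm).
exists (l1, l2) => e e0.
have e20 : 0 < e / 2 by apply: divr_gt0.
have [N1 hN1] := h1 _ e20; have [N2 hN2] := h2 _ e20.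
exists (maxn N1 N2) => n; rewrite geq_max => /andP[n1 n2].
apply: le_trans (hnorm_le _) _; have := hN1 _ n1; have := hN2 _ n2.
by rewrite /=; lra.
Qed.

(* Minimise |T z|^2 / 2 - f z: minimising sequences are Cauchy by the
   parallelogram law. *)
Lemma lax_milgram (T : H -> H) (f : H -> R) (m M K : R) :
  linear T -> 0 < m -> 0 <= M -> 0 <= K ->
  (forall x, m * hnorm x <= hnorm (T x)) ->
  (forall x, hnorm (T x) <= M * hnorm x) ->
  (forall x y, f (x + y) = f x + f y) ->
  (forall (a : R) x, f (a%:C *: x) = a * f x) ->
  (forall x, `|f x| <= K * hnorm x) ->
  exists z, forall x, Re (herm (T x) (T z)) = f x.
Proof.
move=> Tlin m0 M0 K0 Tm TM fD fZ fK.
have TD x y : T (x + y) = T x + T y by rewrite -{1}[x]scale1r Tlin scale1r.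
have T0 : T 0 = 0 by apply: (addrI (T 0)); rewrite -TD !addr0.
have TZ c x : T (c *: x) = c *: T x by rewrite -[c *: x]addr0 Tlin T0 addr0.
have TB z w : T (z - w) = T z - T w by rewrite TD -scaleN1r TZ scaleN1r.
pose Q z := hnorm (T z) ^+ 2 - 2 * f z.
have Q_mid z w : Q z + Q w =
  2 * Q ((2^-1)%:C *: (z + w)) + 2^-1 * hnorm (T (z - w)) ^+ 2.
rewrite /Q fZ fD TZ hnormZ cnormR ger0_norm ?invr_ge0 // exprMn.
rewrite TB TD; have h := parallelogram (T z) (T w).
have -> : hnorm (T z - T w) ^+ 2 =
  2 * (hnorm (T z) ^+ 2 + hnorm (T w) ^+ 2) - hnorm (T z + T w) ^+ 2
    by rewrite -h addrAC subrr add0r.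
by field.
have Q_lb : has_lbound (range Q).
exists (- (K / m) ^+ 2) => _ [z _ <-]; rewrite /Q.
have h1 : (m * hnorm z) ^+ 2 <= hnorm (T z) ^+ 2.
  by rewrite ler_pXn2r ?nnegrE ?mulr_ge0 ?hnorm_ge0 ?(ltW m0).
have h2 : f z <= K * hnorm z := le_trans (ler_norm _) (fK z).
have h3 : 0 <= (m * hnorm z - K / m) ^+ 2 by rewrite sqr_ge0.
have e : (m * hnorm z - K / m) ^+ 2 = (m * hnorm z) ^+ 2 - 2 * (K * hnorm z) + (K / m) ^+ 2.
  by field; rewrite gt_eqF.
lra.
have Q_ge z : inf (range Q) <= Q z by apply: (ge_inf Q_lb); exists z.
have /choice[u Qu] : forall n, exists z : H, Q z < inf (range Q) + n.+1%:R^-1.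
  move=> n.
  have Qinf : has_inf (range Q) by split; [exists (Q 0), 0 | exact: Q_lb].
  have e0 : 0 < n.+1%:R^-1 :> R by rewrite invr_gt0.
  have [_ [z _ <-] zlt] := inf_adherent e0 Qinf.
  by exists z.
have uC n k : m ^+ 2 * hnorm (u n - u k) ^+ 2 <= 2 * (n.+1%:R^-1 + k.+1%:R^-1).
  have := Q_mid (u n) (u k); have := Qu n; have := Qu k.
  have := Q_ge ((2^-1)%:C *: (u n + u k)).
  have : (m * hnorm (u n - u k)) ^+ 2 <= hnorm (T (u n - u k)) ^+ 2.
    by rewrite ler_pXn2r ?nnegrE ?mulr_ge0 ?hnorm_ge0 ?(ltW m0).
  by rewrite exprMn; move: n.+1%:R^-1 k.+1%:R^-1 => *; lra.
have [|z uz] := @hcomplete u.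
  move=> e e0; have [|N hN] := @invS_small _ ((m * e) ^+ 2 / 4).
    by rewrite divr_gt0 ?exprn_gt0 ?mulr_gt0.
  exists N => n k Nn Nk; apply: le_sqr (ltW e0) _.
  rewrite -(ler_pM2l (exprn_gt0 2 m0)).
  have := uC n k; have := hN _ Nn; have := hN _ Nk.
  by rewrite exprMn; move: n.+1%:R^-1 k.+1%:R^-1 => *; lra.
exists z => x.
pose d w := Re (herm (T x) (T w)) - f x.
have du n : d (u n) ^+ 2 <= (hnorm (T x) ^+ 2 + 1) * n.+1%:R^-1.
  (* The step along [x] that decreases [Q] most is [- d (u n) / k2]; adding 1 keeps the denominator
     positive. As [u n] is almost minimal, the decrease, of order [d (u n) ^+ 2], must be small. *)
  set k2 := hnorm (T x) ^+ 2; set t := - d (u n) / (k2 + 1).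
  have k0 : 0 <= k2 by rewrite sqr_ge0.
  have k1 : 0 < k2 + 1 by lra.
  have := Q_ge (u n + t%:C *: x); have := Qu n; rewrite /Q fD fZ TD TZ hnormD_sqr.
  rewrite hnormZ cnormR exprMn real_normK ?num_real // hermZr conjc_real.
  rewrite ReM /= mul0r subr0 hermJ ReJ -/k2.
  have -> : Re (herm (T x) (T (u n))) = d (u n) + f x by rewrite /d subrK.
  set D := d (u n); move: n.+1%:R^-1 => en h1 h2.
  have : 0 <= t ^+ 2 * k2 + 2 * (t * D) + en by lra.
  have -> : t ^+ 2 * k2 + 2 * (t * D) = - (D ^+ 2) / (k2 + 1) - D ^+ 2 / (k2 + 1) ^+ 2.
    by rewrite /t -/D; field; rewrite gt_eqF.
  have : 0 <= D ^+ 2 / (k2 + 1) ^+ 2 by rewrite divr_ge0 ?sqr_ge0.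
  have -> : D ^+ 2 <= (k2 + 1) * en = (D ^+ 2 / (k2 + 1) <= en).
    by rewrite ler_pdivrMr // mulrC.
  by rewrite mulNr; lra.
have dz n : `|d z - d (u n)| <= hnorm (T x) * M * hnorm (u n - z).
  have -> : d z - d (u n) = Re (herm (T x) (T (z - u n))).
    rewrite /d TB hermBr ReD ReN; lra.
  apply: le_trans (Re_le_cnorm _) _; apply: le_trans (cauchy_schwarz _ _) _.
  by rewrite -mulrA ler_wpM2l ?hnorm_ge0 // hnormBC.
apply/eqP; rewrite -subr_eq0 -/(d z) -normr_eq0 eq_le normr_ge0 andbT.
apply: (@le_eps _ _ (hnorm (T x) * M + 1)).
  by rewrite addr_ge0 ?mulr_ge0 ?hnorm_ge0.
move=> e e0; have [N1 hN1] := uz _ e0.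
have k1 : 0 < hnorm (T x) ^+ 2 + 1 by rewrite ltr_wpDl ?sqr_ge0.
have [|N2 hN2] := @invS_small _ (e ^+ 2 / (hnorm (T x) ^+ 2 + 1)).
  by rewrite divr_gt0 ?exprn_gt0.
pose n := maxn N1 N2.
have /hN1 nz : (N1 <= n)%N by rewrite leq_maxl.
have /hN2 : (N2 <= n)%N by rewrite leq_maxr.
rewrite ler_pdivlMr // mulrC => /(le_trans (du n)) dn.
have {dn} : `|d (u n)| <= e.
  by apply: le_sqr (ltW e0) _; rewrite real_normK ?num_real.
have := dz n; have : hnorm (T x) * M * hnorm (u n - z) <= hnorm (T x) * M * e.
  by rewrite ler_wpM2l ?mulr_ge0 ?hnorm_ge0.
have := ler_normD (d z - d (u n)) (d (u n)); rewrite subrK; lra.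
Qed.

(** * Bounded operators *)

Lemma linD (A : H -> H) (Alin : linear A) x y : A (x + y) = A x + A y.
Proof. by rewrite -{1}[x]scale1r Alin scale1r. Qed.

Lemma lin0 (A : H -> H) (Alin : linear A) : A 0 = 0.
Proof. by apply: (addrI (A 0)); rewrite -(linD Alin) !addr0. Qed.

Lemma linZ (A : H -> H) (Alin : linear A) c x : A (c *: x) = c *: A x.
Proof. by rewrite -[c *: x]addr0 Alin (lin0 Alin) addr0. Qed.

Lemma linN (A : H -> H) (Alin : linear A) x : A (- x) = - A x.
Proof. by rewrite -scaleN1r (linZ Alin) scaleN1r. Qed.

Lemma linB (A : H -> H) (Alin : linear A) x y : A (x - y) = A x - A y.
Proof. by rewrite (linD Alin) (linN Alin). Qed.

Lemma lin_sum (A : H -> H) (Alin : linear A) n (F : nat -> H) :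
  A (\sum_(0 <= k < n) F k) = \sum_(0 <= k < n) A (F k).
Proof.
elim: n => [|n ih]; first by rewrite !big_nil (lin0 Alin).
by rewrite !big_nat_recr //= (linD Alin) ih.
Qed.


Lemma bop_bound A : bop ip A -> exists2 M, 0 <= M & forall x, hnorm (A x) <= M * hnorm x.
Proof.
move=> [_ [M AM]]; exists `|M| => // x; apply: le_trans (AM x) _.
by rewrite ler_wpM2r ?hnorm_ge0 // ler_norm.
Qed.

(** The case [T = id] of [lax_milgram] represents the real part of [phi]; the imaginary part follows
    by evaluating at i x. *)
Lemma riesz (phi : H -> C) (K : R) :
  (forall c x y, phi (c *: x + y) = c * phi x + phi y) -> 0 <= K ->
  (forall x, cnorm (phi x) <= K * hnorm x) ->
  exists y, forall x, phi x = herm x y.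
Proof.
move=> phiL K0 phiK.
have phiD x y : phi (x + y) = phi x + phi y by rewrite -{1}[x]scale1r phiL mul1r.
have phi0 : phi 0 = 0 by apply: (addrI (phi 0)); rewrite -phiD !addr0.
have phiZ c x : phi (c *: x) = c * phi x by rewrite -[c *: x]addr0 phiL phi0 addr0.
have [//||||||y hy] := @lax_milgram id (fun x => Re (phi x)) 1 1 K _ ltr01 ler01 K0.
- by move=> x; rewrite mul1r.
- by move=> x; rewrite mul1r.
- by move=> x y; rewrite phiD ReD.
- by move=> a x; rewrite phiZ ReM /= mul0r subr0.
- by move=> x; apply: le_trans (Re_le_cnorm _) (phiK x).
exists y => x; apply: eqC; first by rewrite hy.
by have := hy ('i%C *: x); rewrite /= hermZl phiZ !ReImE /=; lra.
Qed.

(** Riesz representation of [x |-> herm (A x) y] for each [y]. Without it nothing could be said of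
    [adj], a choice with default value 0. *)
Lemma adj_exists A : bop ip A ->
  exists B, bop ip B /\ forall x y, herm (A x) y = herm x (B y).
Proof.
move=> Ab; have [M M0 AM] := bop_bound Ab; have [Al _] := Ab.
have /choice[B AB] : forall y, exists z, forall x, herm (A x) y = herm x z.
  move=> y; apply: (@riesz _ (M * hnorm y)).
  - by move=> c x z; rewrite (linD Al) (linZ Al) hermDl hermZl.
  - by rewrite mulr_ge0 ?hnorm_ge0.
  - move=> x; apply: le_trans (cauchy_schwarz _ _) _.
    by rewrite mulrAC ler_wpM2r ?hnorm_ge0.
exists B; split=> [|x y]; last exact: AB.
split=> [c x y|].
  by apply: herm_eqr => z; rewrite -AB !hermDr !hermZr !AB.
exists M => x; have [B0|B0] := eqVneq (hnorm (B x)) 0.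
  by rewrite B0 mulr_ge0 ?hnorm_ge0.
have Bp : 0 < hnorm (B x) by rewrite lt0r B0 hnorm_ge0.
rewrite -(ler_pM2l Bp) -expr2.
have -> : hnorm (B x) ^+ 2 = Re (herm (A (B x)) x) by rewrite AB herm_sqr.
apply: le_trans (Re_herm_le _ _) _.
by rewrite mulrA (mulrC (hnorm (B x))) ler_wpM2r ?hnorm_ge0.
Qed.

Lemma adj_spec A : bop ip A -> bop ip (adj ip A) /\ forall x y, herm (A x) y = herm x (adj ip A y).
Proof. by move=> /adj_exists[B hB]; rewrite /adj; case: xgetP => [_ -> //|/(_ B)]. Qed.

Lemma adj_unique A B : bop ip A -> (forall x y, herm (A x) y = herm x (B y)) -> adj ip A = B.
Proof.
by move=> /adj_spec[_ h] AB; apply: funext => y; apply: herm_eqr => x; rewrite -h AB.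
Qed.

Lemma bop_adj A : bop ip A -> bop ip (adj ip A).
Proof. by case/adj_spec. Qed.

Lemma bop_id : bop ip idfun.
Proof. by split=> //; exists 1 => x; rewrite mul1r. Qed.

Lemma bop_comp A B : bop ip A -> bop ip B -> bop ip (A \o B).
Proof.
move=> Ab Bb; have [Al _] := Ab; have [Bl _] := Bb.
have [M M0 AM] := bop_bound Ab; have [N N0 BN] := bop_bound Bb.
split=> [c x y|]; first by rewrite /= Bl Al.
exists (M * N) => x; apply: le_trans (AM _) _.
by rewrite -mulrA ler_wpM2l.
Qed.

Lemma bop_add A B : bop ip A -> bop ip B -> bop ip (A + B).
Proof.
move=> Ab Bb; have [Al _] := Ab; have [Bl _] := Bb.
have [M M0 AM] := bop_bound Ab; have [N N0 BN] := bop_bound Bb.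
split=> [c x y|].
  by rewrite !fctE Bl Al scalerDr addrACA.
exists (M + N) => x; apply: le_trans (hnormD _ _) _.
by rewrite mulrDl lerD.
Qed.

Lemma bop_scale c A : bop ip A -> bop ip (c *: A).
Proof.
move=> Ab; have [Al _] := Ab; have [M M0 AM] := bop_bound Ab.
split=> [d x y|].
  by rewrite !fctE Al scalerDr !scalerA mulrC.
exists (cnorm c * M) => x; rewrite fctE hnormZ.
by rewrite -mulrA ler_wpM2l ?cnorm_ge0.
Qed.

Lemma bop_opp A : bop ip A -> bop ip (- A).
Proof. by move=> /(bop_scale (-1)); rewrite scaleN1r. Qed.

Lemma bop_zero : bop ip 0.
Proof. by rewrite -(scale0r idfun); apply: bop_scale bop_id. Qed.

Lemma cconjZ c x : cconj (c *: x) = conjc c *: cconj x :> H.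
Proof.
case: c x => a b [u v]; rewrite /cconj !scaleE /=; congr pair.
  by rewrite scalerN scaleNr opprK.
by rewrite scalerN scaleNr opprD.
Qed.

Lemma cconjD x y : cconj (x + y) = cconj x + cconj y :> H.
Proof. by rewrite /cconj /= opprD. Qed.

Lemma cconjK x : cconj (cconj x) = x :> H.
Proof. by case: x => u v; rewrite /cconj /= opprK. Qed.

Lemma herm_cconj x y : herm (cconj x) (cconj y) = conjc (herm x y).
Proof.
rewrite /cconj !hermE; apply: eqC; rewrite /= !(linearNr, linearNl) /=.
  by rewrite opprK.
ring.
Qed.

Lemma hnorm_cconj x : hnorm (cconj x) = hnorm x.
Proof. by rewrite /Defs.hnorm herm_cconj ReJ. Qed.

Lemma bop_cbar A : bop ip A -> bop ip (cbar A).
Proof.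
move=> Ab; have [Al _] := Ab; have [M M0 AM] := bop_bound Ab.
split=> [d x y|].
  by rewrite /cbar /= cconjD cconjZ Al cconjD cconjZ conjcK.
by exists M => x; rewrite /cbar /= hnorm_cconj -[hnorm x]hnorm_cconj.
Qed.

(** Bundling boundedness turns operators into a ring and a complex module, so that identities
    between compositions are proved by ring rewriting; [bov] returns to the plain maps of the
    statement. *)
Record bo := Bo { bov :> H -> H ; bov_bop : bop ip bov }.

Lemma bo_eq (A B : bo) : (forall x, A x = B x) -> A = B.
Proof.
case: A B => [A Ab] [B Bb] /= /funext AB; subst B.
by congr Bo; exact: Prop_irrelevance.
Qed.

HB.instance Definition _ := gen_eqMixin bo.
HB.instance Definition _ := gen_choiceMixin bo.

Definition bo_add (A B : bo) := Bo (bop_add (bov_bop A) (bov_bop B)).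
Definition bo_opp (A : bo) := Bo (bop_opp (bov_bop A)).
Definition bo_zero := Bo bop_zero.
Definition bo_mul (A B : bo) := Bo (bop_comp (bov_bop A) (bov_bop B)).
Definition bo_one := Bo bop_id.
Definition bo_scale c (A : bo) := Bo (bop_scale c (bov_bop A)).

Lemma bo_addA : associative bo_add.
Proof. by move=> A B D; apply: bo_eq => x; rewrite /= !fctE addrA. Qed.
Lemma bo_addC : commutative bo_add.
Proof. by move=> A B; apply: bo_eq => x; rewrite /= !fctE addrC. Qed.
Lemma bo_add0 : left_id bo_zero bo_add.
Proof. by move=> A; apply: bo_eq => x; rewrite /= !fctE add0r. Qed.
Lemma bo_addN : left_inverse bo_zero bo_opp bo_add.
Proof. by move=> A; apply: bo_eq => x; rewrite /= !fctE addNr. Qed.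
HB.instance Definition _ := GRing.isZmodule.Build bo bo_addA bo_addC bo_add0 bo_addN.

Lemma bo_linear (A : bo) : linear A. Proof. by case: A => A []. Qed.

Lemma bo_mulA : associative bo_mul.
Proof. by move=> A B D; apply: bo_eq. Qed.
Lemma bo_mul1 : left_id bo_one bo_mul.
Proof. by move=> A; apply: bo_eq. Qed.
Lemma bo_mul1r : right_id bo_one bo_mul.
Proof. by move=> A; apply: bo_eq. Qed.
Lemma bo_mulDl : left_distributive bo_mul bo_add.
Proof. by move=> A B D; apply: bo_eq. Qed.
Lemma bo_mulDr : right_distributive bo_mul bo_add.
Proof. by move=> A B D; apply: bo_eq => x /=; rewrite !fctE /= (linD (bo_linear A)). Qed.
HB.instance Definition _ := GRing.Zmodule_isPzRing.Build bo
  bo_mulA bo_mul1 bo_mul1r bo_mulDl bo_mulDr.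

Lemma bo_scaleA a b A : bo_scale a (bo_scale b A) = bo_scale (a * b) A.
Proof. by apply: bo_eq => x; rewrite /= !fctE scalerA. Qed.
Lemma bo_scale1 : left_id 1 bo_scale.
Proof. by move=> A; apply: bo_eq => x; rewrite /= !fctE scale1r. Qed.
Lemma bo_scaleDr : right_distributive bo_scale +%R.
Proof. by move=> a A B; apply: bo_eq => x; rewrite /= !fctE scalerDr. Qed.
Lemma bo_scaleDl A : {morph bo_scale^~ A : a b / a + b}.
Proof. by move=> a b; apply: bo_eq => x; rewrite /= !fctE scalerDl. Qed.
HB.instance Definition _ := GRing.Zmodule_isLmodule.Build C bo
  bo_scaleA bo_scale1 bo_scaleDr bo_scaleDl.

Implicit Types A B D : bo.

Lemma boDE A B x : (A + B) x = A x + B x. Proof. by []. Qed.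
Lemma boNE A x : (- A) x = - A x. Proof. by []. Qed.
Lemma boME A B x : (A * B) x = A (B x). Proof. by []. Qed.
Lemma boZE c A x : (c *: A) x = c *: A x. Proof. by []. Qed.
Lemma bo1E x : (1 : bo) x = x. Proof. by []. Qed.
Lemma bo0E x : (0 : bo) x = 0. Proof. by []. Qed.
Definition boE := (boDE, boNE, boME, boZE, bo1E, bo0E).

Lemma bo_val_inj A B : bov A = bov B -> A = B.
Proof. by move=> e; apply: bo_eq => x; rewrite e. Qed.

Lemma boZl c A B : (c *: A) * B = c *: (A * B).
Proof. exact: bo_eq. Qed.
Lemma boZr c A B : A * (c *: B) = c *: (A * B).
Proof. by apply: bo_eq => x; rewrite !boE (linZ (bo_linear A)). Qed.

Definition star A := Bo (bop_adj (bov_bop A)).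
Definition cb A := Bo (bop_cbar (bov_bop A)).

Lemma starP A x y : herm (A x) y = herm x (star A y).
Proof. by have [_] := adj_spec (bov_bop A). Qed.

Lemma star_unique A B : (forall x y, herm (A x) y = herm x (B y)) -> star A = B.
Proof. by move=> h; apply: bo_val_inj; exact: adj_unique (bov_bop A) h. Qed.

Lemma starK A : star (star A) = A.
Proof. by apply: star_unique => x y; rewrite hermJ -starP -hermJ. Qed.
Lemma starP' A x y : herm x (A y) = herm (star A x) y.
Proof. by rewrite starP starK. Qed.
Lemma starM A B : star (A * B) = star B * star A.
Proof. by apply: star_unique => x y; rewrite !boE !starP. Qed.
Lemma starD A B : star (A + B) = star A + star B.
Proof. by apply: star_unique => x y; rewrite !boE hermDl hermDr !starP. Qed.
Lemma starN A : star (- A) = - star A.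
Proof. by apply: star_unique => x y; rewrite !boE hermNl hermNr !starP. Qed.
Lemma starB A B : star (A - B) = star A - star B.
Proof. by rewrite starD starN. Qed.
Lemma starZ c A : star (c *: A) = conjc c *: star A.
Proof. by apply: star_unique => x y; rewrite !boE hermZl hermZr !starP conjcK. Qed.
Lemma star1 : star 1 = 1.
Proof. by apply: star_unique. Qed.
Lemma cbE A x : cb A x = cconj (A (cconj x)). Proof. by []. Qed.
Lemma cbK A : cb (cb A) = A.
Proof. by apply: bo_eq => x; rewrite !cbE !cconjK. Qed.
Lemma cbM A B : cb (A * B) = cb A * cb B.
Proof. by apply: bo_eq => x; rewrite !boE !cbE !boE cconjK. Qed.
Lemma cbD A B : cb (A + B) = cb A + cb B.
Proof. by apply: bo_eq => x; rewrite !boE !cbE !boE cconjD. Qed.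
Lemma cbZ c A : cb (c *: A) = conjc c *: cb A.
Proof. by apply: bo_eq => x; rewrite !boE !cbE !boE cconjZ. Qed.
Lemma cbN A : cb (- A) = - cb A.
Proof. by rewrite -scaleN1r cbZ conjcN conjc1 scaleN1r. Qed.
Lemma cbB A B : cb (A - B) = cb A - cb B.
Proof. by rewrite cbD cbN. Qed.
Lemma cb1 : cb 1 = 1.
Proof. by apply: bo_eq => x; rewrite cbE !boE cconjK. Qed.
Lemma star_cb A : star (cb A) = cb (star A).
Proof.
apply: star_unique => x y.
by rewrite !cbE -{1}[y]cconjK herm_cconj starP -herm_cconj cconjK.
Qed.

(** An upper bound for the operator norm instead of the norm itself: sums and products of operators
    then need only sums and products of bounds. *)
Definition bnd A (M : R) := 0 <= M /\ forall x, hnorm (A x) <= M * hnorm x.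

Lemma bnd_ex A : exists M, bnd A M.
Proof. by have [M M0 AM] := bop_bound (bov_bop A); exists M. Qed.

Lemma bndD A B M N : bnd A M -> bnd B N -> bnd (A + B) (M + N).
Proof.
move=> [M0 AM] [N0 BN]; split=> [|x]; first exact: addr_ge0.
by rewrite mulrDl; apply: le_trans (hnormD _ _) _; rewrite lerD.
Qed.

Lemma bndM A B M N : bnd A M -> bnd B N -> bnd (A * B) (M * N).
Proof.
move=> [M0 AM] [N0 BN]; split=> [|x]; first exact: mulr_ge0.
by apply: le_trans (AM _) _; rewrite -mulrA ler_wpM2l.
Qed.

Lemma bndZ c A M : bnd A M -> bnd (c *: A) (cnorm c * M).
Proof.
move=> [M0 AM]; split=> [|x]; first by rewrite mulr_ge0 ?cnorm_ge0.
by rewrite boE hnormZ -mulrA ler_wpM2l ?cnorm_ge0.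
Qed.

Lemma bnd_star A M : bnd A M -> bnd (star A) M.
Proof.
move=> [M0 AM]; split=> // x; have [B0|B0] := eqVneq (hnorm (star A x)) 0.
  by rewrite B0 mulr_ge0 ?hnorm_ge0.
have Bp : 0 < hnorm (star A x) by rewrite lt0r B0 hnorm_ge0.
rewrite -(ler_pM2l Bp) -expr2.
have -> : hnorm (star A x) ^+ 2 = Re (herm (A (star A x)) x) by rewrite starP herm_sqr.
apply: le_trans (Re_herm_le _ _) _.
by rewrite mulrA (mulrC (hnorm (star A x))) ler_wpM2r ?hnorm_ge0.
Qed.

(** Lax-Milgram solves the normal equation [star A (A z) = star A y], and injectivity of [star A]
    then gives [A z = y]. The constant [(M + 1)^-1] allows for [M = 0]. *)
Lemma inverse_bounded_below A (M : R) : 0 <= M -> (forall x, hnorm x <= M * hnorm (A x)) ->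
  (forall x, star A x = 0 -> x = 0) -> exists2 B, A * B = 1 /\ B * A = 1 & bnd B M.
Proof.
move=> M0 AM A0; have [K [K0 AK]] := bnd_ex A.
have M1 : 0 < M + 1 by rewrite ltr_wpDl.
have /choice[S AS] : forall y, exists z, A z = y.
  move=> y; have [|||||||||z hz] :=
    @lax_milgram A (fun x => Re (herm (A x) y)) (M + 1)^-1 K (K * hnorm y).
  - exact: bo_linear.
  - by rewrite invr_gt0.
  - by [].
  - by rewrite mulr_ge0 ?hnorm_ge0.
  - move=> x; rewrite mulrC ler_pdivrMr //; apply: le_trans (AM x) _.
    by rewrite mulrC ler_wpM2l ?hnorm_ge0 // lerDl.
  - by [].
  - by move=> x x'; rewrite (linD (bo_linear A)) hermDl ReD.
  - by move=> a x; rewrite (linZ (bo_linear A)) hermZl ReM /= mul0r subr0.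
  - move=> x; apply: le_trans (Re_le_cnorm _) _; apply: le_trans (cauchy_schwarz _ _) _.
    by rewrite mulrAC ler_wpM2r ?hnorm_ge0.
  exists z; apply/eqP; rewrite -subr_eq0; apply/eqP/A0; apply: Re_herm_eqr => x.
  by rewrite -starP hermBr ReD ReN hz subrr herm0r.
have Ainj x y : A x = A y -> x = y.
  move=> Axy; apply/eqP; rewrite -subr_eq0; apply/eqP/hnorm_eq0/le_anti.
  rewrite hnorm_ge0 andbT; apply: le_trans (AM _) _.
  by rewrite (linB (bo_linear A)) Axy subrr hnorm0 mulr0.
have SM x : hnorm (S x) <= M * hnorm x by rewrite -{2}(AS x).
have Sb : bop ip S.
  split=> [c x y|]; last by exists M.
  by apply: Ainj; rewrite (linD (bo_linear A)) (linZ (bo_linear A)) !AS.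
exists (Bo Sb) => //; split; apply: bo_eq => x; rewrite !boE; first exact: AS.
by apply: Ainj; rewrite AS.
Qed.

(** Stands in for the Neumann series: [1 + E] is bounded below by 1/2, and so is its adjoint,
    because [star E] has the same bound as [E]. *)
Lemma inverse_near1 (E : bo) : (forall x, hnorm (E x) <= 2^-1 * hnorm x) ->
  exists2 B, (1 + E) * B = 1 /\ B * (1 + E) = 1 & bnd B 2.
Proof.
have aux (F : bo) : (forall x, hnorm (F x) <= 2^-1 * hnorm x) ->
    forall x, hnorm x <= 2 * hnorm ((1 + F) x).
  move=> h x; have := hnormB ((1 + F) x) (F x); have := h x.
  rewrite !boE addrK; move: (hnorm x) (hnorm _) (hnorm _) => *; lra.
move=> h; apply: inverse_bounded_below; [by []|exact: aux|move=> x].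
have [_ h'] : bnd (star E) 2^-1 by apply: bnd_star; split=> //; rewrite invr_ge0.
rewrite starD star1 => x0; apply/hnorm_eq0/le_anti; rewrite hnorm_ge0 andbT.
by apply: le_trans (aux _ h' x) _; rewrite x0 hnorm0 mulr0.
Qed.

(** * Orthonormal bases *)

Lemma ip_le u v : ip u v <= `|u| * `|v|.
Proof.
have hn w : hnorm ((w, 0) : H) = `|w|.
  apply: eq_sqr; rewrite ?hnorm_ge0 ?normr_ge0 //.
  by rewrite hnorm_sqrE /= normr0 expr0n addr0.
have := Re_herm_le ((u, 0) : H) ((v, 0) : H); rewrite !hn.
by rewrite hermE /= linear0r addr0.
Qed.

(** If [u] is nonzero, some [s k] is closer to [u] than [|u|], whereas orthogonality gives |u|^2 =
    <u, u - s k> <= |u| |u - s k|. *)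
Lemma dense_ortho (s : nat -> V) u : dense (range s) -> (forall k, ip u (s k) = 0) -> u = 0.
Proof.
move=> s_dense us; apply/eqP; rewrite -normr_eq0; apply/eqP/le_anti; rewrite normr_ge0 andbT.
rewrite leNgt; apply/negP => u0.
have [|v [/= + [k _ vk]]] := @s_dense (ball u `|u|) _ (ball_open u `|u|).
  by exists u; apply: ballxx.
rewrite -ball_normE /= -vk => uv.
have : `|u| ^+ 2 <= `|u| * `|u - s k|.
  by rewrite -ip_norm -[X in X <= _](subr0 _) -(us k) -linearBr ip_le.
by rewrite expr2 ler_pM2l // leNgt uv.
Qed.

Definition gs_res (E : seq V) u := u - \sum_(0 <= i < size E) ip u E`_i *: E`_i.

Definition gs_ortho (E : seq V) := forall i j, (i < size E)%N -> (j < size E)%N ->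
  ip E`_i E`_j = (i == j)%:R.

Lemma gs_sumr (E : seq V) u (c : nat -> R) :
  ip (\sum_(0 <= i < size E) c i *: E`_i) u = \sum_(0 <= i < size E) c i * ip E`_i u.
Proof.
elim/big_ind2: _ => [|x a y b <- <-|i _]; first by rewrite linear0l.
  by rewrite linearDl.
by rewrite ipZl.
Qed.

Lemma gs_res_ortho (E : seq V) u j : gs_ortho E -> (j < size E)%N -> ip (gs_res E u) E`_j = 0.
Proof.
move=> EO jE; rewrite /gs_res linearBl /= gs_sumr.
rewrite big_mkord (bigD1 (Ordinal jE)) //= EO // eqxx mulr1 big1 ?addr0 ?subrr // => i ij.
by rewrite EO // (_ : (_ == _) = false) ?mulr0 //; apply/negbTE.
Qed.

(** The vector is the normalised residual of the first member of the dense sequence outside the span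
    of [E]. If there were none, every residual would be orthogonal to the dense sequence and [E]
    would span [V]. For a list that is not orthonormal [v] is arbitrary, so that the step can be
    iterated as a total function. *)
Lemma gs_step (s : nat -> V) (E : seq V) : dense (range s) ->
  (~ exists (n : nat) (b : 'I_n -> V), forall u : V,
        exists c : 'I_n -> R, u = \sum_i c i *: b i) ->
  exists v, gs_ortho E ->
  [/\ `|v| = 1, forall j, (j < size E)%N -> ip v E`_j = 0 &
    exists k, [/\ gs_res E (s k) != 0, forall j, (j < k)%N -> gs_res E (s j) = 0
      & exists a, gs_res E (s k) = a *: v /\ ip (s k) v = a]].
Proof.
move=> s_dense infdim.
have [EO|nEO] := pselect (gs_ortho E); last by exists 0.
have [allz|] := pselect (forall k, gs_res E (s k) = 0).
  exfalso; apply: infdim; exists (size E), (fun i => E`_i) => u.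
  exists (fun i => ip u E`_i); apply/eqP; rewrite -subr_eq0; apply/eqP.
  rewrite -(big_mkord predT (fun i => ip u E`_i *: E`_i)) -/(gs_res E u).
  apply: (dense_ortho s_dense) => k.
  have := allz k => /eqP; rewrite subr_eq0 => /eqP ->.
  rewrite ipC gs_sumr big_nat big1 // => i /andP[_ iE].
  by rewrite [ip _ (gs_res _ _)]ipC gs_res_ortho ?mulr0.
move=> /existsNP[k0 /eqP k0n].
have ex : exists k, gs_res E (s k) != 0 by exists k0.
case: (ex_minnP ex) => k kn kmin.
set r := gs_res E (s k) in kn *.
have rn : `|r| != 0 by rewrite normr_eq0.
exists (`|r|^-1 *: r) => _; split.
- by rewrite normrZ ger0_norm ?invr_ge0 // mulVf.
- by move=> j jE; rewrite ipZl gs_res_ortho ?mulr0.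
exists k; split => //.
  move=> j jk; apply/eqP; apply: contraTT jk => /kmin.
  by rewrite -leqNgt.
exists `|r|; split; first by rewrite scalerA divff // scale1r.
have sk : s k = r + \sum_(0 <= i < size E) ip (s k) E`_i *: E`_i by rewrite /r /gs_res subrK.
rewrite ipZr sk linearDl /= ip_norm gs_sumr big_nat big1 => [|i /andP[_ iE]].
  by rewrite addr0 expr2 mulrA mulVf // mul1r.
by rewrite [ip _ r]ipC /r gs_res_ortho ?mulr0.
Qed.

Lemma onb_exists (s : nat -> V) : dense (range s) ->
  (~ exists (n : nat) (b : 'I_n -> V), forall u : V,
        exists c : 'I_n -> R, u = \sum_i c i *: b i) ->
  exists e, onb ip e.
Proof.
move=> s_dense infdim.
have /choice[nxt nxtP] : forall E, _ := fun E => gs_step E s_dense infdim.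
pose G := fix G n := if n is m.+1 then rcons (G m) (nxt (G m)) else [::].
pose e n := nxt (G n).
have Gs n : size (G n) = n by elim: n => //= n ih; rewrite size_rcons ih.
have Ge n i : (i < n)%N -> (G n)`_i = e i.
  elim: n => // n ih; rewrite ltnS leq_eqVlt /= nth_rcons Gs => /predU1P[->|i_n].
    by rewrite ltnn eqxx.
  by rewrite i_n ih.
have GO n : gs_ortho (G n).
  elim: n => [|n ih] i j; rewrite ?Gs //.
  have [e1 e0 _] := nxtP _ ih; rewrite Gs in e0.
  have en k : (k < n)%N -> ip (e n) (e k) = 0 by move=> kn; rewrite -(Ge _ _ kn) e0.
  move=> i_n jn; rewrite !Ge //.
  move: i_n jn; rewrite !ltnS (leq_eqVlt i) (leq_eqVlt j) => /predU1P[->|i_n] /predU1P[->|jn].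
  - by rewrite ip_norm e1 eqxx expr1n.
  - by rewrite en // gtn_eqF.
  - by rewrite ipC en // ltn_eqF.
  - by rewrite -(Ge n i) // -(Ge n j) // ih ?Gs.
have eO i j : ip (e i) (e j) = (i == j)%:R.
  have im : (i < (maxn i j).+1)%N by rewrite ltnS leq_maxl.
  have jm : (j < (maxn i j).+1)%N by rewrite ltnS leq_maxr.
  by rewrite -(Ge _ _ im) -(Ge _ _ jm) GO ?Gs.
pose rs n u := u - \sum_(0 <= i < n) ip u (e i) *: e i.
have rsE n u : gs_res (G n) u = rs n u.
  rewrite /gs_res Gs /rs; congr (_ - _); apply: eq_big_nat => i /andP[_ i_n].
  by rewrite Ge.
have rsS n u : rs n.+1 u = rs n u - ip u (e n) *: e n.
  by rewrite /rs big_nat_recr //= opprD addrA.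
have rs0 n u : rs n u = 0 -> rs n.+1 u = 0.
  move=> u0; rewrite rsS u0 sub0r.
  move: u0 => /eqP; rewrite subr_eq0 => /eqP ->.
  have -> : ip (\sum_(0 <= i < n) ip u (e i) *: e i) (e n) = 0.
    rewrite big_nat; elim/big_ind: _ => [|y z y0 z0|i /andP[_ i_n]].
    - by rewrite linear0l.
    - by rewrite linearDl /= y0 z0 addr0.
    - by rewrite ipZl eO ltn_eqF // mulr0.
  by rewrite scale0r oppr0.
(* Each step removes the least index not yet spanned, so after [n] steps the first [n] members of
   the dense sequence are spanned. *)
have rss n j : (j < n)%N -> rs n (s j) = 0.
  elim: n j => // n ih j; rewrite ltnS leq_eqVlt => /predU1P[->|jn]; last exact/rs0/ih.
  have [_ _ [k [kn kmin [a [ka kv]]]]] := nxtP _ (GO n).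
  have : (n <= k)%N.
    by rewrite leqNgt; apply: contra_neqN kn => /ih; rewrite -rsE.
  rewrite leq_eqVlt => /predU1P[nk|nk]; last by apply: rs0; rewrite -rsE kmin.
  subst k.
  by rewrite rsS -rsE ka -/(e n) -kv subrr.
(* A real orthonormal basis of [V] is already one of the complexification: the two components of [x]
   are tested separately. *)
exists (fun n => (e n, 0)); split=> [i j|x xe].
  by rewrite hermE /= eO !linear0l !linear0r !addr0 subr0; case: eqP => _; apply: eqC.
have xe1 i : ip x.1 (e i) = 0.
  by have := congr1 (@complex.Re R) (xe i); rewrite hermE /= linear0r addr0.
have xe2 i : ip x.2 (e i) = 0.
  by have := congr1 (@complex.Im R) (xe i); rewrite hermE /= linear0r subr0.
have aux u : (forall i, ip u (e i) = 0) -> u = 0.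
  move=> ue; apply: (dense_ortho s_dense) => k.
  have /eqP := rss k.+1 k (ltnSn _); rewrite subr_eq0 => /eqP ->.
  elim/big_ind: _ => [|y z|i _]; first by rewrite linear0r.
    by rewrite linearDr /= => -> ->; rewrite addr0.
  by rewrite ipZr ue mulr0.
by case: x xe1 xe2 {xe} => x1 x2 /= /aux -> /aux ->.
Qed.

Definition proj (e : nat -> H) n x := \sum_(0 <= i < n) herm x (e i) *: e i.

Lemma ortho_sum_sqr (e : nat -> H) (c : nat -> C) m d :
  (forall i j, herm (e i) (e j) = (i == j)%:R) ->
  hnorm (\sum_(m <= i < m + d) c i *: e i) ^+ 2 =
  \sum_(m <= i < m + d) cnorm (c i) ^+ 2.
Proof.
move=> eO; elim: d => [|d ih].
  by rewrite addn0 !big_geq // hnorm0 expr0n.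
rewrite addnS !big_nat_recr ?leq_addr //= hnormD_sqr ih hnormZ exprMn.
have -> : herm (\sum_(m <= i < m + d) c i *: e i) (c (m + d)%N *: e (m + d)%N) = 0.
  rewrite herm_suml big_nat big1 // => i /andP[_ im].
  by rewrite hermZl hermZr eO ltn_eqF // !mulr0.
have -> : hnorm (e (m + d)%N) ^+ 2 = 1.
  by have := herm_sqr (e (m + d)%N); rewrite eO eqxx => /(congr1 (@complex.Re R)).
by rewrite mulr0 addr0 mulr1.
Qed.

Lemma proj_sqr (e : nat -> H) (e_onb : onb ip e) n x :
  hnorm (proj e n x) ^+ 2 = \sum_(0 <= i < n) cnorm (herm x (e i)) ^+ 2.
Proof. exact: (ortho_sum_sqr (fun i => herm x (e i)) 0 n e_onb.1). Qed.

Lemma herm_proj (e : nat -> H) (e_onb : onb ip e) n x :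
  herm x (proj e n x) = (hnorm (proj e n x) ^+ 2)%:C.
Proof.
rewrite (proj_sqr e_onb) rmorph_sum /= /proj herm_sumr; apply: eq_bigr => i _.
by rewrite hermZr mulrC mulJ.
Qed.

Lemma pythagoras (e : nat -> H) (e_onb : onb ip e) n x :
  hnorm (x - proj e n x) ^+ 2 = hnorm x ^+ 2 - hnorm (proj e n x) ^+ 2.
Proof.
rewrite hnormD_sqr hnormN hermNr ReN (herm_proj e_onb) /=; ring.
Qed.

Lemma bessel (e : nat -> H) (e_onb : onb ip e) n x : hnorm (proj e n x) <= hnorm x.
Proof.
by apply: le_sqr (hnorm_ge0 _) _; rewrite -subr_ge0 -(pythagoras e_onb) sqr_ge0.
Qed.

(** The partial sums are Cauchy by Bessel's inequality, and their limit has the same coefficients as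
    [x]; totality of the basis identifies the two. *)
Lemma proj_cvg (e : nat -> H) (e_onb : onb ip e) x eps : 0 < eps ->
  exists N, forall n, (N <= n)%N -> hnorm (proj e n x - x) <= eps.
Proof.
pose s n := hnorm (proj e n x) ^+ 2.
have sD m d : s (m + d)%N = s m + \sum_(m <= i < m + d) cnorm (herm x (e i)) ^+ 2.
  by rewrite /s !(proj_sqr e_onb) -big_cat_nat // leq_addr.
have pD m d : proj e (m + d) x - proj e m x = \sum_(m <= i < m + d) herm x (e i) *: e i.
  by rewrite /proj (@big_cat_nat _ _ _ m) ?leq_addr //= addrAC subrr add0r.
have s_sup : has_sup (range s).
  split; first by exists (s 0%N), 0%N.
  exists (hnorm x ^+ 2) => _ [n _ <-].
  by rewrite ler_pXn2r ?nnegrE ?hnorm_ge0 // (bessel e_onb).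
have [|y hy] := @hcomplete (fun n => proj e n x).
  move=> d d0.
  have [_ [N _ <-] sN] := sup_adherent (exprn_gt0 2 d0) s_sup.
  have close m k : (N <= m)%N -> hnorm (proj e (m + k) x - proj e m x) <= d.
    move=> Nm; apply: le_sqr (ltW d0) _.
    rewrite pD ortho_sum_sqr ?e_onb.1 //; last by case: e_onb.
    have := sD m k; have : s (m + k)%N <= sup (range s).
      by apply: ub_le_sup; [case: s_sup | exists (m + k)%N].
    have : s N <= s m.
      by rewrite -(subnKC Nm) sD lerDl sumr_ge0 // => i _; rewrite sqr_ge0.
    move: sN; move: (s _) (s _) (s _) (sup _) (\sum_(_ <= _ < _) _) (d ^+ 2) => *; lra.
  exists N => n m Nn Nm; case: (leqP n m) => [nm|/ltnW mn].
    by rewrite hnormBC -(subnKC nm) close.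
  by rewrite -(subnKC mn) close.
suff xy : x = y
  by move=> d0; have [N hN] := hy _ d0; exists N => n; rewrite [X in _ - X]xy; exact: hN.
apply/eqP; rewrite -subr_eq0; apply/eqP; have [_] := e_onb; apply => i.
apply: cnorm_eq0; apply/le_anti; rewrite cnorm_ge0 andbT.
apply: (@le_eps _ _ (hnorm (e i))) => [|d d0]; first exact: hnorm_ge0.
have [N hN] := hy _ d0.
have := hN (maxn N i.+1) (leq_maxl _ _).
set M := maxn N i.+1 => yM.
have -> : herm (x - y) (e i) = herm (proj e M x - y) (e i).
  rewrite !hermBl; congr (_ - _); rewrite /proj herm_suml.
  rewrite big_mkord (bigD1 (Ordinal (leq_maxr N i.+1 : (i < M)%N))) //=.
  rewrite hermZl (proj1 e_onb) eqxx mulr1 big1 ?addr0 // => j ji.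
  rewrite hermZl (proj1 e_onb) (_ : (_ == _) = false) ?mulr0 //.
  by apply/negbTE; apply: contra_neq ji => jE; apply: val_inj.
apply: le_trans (cauchy_schwarz _ _) _.
by rewrite mulrC ler_wpM2l ?hnorm_ge0.
Qed.

Lemma parseval (e : nat -> H) (e_onb : onb ip e) x :
  (fun n => hnorm (proj e n x) ^+ 2) @ \oo --> hnorm x ^+ 2.
Proof.
apply/cvgrPdist_le => d d0.
have [N hN] := proj_cvg e_onb x (etrans (sqrtr_gt0 d) d0).
exists N => // n /= /hN; rewrite -(pythagoras e_onb) ger0_norm ?sqr_ge0 // hnormBC => h.
by rewrite -(sqr_sqrtr (ltW d0)) ler_pXn2r ?nnegrE ?hnorm_ge0 ?sqrtr_ge0.
Qed.


(** * Hilbert-Schmidt operators *)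

Definition hs_le (A : H -> H) (M : R) (e : nat -> H) :=
  forall N, \sum_(0 <= n < N) hnorm (A (e n)) ^+ 2 <= M.

Lemma cvg_sumr N (f : nat -> nat -> R) (l : nat -> R) :
  (forall m, f m @ \oo --> l m) ->
  (fun k => \sum_(0 <= m < N) f m k) @ \oo --> \sum_(0 <= m < N) l m.
Proof.
move=> fl; elim: N => [|N ih].
  by under eq_fun do rewrite big_nil; rewrite big_nil; exact: cvg_cst.
under eq_fun do rewrite big_nat_recr //=.
by rewrite big_nat_recr //=; exact: cvgD.
Qed.

Lemma cvg_le_cst (f : nat -> R) l M : f @ \oo --> l -> (forall n, f n <= M) -> l <= M.
Proof.
move=> fl fM; apply: (@ler_cvg_to _ _ _ _ f (fun=> M)) fl (cvg_cst _) _.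
by apply: nearW.
Qed.

(* Expand [star A (f m)] in the basis e, exchange the two sums, and apply Bessel's
   inequality to f. *)
Lemma hs_le_star (A : bo) M e f : onb ip e -> onb ip f -> hs_le A M e -> hs_le (star A) M f.
Proof.
move=> eO fO AM N.
apply: (@cvg_le_cst (fun k => \sum_(0 <= m < N) hnorm (proj e k (star A (f m))) ^+ 2)).
  by apply: cvg_sumr => m; apply: parseval.
move=> K; apply: le_trans (AM K).
under eq_bigr do rewrite proj_sqr //.
rewrite exchange_big_nat /=; apply: ler_sum => n _.
have -> : \sum_(0 <= i < N) cnorm (herm (star A (f i)) (e n)) ^+ 2 =
   \sum_(0 <= i < N) cnorm (herm (A (e n)) (f i)) ^+ 2.
  by apply: eq_bigr => i _; rewrite hermJ cnormJ -starP.
by rewrite -proj_sqr // ler_pXn2r ?nnegrE ?hnorm_ge0 // (bessel fO).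
Qed.

Lemma hs_le_onb (A : bo) M e f : onb ip e -> onb ip f -> hs_le A M e -> hs_le A M f.
Proof.
move=> eO fO /(hs_le_star eO eO) /(hs_le_star eO fO).
by rewrite starK.
Qed.

Context (e0 : nat -> H) (e0_onb : onb ip e0).

(** The basis [e0] is what makes the sum unique: if there were no orthonormal basis, [basis_sum_to]
    would hold for every [t]. *)
Lemma basis_sumE f t : basis_sum_to ip f t -> basis_sum ip f = t.
Proof.
move=> ft; rewrite /basis_sum; case: xgetP => [t' _ ft'|/(_ t)//].
exact: cvg_unique (ft' _ e0_onb) (ft _ e0_onb).
Qed.

(** An upper bound for the Hilbert-Schmidt norm, valid in all bases at once; by [hs_le_onb] it may
    be checked in one of them. *)
Definition hsb (A : bo) M := 0 <= M /\ forall e, onb ip e -> hs_le A (M ^+ 2) e.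

Lemma hsb_e0 (A : bo) M : 0 <= M -> hs_le A (M ^+ 2) e0 -> hsb A M.
Proof. by move=> M0 AM; split=> // e eO; apply: hs_le_onb AM. Qed.

Lemma nd_sqr (A : bo) (e : nat -> H) :
  nondecreasing_seq (fun N => \sum_(0 <= n < N) hnorm (A (e n)) ^+ 2).
Proof.
by apply: nondecreasing_series => n _ _; rewrite sqr_ge0.
Qed.

(** The supremum of the partial sums in one basis bounds them in every other by [hs_le_onb], so all
    these suprema coincide. *)
Lemma hsb_sum (A : bo) M : hsb A M -> exists2 t, 0 <= t <= M ^+ 2 &
  basis_sum_to ip (fun x => hnorm (A x) ^+ 2) t.
Proof.
move=> [M0 AM].
pose s e := sup (range (fun N => \sum_(0 <= n < N) hnorm (A (e n)) ^+ 2)).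
have ub e : onb ip e -> has_ubound (range (fun N => \sum_(0 <= n < N) hnorm (A (e n)) ^+ 2)).
  by move=> eO; exists (M ^+ 2) => _ [n _ <-]; exact: AM.
have sP e N : onb ip e -> \sum_(0 <= n < N) hnorm (A (e n)) ^+ 2 <= s e.
  by move=> eO; apply: ub_le_sup; [exact: ub|exists N].
have sle e t : (forall N, \sum_(0 <= n < N) hnorm (A (e n)) ^+ 2 <= t) -> s e <= t.
  by move=> h; apply: ge_sup; [exists 0, 0%N => //; rewrite big_nil|move=> _ [n _ <-]].
have s_indep e : onb ip e -> s e = s e0.
  move=> eO; apply/le_anti/andP; split; apply: sle.
    by apply: (hs_le_onb e0_onb eO) => N; apply: sP.
  by apply: (hs_le_onb eO e0_onb) => N; apply: sP.
exists (s e0).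
  rewrite sle ?andbT; last by move=> N; apply: AM.
  by have := sP e0 0%N e0_onb; rewrite big_nil.
move=> e eO; rewrite -(s_indep _ eO).
by apply: nondecreasing_cvgn; [exact: nd_sqr|exact: ub].
Qed.

Lemma hsb_hs (A : bo) M : hsb A M -> hilbert_schmidt ip A.
Proof. by move=> /hsb_sum[t _ At]; split; [exact: bov_bop | exists t]. Qed.

Lemma hsb_hsnorm_le (A : bo) M : hsb A M -> hsnorm ip A <= M.
Proof.
move=> AM; have [t /andP[t0 tM] At] := hsb_sum AM.
rewrite /hsnorm (basis_sumE At); apply: le_sqr; first exact: AM.1.
by rewrite sqr_sqrtr.
Qed.

Lemma hs_hsb (A : bo) : hilbert_schmidt ip A -> hsb A (hsnorm ip A).
Proof.
move=> [_ [t At]]; rewrite /hsnorm (basis_sumE At).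
have h e N : onb ip e -> \sum_(0 <= n < N) hnorm (A (e n)) ^+ 2 <= t.
  move=> eO; have := At _ eO => et.
  have := nondecreasing_cvgn_le (nd_sqr A e) (cvgP _ et) N.
  by rewrite (cvg_lim _ et).
have t0 : 0 <= t by have := h e0 0%N e0_onb; rewrite big_nil.
by split=> [|e eO N]; [exact: sqrtr_ge0|rewrite sqr_sqrtr //; exact: h].
Qed.

Lemma hsb_star (A : bo) M : hsb A M -> hsb (star A) M.
Proof. by move=> [M0 AM]; split=> // e eO; apply: (hs_le_star eO eO); exact: AM. Qed.

Lemma hsbMl (A B : bo) b M : bnd B b -> hsb A M -> hsb (B * A) (b * M).
Proof.
move=> [b0 Bb] [M0 AM]; split=> [|e eO N]; first exact: mulr_ge0.
apply: (@le_trans _ _ (b ^+ 2 * \sum_(0 <= n < N) hnorm (A (e n)) ^+ 2)); last first.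
  by rewrite exprMn ler_wpM2l ?sqr_ge0 // AM.
rewrite mulr_sumr; apply: ler_sum => n _; rewrite -exprMn.
by rewrite ler_pXn2r ?nnegrE ?mulr_ge0 ?hnorm_ge0 // boE Bb.
Qed.

Lemma hsbMr (A B : bo) b M : bnd B b -> hsb A M -> hsb (A * B) (M * b).
Proof.
move=> /bnd_star Bb /hsb_star AM; rewrite -[A * B]starK starM mulrC.
exact/hsb_star/hsbMl.
Qed.

(** The constant 2 is not sharp: it comes from |a + b|^2 <= 2 |a|^2 + 2 |b|^2, and a finite bound is
    all that is asked for. *)
Lemma hsbD (A B : bo) M N : hsb A M -> hsb B N -> hsb (A + B) (2 * (M + N)).
Proof.
move=> [M0 AM] [N0 BN]; split=> [|e eO K]; first by rewrite mulr_ge0 ?addr_ge0.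
apply: (@le_trans _ _ (2 * \sum_(0 <= n < K) hnorm (A (e n)) ^+ 2 +
                       2 * \sum_(0 <= n < K) hnorm (B (e n)) ^+ 2)).
  rewrite !mulr_sumr -big_split; apply: ler_sum => n _.
  change (hnorm (A (e n) + B (e n)) ^+ 2 <=
    2 * hnorm (A (e n)) ^+ 2 + 2 * hnorm (B (e n)) ^+ 2).
  have := parallelogram (A (e n)) (B (e n)).
  have := sqr_ge0 (hnorm (A (e n) - B (e n))).
  lra.
by have := AM _ eO K; have := BN _ eO K; nra.
Qed.

Lemma hsb_le (A : bo) M N : M <= N -> hsb A M -> hsb A N.
Proof.
move=> MN [M0 AM]; have N0 := le_trans M0 MN; split=> // e eO K.
by apply: le_trans (AM _ eO K) _; rewrite ler_pXn2r.
Qed.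

Lemma hsbZ (A : bo) c M : hsb A M -> hsb (c *: A) (cnorm c * M).
Proof.
move=> AM; have -> : c *: A = (c *: (1 : bo)) * A by rewrite boZl mul1r.
apply: hsbMl AM; split=> [|x]; first exact: cnorm_ge0.
by rewrite !boE hnormZ.
Qed.

Lemma hsb0 M : 0 <= M -> hsb 0 M.
Proof.
by move=> M0; split=> // e _ N; rewrite big1 ?sqr_ge0 // => i _; rewrite boE hnorm0 expr0n.
Qed.

Lemma onb_cconj e : onb ip e -> onb ip (fun n => cconj (e n)).
Proof.
move=> [eO eT]; split=> [i j|x xe].
  by rewrite herm_cconj eO conjc_nat.
rewrite -[x]cconjK (eT (cconj x)); first by rewrite /cconj /= oppr0.
move=> i; rewrite -[x]cconjK in xe *; rewrite cconjK; have := xe i.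
by rewrite herm_cconj => /eqP; rewrite conjc_eq0 => /eqP.
Qed.

Lemma hsb_cb (A : bo) M : hsb A M -> hsb (cb A) M.
Proof.
move=> [M0 AM]; split=> // e eO N; apply: le_trans (AM _ (onb_cconj eO) N).
by apply: ler_sum => n _; rewrite cbE hnorm_cconj.
Qed.

(** Parseval's identity for [A x]: its coefficients are <x, A^* e_i>, bounded by |x| |A^* e_i|, and
    the adjoint has the same Hilbert-Schmidt bound. *)
Lemma hsb_bnd (A : bo) M : hsb A M -> bnd A M.
Proof.
move=> AM; have [M0 A'M] := hsb_star AM; split=> // x.
apply: le_sqr; first by rewrite mulr_ge0 ?hnorm_ge0.
apply: (cvg_le_cst (@parseval _ e0_onb (A x))) => n.
rewrite proj_sqr //.
apply: (@le_trans _ _ (\sum_(0 <= i < n) hnorm x ^+ 2 * hnorm (star A (e0 i)) ^+ 2)).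
  apply: ler_sum => i _; rewrite starP -exprMn ler_pXn2r ?nnegrE ?mulr_ge0 ?cnorm_ge0 ?hnorm_ge0 //.
  exact: cauchy_schwarz.
by rewrite -mulr_sumr exprMn mulrC ler_wpM2r ?sqr_ge0 // A'M.
Qed.

Lemma cvg_ext (f g : nat -> R) (l : R) :
  (forall N, f N = g N) -> f @ \oo --> l -> g @ \oo --> l.
Proof. by move=> /funext ->. Qed.

Lemma series_lin (a b : R) (u v w : nat -> R) (l m k : R) :
  (forall n, w n = a * u n + b * v n) -> k = a * l + b * m ->
  series u @ \oo --> l -> series v @ \oo --> m -> series w @ \oo --> k.
Proof.
move=> wE -> ul vm.
have h : (fun N => a * series u N + b * series v N) @ \oo --> a * l + b * m.
  by apply: cvgD; apply: cvgM => //; exact: cvg_cst.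
apply: (cvg_ext _ h) => N; rewrite /series !mulr_sumr -big_split.
by apply: eq_bigr => n _; rewrite wE.
Qed.

Definition hs (A : bo) := exists M, hsb A M.

Lemma hsP (A : bo) : hilbert_schmidt ip A <-> hs A.
Proof. by split=> [/hs_hsb|[M /hsb_hs//]]; exists (hsnorm ip A). Qed.

Lemma hsD (A B : bo) : hs A -> hs B -> hs (A + B).
Proof. by move=> [M AM] [N BN]; exists (2 * (M + N)); exact: hsbD. Qed.

Lemma hsZ (A : bo) c : hs A -> hs (c *: A).
Proof. by move=> [M AM]; exists (cnorm c * M); exact: hsbZ. Qed.

Lemma hsN (A : bo) : hs A -> hs (- A).
Proof. by rewrite -scaleN1r; exact: hsZ. Qed.

Lemma hsB (A B : bo) : hs A -> hs B -> hs (A - B).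
Proof. by move=> ? /hsN; exact: hsD. Qed.

Lemma hsMl (A B : bo) : hs A -> hs (B * A).
Proof. by move=> [M AM]; have [b Bb] := bnd_ex B; exists (b * M); exact: hsbMl. Qed.

Lemma hsMr (A B : bo) : hs A -> hs (A * B).
Proof. by move=> [M AM]; have [b Bb] := bnd_ex B; exists (M * b); exact: hsbMr. Qed.

Lemma hs_star (A : bo) : hs A -> hs (star A).
Proof. by move=> [M AM]; exists M; exact: hsb_star. Qed.

Lemma hs_cb (A : bo) : hs A -> hs (cb A).
Proof. by move=> [M AM]; exists M; exact: hsb_cb. Qed.

Lemma hs0 : hs 0.
Proof. by exists 0; exact: hsb0. Qed.

Definition hssq (A : bo) := basis_sum ip (fun x => hnorm (A x) ^+ 2).

Lemma hssqP (A : bo) : hs A -> basis_sum_to ip (fun x => hnorm (A x) ^+ 2) (hssq A).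
Proof. by move=> [M /hsb_sum[t _ At]]; rewrite /hssq (basis_sumE At). Qed.

Lemma hssq_le (A : bo) M : hsb A M -> hssq A <= M ^+ 2.
Proof. by move=> /hsb_sum[t /andP[_ tM] At]; rewrite /hssq (basis_sumE At). Qed.

Lemma hssq_ge0 (A : bo) : hs A -> 0 <= hssq A.
Proof. by move=> [M /hsb_sum[t /andP[t0 _] At]]; rewrite /hssq (basis_sumE At). Qed.

Lemma hsb_hssq (A : bo) : hs A -> hsb A (Num.sqrt (hssq A)).
Proof. by move=> /hsP/hs_hsb. Qed.

Lemma hssq_mono (A B : bo) : hs A -> (forall M, hsb A M -> hsb B M) -> hssq B <= hssq A.
Proof.
move=> Ah AB; have := hssq_le (AB _ (hsb_hssq Ah)).
by rewrite sqr_sqrtr // hssq_ge0.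
Qed.

Lemma hssq_star (A : bo) : hs A -> hssq (star A) = hssq A.
Proof.
move=> Ah; apply/le_anti/andP; split; apply: hssq_mono => //.
- by move=> M; exact: hsb_star.
- exact: hs_star.
- by move=> M /hsb_star; rewrite starK.
Qed.

Lemma hssqZ (A : bo) c : cnorm c = 1 -> hssq (c *: A) = hssq A.
Proof.
move=> c1; rewrite /hssq; congr basis_sum; apply: funext => x.
by rewrite boE hnormZ c1 mul1r.
Qed.

(** * Traces *)

(* [tr ip A] is a junk value unless its series have the same limit in all bases. *)
Definition trc (A : bo) (z : C) := forall e, onb ip e ->
  (series (fun n => Re (herm (A (e n)) (e n))) @ \oo --> Re z) /\
  (series (fun n => Im (herm (A (e n)) (e n))) @ \oo --> Im z).

Lemma trcE (A : bo) z : trc A z -> tr ip A = z.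
Proof.
move=> Az; rewrite /tr; apply: eqC => /=; apply: basis_sumE => e eO.
  exact: (Az e eO).1.
exact: (Az e eO).2.
Qed.

Lemma trc_unique (A : bo) z w : trc A z -> trc A w -> z = w.
Proof. by move=> /trcE <- /trcE <-. Qed.

Lemma trcD (A B : bo) z w : trc A z -> trc B w -> trc (A + B) (z + w).
Proof.
move=> Az Bw e eO; have [A1 A2] := Az e eO; have [B1 B2] := Bw e eO; split.
  by apply: (series_lin _ _ A1 B1 (a := 1) (b := 1)) => [n|]; rewrite ?boE ?hermDl ReD !mul1r.
by apply: (series_lin _ _ A2 B2 (a := 1) (b := 1)) => [n|]; rewrite ?boE ?hermDl ImD !mul1r.
Qed.

Lemma trcZ (A : bo) c z : trc A z -> trc (c *: A) (c * z).
Proof.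
move=> Az e eO; have [A1 A2] := Az e eO; split.
  apply: (series_lin _ _ A1 A2 (a := Re c) (b := - Im c)) => [n|];
    by rewrite ?boE ?hermZl ReM mulNr.
apply: (series_lin _ _ A2 A1 (a := Re c) (b := Im c)) => [n|];
  by rewrite ?boE ?hermZl ImM.
Qed.

Lemma trcN (A : bo) z : trc A z -> trc (- A) (- z).
Proof. by move=> /(trcZ (-1)); rewrite scaleN1r mulN1r. Qed.

Lemma trcB (A B : bo) z w : trc A z -> trc B w -> trc (A - B) (z - w).
Proof. by move=> Az /trcN; exact: trcD. Qed.

Lemma series0 (u : nat -> R) : (forall n, u n = 0) -> series u @ \oo --> (0 : R).
Proof.
move=> u0; rewrite (_ : series u = cst 0); first exact: cvg_cst.
by apply: funext => N; apply: big1 => n _; exact: u0.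
Qed.

Lemma trc0 : trc 0 0.
Proof. by move=> e eO; split; apply: series0 => n; rewrite boE herm0l. Qed.

Lemma trc_cb (A : bo) z : trc A z -> trc (cb A) (conjc z).
Proof.
move=> Az e eO; have [A1 A2] := Az _ (onb_cconj eO).
have h n : herm (cb A (e n)) (e n) = conjc (herm (A (cconj (e n))) (cconj (e n))).
  by rewrite -herm_cconj cconjK.
split.
  apply: (series_lin _ _ A1 A1 (a := 1) (b := 0)) => [n|];
    by rewrite ?h ReJ mul1r mul0r addr0.
apply: (series_lin _ _ A2 A2 (a := -1) (b := 0)) => [n|];
  by rewrite ?h ImJ mulN1r mul0r addr0.
Qed.

Definition tval (A B : bo) : C :=
  4^-1 * (hssq (A + B) - hssq (A - B)) +i*
  (4^-1 * (hssq (A + 'i%C *: B) - hssq (A - 'i%C *: B))).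

Lemma trc_hs (A B : bo) : hs A -> hs B -> trc (star B * A) (tval A B).
Proof.
move=> Ah Bh e eO.
have aux (D : bo) : hs D ->
  series (fun n => Re (herm (A (e n)) (D (e n)))) @ \oo -->
    4^-1 * (hssq (A + D) - hssq (A - D)).
  move=> Dh.
  apply: (series_lin _ _ (hssqP (hsD Ah Dh) eO) (hssqP (hsB Ah Dh) eO)
    (a := 4^-1) (b := - 4^-1)) => [n|]; last by ring.
  rewrite !boE !hnormD_sqr hnormN hermNr ReN.
  by move: (_ ^+ 2) (_ ^+ 2) (Re _) => a b c; field.
split.
  rewrite (_ : (fun n => _) = fun n => Re (herm (A (e n)) (B (e n)))) //; first exact: aux.
  by apply: funext => n; rewrite boE -starP'.
rewrite (_ : (fun n => _) = fun n => Re (herm (A (e n)) (('i%C *: B) (e n)))) //.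
  exact/aux/hsZ.
apply: funext => n; rewrite boE -starP' boE hermZr !ReImE; lra.
Qed.

(** Taking adjoints and multiplying by unit scalars preserve [hssq], so the four terms of the
    polarisation formula match. This is where the symmetry of the trace comes from. *)
Lemma tvalC (A B : bo) : hs A -> hs B -> tval (star B) (star A) = tval A B.
Proof.
move=> Ah Bh; have iBh := hsZ 'i%C Bh.
have h1 : cnorm (-1 : C) = 1 by rewrite cnormN (cnormR 1) normr1.
have hi : cnorm (- 'i%C : C) = 1 by rewrite cnormN cnormi.
rewrite /tval; congr (_ * (_ - _) +i* (_ * (_ - _))).
- by rewrite addrC -starD hssq_star //; exact: hsD.
- by rewrite -(hssqZ _ h1) scaleN1r opprB -starB hssq_star //; exact: hsB.
- rewrite -(hssqZ _ hi) -(hssq_star (hsD Ah iBh)); congr hssq.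
  rewrite starD starZ scalerDr scalerA addrC; congr (_ + _ *: _); last first.
    by apply: eqC => /=; ring.
  by rewrite -[RHS]scale1r; congr (_ *: _); apply: eqC => /=; ring.
- rewrite -(hssqZ _ cnormi) -(hssq_star (hsB Ah iBh)); congr hssq.
  rewrite starB starZ scalerBr scalerA addrC -!scaleNr; congr (_ + _ *: _); last first.
    by apply: eqC => /=; ring.
  by rewrite -[RHS]scale1r; congr (_ *: _); apply: eqC => /=; ring.
Qed.

Lemma trc_comm (A B : bo) : hs A -> hs B -> exists2 z, trc (A * B) z & trc (B * A) z.
Proof.
move=> Ah Bh; exists (tval B (star A)).
  by have := trc_hs Bh (hs_star Ah); rewrite starK.
have := trc_hs (hs_star (hs_star Ah)) (hs_star Bh).
by rewrite tvalC ?starK //; exact: hs_star.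
Qed.

Lemma trc_hsnorm (A : bo) : hs A -> trc (star A * A) (hssq A)%:C.
Proof.
move=> Ah e eO; split.
  rewrite (_ : (fun n => _) = fun n => hnorm (A (e n)) ^+ 2); first exact: hssqP Ah _ eO.
  by apply: funext => n; rewrite boE -starP' herm_sqr.
by apply: series0 => n; rewrite boE -starP' herm_sqr.
Qed.

Lemma bnd0_eq0 (A : bo) : bnd A 0 -> A = 0.
Proof.
move=> [_ A0]; apply: bo_eq => x; apply/hnorm_eq0/le_anti; rewrite hnorm_ge0 andbT.
by apply: le_trans (A0 x) _; rewrite mul0r.
Qed.

Lemma hssq_eq0 (A : bo) : hs A -> hssq A = 0 -> A = 0.
Proof.
by move=> /hsb_hssq + A0; rewrite A0 sqrtr0 => /hsb_bnd; exact: bnd0_eq0.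
Qed.

(** * Nuclear operators *)

(** Here [s] bounds the partial sums instead of being the sum of the series, which makes the notion
    stable under the estimates below. [nuc_expansion] and [expansion_nuc] compare it with
    [nuclear_expansion]. *)
Definition nuc (A : bo) (s : R) := exists x y : nat -> H,
  (forall n, \sum_(0 <= k < n) hnorm (x k) * hnorm (y k) <= s) /\
  forall u eps, 0 < eps -> exists N, forall n, (N <= n)%N ->
    hnorm (A u - \sum_(0 <= k < n) herm u (x k) *: y k) <= eps.

Lemma nd_nuc (x y : nat -> H) :
  nondecreasing_seq (series (fun n => hnorm (x n) * hnorm (y n))).
Proof. by apply: nondecreasing_series => n _ _; rewrite mulr_ge0 ?hnorm_ge0. Qed.

Lemma nuc_expansion (A : bo) s : nuc A s -> exists2 s', s' <= s & nuclear_expansion ip A s'.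
Proof.
move=> [x [y [xys Axy]]]; pose S := series (fun n => hnorm (x n) * hnorm (y n)).
have cS : cvgn S.
  by apply: nondecreasing_is_cvgn; [exact: nd_nuc | exists s => _ [n _ <-]; exact: xys].
exists (limn S); first by apply: limr_le => //; apply: nearW => n; exact: xys.
exists x, y; split=> // u; apply/cvg0P => e /(Axy u)[N hN].
by exists N => n /hN; rewrite ger0_norm ?hnorm_ge0.
Qed.

Lemma expansion_nuc (A : bo) s : nuclear_expansion ip A s -> nuc A s.
Proof.
move=> [x [y [xys Axy]]]; exists x, y; split=> [n|u e ep].
  have := nondecreasing_cvgn_le (@nd_nuc x y) (cvgP _ xys) n.
  by rewrite (cvg_lim _ xys).
have /cvg0P/(_ _ ep)[N hN] := Axy u.
by exists N => n /hN; rewrite ger0_norm ?hnorm_ge0.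
Qed.

Lemma nuc_ge0 (A : bo) s : nuc A s -> 0 <= s.
Proof. by move=> [x [y [/(_ 0%N) + _]]]; rewrite big_nil. Qed.

Lemma nuc_lb (A : bo) : has_lbound (nuclear_expansion ip A).
Proof. by exists 0 => s /expansion_nuc/nuc_ge0. Qed.

Lemma trnorm_le (A : bo) s : nuc A s -> trnorm ip A <= s.
Proof.
move=> /nuc_expansion[s' s's As']; apply: le_trans s's.
by apply: (ge_inf (nuc_lb A)).
Qed.

Lemma trnorm_ge0 (A : H -> H) : 0 <= trnorm ip A.
Proof.
rewrite /trnorm; have [->|/set0P ne] := eqVneq (nuclear_expansion ip A : set R) set0.
  by rewrite inf0.
apply: lb_le_inf => // s [x [y [xys _]]].
have := nondecreasing_cvgn_le (@nd_nuc x y) (cvgP _ xys) 0%N.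
by rewrite (cvg_lim _ xys) // /series /= big_nil.
Qed.

Definition tc (A : bo) := exists s, nuc A s.

Lemma tcP (A : bo) : trace_class ip A <-> tc A.
Proof.
split=> [[_ [s /expansion_nuc As]]|[s /nuc_expansion[s' _ As]]]; first by exists s.
by split; [exact: bov_bop|exists s'].
Qed.

(** Convergence of the expansion at each [u] is improved to convergence in operator norm; [tau n] is
    the tail of the series of [hnorm (x k) * hnorm (y k)]. *)
Lemma nuc_tail (A : bo) s : nuc A s -> exists x y (tau : nat -> R),
  [/\ forall n, \sum_(0 <= k < n) hnorm (x k) * hnorm (y k) <= s,
      forall e, 0 < e -> exists N, forall n, (N <= n)%N -> tau n <= e &
      forall u n, hnorm (A u - \sum_(0 <= k < n) herm u (x k) *: y k) <= tau n * hnorm u].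
Proof.
move=> [x [y [xys Axy]]]; pose S n := \sum_(0 <= k < n) hnorm (x k) * hnorm (y k).
have Ssup : has_sup (range S).
  by split; [exists (S 0%N), 0%N | exists s => _ [n _ <-]; exact: xys].
have Sle n : S n <= sup (range S).
  by apply: ub_le_sup; [case: Ssup | exists n].
exists x, y, (fun n => sup (range S) - S n); split=> // [e ep|u n].
  have [_ [N _ <-] sN] := sup_adherent ep Ssup; exists N => n Nn.
  have : S N <= S n by rewrite -(subnKC Nn); apply: nd_nuc; rewrite leq_addr.
  by move: sN; move: (S N) (S n) => *; lra.
rewrite -subr_le0; apply: (@le_eps _ _ 1) => // e ep; rewrite mul1r.
have [N hN] := Axy u _ ep.
have := hN _ (leq_maxl N n); set m := maxn N n => Am.
have nm : (n <= m)%N by rewrite leq_maxr.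
rewrite lerBlDl.
have -> : A u - \sum_(0 <= k < n) herm u (x k) *: y k =
   (A u - \sum_(0 <= k < m) herm u (x k) *: y k) + \sum_(n <= k < m) herm u (x k) *: y k.
  by rewrite (@big_cat_nat _ _ _ n 0%N m) //= opprD addrA subrK.
apply: le_trans (hnormD _ _) _; rewrite addrC lerD //.
apply: (@le_trans _ _ ((S m - S n) * hnorm u)); last first.
  by rewrite ler_wpM2r ?hnorm_ge0 // lerB.
have -> : S m - S n = \sum_(n <= k < m) hnorm (x k) * hnorm (y k).
  by rewrite /S (@big_cat_nat _ _ _ n 0%N m) //= addrAC subrr add0r.
rewrite mulr_suml; elim/big_ind2: _ => [|v a w b va wb|k _]; first by rewrite hnorm0.
  by apply: le_trans (hnormD _ _) _; rewrite lerD.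
rewrite hnormZ mulrAC ler_wpM2r ?hnorm_ge0 // mulrC.
exact: cauchy_schwarz.
Qed.

Lemma nuc_bnd (A : bo) s : nuc A s -> bnd A s.
Proof.
move=> As; split=> [|u]; first exact: nuc_ge0 As.
have [x [y [tau [xys tau0 Atau]]]] := nuc_tail As.
rewrite -subr_le0; apply: (@le_eps _ _ (hnorm u)) => [|e /tau0[N hN]].
  exact: hnorm_ge0.
have := hN _ (leqnn N) => tN.
have := Atau u N; set w := \sum_(0 <= k < N) _ => h1.
have h2 : hnorm w <= s * hnorm u.
  apply: le_trans (hnorm_sum _ _) _.
  apply: (@le_trans _ _ ((\sum_(0 <= k < N) hnorm (x k) * hnorm (y k)) * hnorm u)).
    rewrite mulr_suml; apply: ler_sum => k _.
    by rewrite hnormZ mulrAC ler_wpM2r ?hnorm_ge0 // mulrC; exact: cauchy_schwarz.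
  by rewrite ler_wpM2r ?hnorm_ge0.
have := hnormD (A u - w) w; rewrite subrK.
have : tau N * hnorm u <= e * hnorm u by rewrite ler_wpM2r ?hnorm_ge0.
by move: h1 h2; rewrite (mulrC e); move: (tau N * _) (hnorm u * e) => *; lra.
Qed.

(** [trnorm] is an infimum, so the bound is inherited from expansions that nearly attain it. With
    [hsb_bnd] it makes velocities in [norm12] converge in operator norm. *)
Lemma tc_trnorm_bnd (A : bo) : tc A -> bnd A (trnorm ip A).
Proof.
move=> [s /nuc_expansion[s' _ As']]; split=> [|u]; first exact: trnorm_ge0.
rewrite -subr_le0; apply: (@le_eps _ _ (hnorm u)) => [|e ep]; first exact: hnorm_ge0.
have [t /expansion_nuc/nuc_bnd[_ At] te] :
  exists2 t, nuclear_expansion ip A t & t < trnorm ip A + e.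
  have : has_inf (nuclear_expansion ip A) by split; [exists s' | exact: nuc_lb].
  by move=> /(inf_adherent ep).
rewrite lerBlDl (mulrC (hnorm u)) -mulrDl; apply: le_trans (At u) _.
by rewrite ler_wpM2r ?hnorm_ge0 // ltW.
Qed.

(** The expansion of a sum of two nuclear operators alternates the terms of their expansions. *)
Lemma sum_interleave (W : zmodType) (F1 F2 : nat -> W) n :
  \sum_(0 <= k < n) (if odd k then F2 k./2 else F1 k./2) =
  \sum_(0 <= k < uphalf n) F1 k + \sum_(0 <= k < n./2) F2 k.
Proof.
elim: n => [|n ih]; first by rewrite !big_nil addr0.
have S F : \sum_(0 <= k < n./2.+1) F k = \sum_(0 <= k < n./2) F k + F n./2 :> W.
  by rewrite big_nat_recr.
rewrite big_nat_recr //= ih uphalf_half; case: (odd n).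
  by rewrite add1n (S F2) addrA.
by rewrite add0n (S F1) addrAC.
Qed.

Lemma nucD (A B : bo) s t : nuc A s -> nuc B t -> nuc (A + B) (s + t).
Proof.
move=> [x1 [y1 [xy1 A1]]] [x2 [y2 [xy2 A2]]].
exists (fun k => if odd k then x2 k./2 else x1 k./2),
       (fun k => if odd k then y2 k./2 else y1 k./2); split=> [n|u e ep].
  rewrite (eq_bigr (fun k => if odd k then hnorm (x2 k./2) * hnorm (y2 k./2)
     else hnorm (x1 k./2) * hnorm (y1 k./2))); last by move=> k _; case: odd.
  rewrite (sum_interleave (fun k => hnorm (x1 k) * hnorm (y1 k))
    (fun k => hnorm (x2 k) * hnorm (y2 k))).
  exact: lerD.
have e20 : 0 < e / 2 by rewrite divr_gt0.
have [N1 h1] := A1 u _ e20; have [N2 h2] := A2 u _ e20.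
exists (maxn N1 N2).*2 => n nN.
have n1 : (N1 <= n./2)%N by rewrite (leq_trans (leq_maxl N1 N2)) // -(doubleK (maxn _ _)) half_leq.
have n2 : (N2 <= n./2)%N by rewrite (leq_trans (leq_maxr N1 N2)) // -(doubleK (maxn _ _)) half_leq.
have n3 : (N1 <= uphalf n)%N by rewrite (leq_trans n1) // uphalf_half leq_addl.
rewrite (eq_bigr (fun k => if odd k then herm u (x2 k./2) *: y2 k./2
     else herm u (x1 k./2) *: y1 k./2)); last by move=> k _; case: odd.
rewrite (sum_interleave (fun k => herm u (x1 k) *: y1 k) (fun k => herm u (x2 k) *: y2 k)).
rewrite boE opprD addrACA; apply: le_trans (hnormD _ _) _.
have := h1 _ n3; have := h2 _ n2.
by move: (hnorm _) (hnorm _) => *; lra.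
Qed.

Lemma nucMl (A B : bo) b s : bnd B b -> nuc A s -> nuc (B * A) (b * s).
Proof.
move=> [b0 Bb] [x [y [xys Axy]]]; exists x, (fun k => B (y k)); split=> [n|u e ep].
  apply: le_trans (_ : b * \sum_(0 <= k < n) hnorm (x k) * hnorm (y k) <= _); last exact: ler_wpM2l.
  rewrite mulr_sumr; apply: ler_sum => k _; rewrite mulrCA ler_wpM2l ?hnorm_ge0 //.
have b1 : 0 < b + 1 by rewrite ltr_wpDl.
have [|N hN] := Axy u (e / (b + 1)); first by rewrite divr_gt0.
exists N => n /hN; rewrite ler_pdivlMr // => h.
have -> : \sum_(0 <= k < n) herm u (x k) *: B (y k) = B (\sum_(0 <= k < n) herm u (x k) *: y k).
  rewrite (lin_sum (bo_linear B)); apply: eq_bigr => k _.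
  by rewrite (linZ (bo_linear B)).
rewrite boE -(linB (bo_linear B)); apply: le_trans (Bb _) _; apply: le_trans h.
by rewrite mulrC ler_wpM2l ?hnorm_ge0 // lerDl.
Qed.

(** Exchange [x] and [y] in the expansion. Pairing the error w with itself moves the operator back
    to [A]: |w|^2 = Re <(A - A_n) w, u> <= tau n |w| |u|, with A_n the truncated expansion. Since w
    depends on n, the uniform tail of [nuc_tail] is what is needed. *)
Lemma nuc_star (A : bo) s : nuc A s -> nuc (star A) s.
Proof.
move=> /nuc_tail[x [y [tau [xys tau0 Atau]]]]; exists y, x; split=> [n|u e ep].
  by under eq_bigr do rewrite mulrC.
have u1 : 0 < hnorm u + 1 by rewrite ltr_wpDl ?hnorm_ge0.
have [|N hN] := tau0 (e / (hnorm u + 1)); first by rewrite divr_gt0.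
exists N => n /hN tn; set w := _ - _.
have [w0|w0] := eqVneq (hnorm w) 0; first by rewrite w0 ltW.
have wp : 0 < hnorm w by rewrite lt0r w0 hnorm_ge0.
rewrite -(ler_pM2l wp) -expr2.
have -> : hnorm w ^+ 2 = Re (herm (A w - \sum_(0 <= k < n) herm w (x k) *: y k) u).
  rewrite hermBl starP herm_suml.
  rewrite (eq_bigr (fun k => herm w (herm u (y k) *: x k))); last first.
    by move=> k _; rewrite hermZl hermZr mulrC -hermJ.
  by rewrite -herm_sumr -hermBr herm_sqr.
apply: le_trans (Re_herm_le _ _) _.
apply: le_trans (_ : tau n * hnorm w * hnorm u <= _).
  by rewrite ler_wpM2r ?hnorm_ge0.
rewrite mulrC mulrA mulrC ler_wpM2l ?hnorm_ge0 //.
have : tau n * (hnorm u + 1) <= e by rewrite -ler_pdivlMr.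
have [t0|/ltW t0] := leP 0 (tau n); first by nra.
by move=> _; apply: le_trans (ltW ep); rewrite mulr_ge0_le0 ?hnorm_ge0.
Qed.

Lemma nucMr (A B : bo) b s : bnd B b -> nuc A s -> nuc (A * B) (s * b).
Proof.
move=> /bnd_star Bb /nuc_star As; rewrite -[A * B]starK starM mulrC.
exact/nuc_star/nucMl.
Qed.

Lemma nucZ (A : bo) c s : nuc A s -> nuc (c *: A) (cnorm c * s).
Proof.
move=> As; have -> : c *: A = (c *: (1 : bo)) * A by rewrite boZl mul1r.
apply: nucMl As; split=> [|x]; first exact: cnorm_ge0.
by rewrite !boE hnormZ.
Qed.

(** Expanding [B u] in the basis [e0] gives the series of <u, B^* e_k> A e_k; the bound comes from a
    b <= a^2 + b^2. *)
Lemma nuc_hs (A B : bo) M N : hsb A M -> hsb B N -> nuc (A * B) (M ^+ 2 + N ^+ 2).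
Proof.
move=> [M0 AM] /hsb_star[N0 BN].
exists (fun k => star B (e0 k)), (fun k => A (e0 k)); split=> [n|u e e_gt0].
  have := lerD (AM _ e0_onb n) (BN _ e0_onb n); apply: le_trans.
  rewrite -big_split; apply: ler_sum => k _.
  change (hnorm (star B (e0 k)) * hnorm (A (e0 k)) <=
    hnorm (A (e0 k)) ^+ 2 + hnorm (star B (e0 k)) ^+ 2).
  have : 0 <= hnorm (A (e0 k)) * hnorm (star B (e0 k)) by rewrite mulr_ge0 ?hnorm_ge0.
  have := sqr_ge0 (hnorm (A (e0 k)) - hnorm (star B (e0 k))).
  by move: (hnorm _) (hnorm _) => a b; nra.
have [b [b0 Ab]] := bnd_ex A.
have b1 : 0 < b + 1 by rewrite ltr_wpDl.
have [|K hK] := @proj_cvg _ e0_onb (B u) (e / (b + 1)); first by rewrite divr_gt0.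
exists K => n /hK; rewrite ler_pdivlMr // hnormBC => h.
have -> : \sum_(0 <= k < n) herm u (star B (e0 k)) *: A (e0 k) = A (proj e0 n (B u)).
  rewrite (lin_sum (bo_linear A)); apply: eq_bigr => k _.
  by rewrite (linZ (bo_linear A)) -starP.
rewrite boE -(linB (bo_linear A)); apply: le_trans (Ab _) _; apply: le_trans h.
by rewrite mulrC ler_wpM2l ?hnorm_ge0 // lerDl.
Qed.

(* With [P_N] the projection onto the span of [e 0, ..., e (N - 1)], the sum of
   the [hnorm (A (e n)) ^+ 2] for [n < N] is the limit of the sum over [k] of
   the [herm (y k) (A (P_N (x k)))]. *)
Lemma tc_hs (A : bo) : tc A -> hs A.
Proof.
move=> [s As]; have [a Aa] := bnd_ex A; have [a0 Aa'] := Aa.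
have s0 := nuc_ge0 As; have [x [y [xys Axy]]] := As.
exists (Num.sqrt (a * s)); apply: hsb_e0 => [|N]; first exact: sqrtr_ge0.
rewrite sqr_sqrtr ?mulr_ge0 //.
rewrite -subr_le0; apply: (@le_eps _ _ (\sum_(0 <= n < N) hnorm (A (e0 n)))) => [|e e_gt0].
  by apply: sumr_ge0 => n _; exact: hnorm_ge0.
rewrite lerBlDl.
have [K hK] : exists K, forall n, (n < N)%N ->
    hnorm (A (e0 n) - \sum_(0 <= k < K) herm (e0 n) (x k) *: y k) <= e.
  suff [K hK] : exists K, forall k n, (K <= k)%N -> (n < N)%N ->
      hnorm (A (e0 n) - \sum_(0 <= i < k) herm (e0 n) (x i) *: y i) <= e.
    by exists K => n; apply: hK.
  elim: N => [|N [K hK]]; first by exists 0%N.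
  have [K' hK'] := Axy (e0 N) _ e_gt0.
  exists (maxn K K') => k n; rewrite geq_max => /andP[Kk K'k].
  by rewrite ltnS leq_eqVlt => /predU1P[->|nN]; [exact: hK'|exact: hK].
have step n : (n < N)%N -> hnorm (A (e0 n)) ^+ 2 <=
    hnorm (A (e0 n)) * e + Re (herm (\sum_(0 <= k < K) herm (e0 n) (x k) *: y k) (A (e0 n))).
  move=> nN; set w := \sum_(0 <= k < K) _.
  have -> : hnorm (A (e0 n)) ^+ 2 = Re (herm (A (e0 n)) (A (e0 n))) by rewrite herm_sqr.
  rewrite -{1}[A (e0 n)](subrK w) hermDl ReD lerD2r mulrC.
  by apply: le_trans (Re_herm_le _ _) _; rewrite ler_wpM2r ?hnorm_ge0 // hK.
apply: (@le_trans _ _ (\sum_(0 <= n < N) (hnorm (A (e0 n)) * e +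
    Re (herm (\sum_(0 <= k < K) herm (e0 n) (x k) *: y k) (A (e0 n)))))).
  by rewrite big_nat [leRHS]big_nat; apply: ler_sum => n /andP[_ nN]; exact: step.
rewrite big_split /= -mulr_suml addrC lerD2r.
have -> : \sum_(0 <= n < N) Re (herm (\sum_(0 <= k < K) herm (e0 n) (x k) *: y k) (A (e0 n)))
   = \sum_(0 <= k < K) Re (herm (y k) (A (proj e0 N (x k)))).
  under eq_bigr do rewrite herm_suml raddf_sum.
  rewrite exchange_big_nat; apply: eq_bigr => k _; cbv beta.
  rewrite /proj (lin_sum (bo_linear A)) herm_sumr raddf_sum; apply: eq_bigr => n _; cbv beta.
  by rewrite hermZl (linZ (bo_linear A)) hermZr -hermJ.
apply: (@le_trans _ _ (a * \sum_(0 <= k < K) hnorm (x k) * hnorm (y k))); last first.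
  by rewrite ler_wpM2l.
rewrite mulr_sumr; apply: ler_sum => k _; apply: le_trans (Re_herm_le _ _) _.
rewrite mulrA mulrC ler_wpM2r ?hnorm_ge0 //; apply: le_trans (Aa' _) _.
by rewrite ler_wpM2l // (bessel e0_onb).
Qed.

Lemma tcD (A B : bo) : tc A -> tc B -> tc (A + B).
Proof. by move=> [s As] [t Bt]; exists (s + t); exact: nucD. Qed.

Lemma tcMl (A B : bo) : tc A -> tc (B * A).
Proof. by move=> [s As]; have [b Bb] := bnd_ex B; exists (b * s); exact: nucMl. Qed.

Lemma tcMr (A B : bo) : tc A -> tc (A * B).
Proof. by move=> [s As]; have [b Bb] := bnd_ex B; exists (s * b); exact: nucMr. Qed.

Lemma tcZ (A : bo) c : tc A -> tc (c *: A).
Proof. by move=> [s As]; exists (cnorm c * s); exact: nucZ. Qed.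

Lemma tc_star (A : bo) : tc A -> tc (star A).
Proof. by move=> [s As]; exists s; exact: nuc_star. Qed.

Lemma tcM (A B : bo) : hs A -> hs B -> tc (A * B).
Proof. by move=> [M AM] [N BN]; exists (M ^+ 2 + N ^+ 2); exact: nuc_hs. Qed.

Lemma tc0 : tc 0.
Proof. by rewrite -(mulr0 0); apply: tcM; exact: hs0. Qed.

Context (J : {linear V -> V}).
Context (J_square : forall u : V, J (J u) = - u).
Context (J_isometry : forall u v : V, ip (J u) (J v) = ip u v).

(** * The block decomposition defined by J *)

Lemma hnorm_JC x : hnorm (JC J x) = hnorm x.
Proof.
by rewrite /Defs.hnorm; congr (Num.sqrt (Re _)); rewrite !hermE /= !J_isometry.
Qed.

Lemma bop_JC : bop ip (JC J).
Proof.
split=> [c x y|]; last by exists 1 => x; rewrite mul1r hnorm_JC.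
by rewrite /JC !scaleE /= !(linearD, linearN, linearZ).
Qed.

Definition bJ := Bo bop_JC.

Lemma bJ_sqr : bJ * bJ = -1.
Proof. by apply: bo_eq => x; rewrite !boE /= /JC /= !J_square. Qed.

Lemma star_bJ : star bJ = - bJ.
Proof.
apply: star_unique => x y.
have h u v : ip (J u) v = - ip u (J v).
  by rewrite -[in RHS]J_isometry J_square linearNr opprK.
by rewrite boE hermNr !hermE /= !h; apply: eqC => /=; ring.
Qed.

Lemma cb_bJ : cb bJ = bJ.
Proof. by apply: bo_eq => x; rewrite cbE /= /cconj /JC /= linearN opprK. Qed.

(* Locked here and below: otherwise the ring laws rewrite inside these constants. *)
Definition p : bo := locked (2^-1 *: (1 - 'i%C *: bJ)).
Definition q : bo := locked (2^-1 *: (1 + 'i%C *: bJ)).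
Definition d : bo := locked (p - q).

Lemma pE : Pp J = p. Proof. by rewrite /p -lock. Qed.
Lemma qE : Pm J = q. Proof. by rewrite /q -lock. Qed.

Lemma blkE (A : bo) :
  [/\ blk (Pp J) (Pp J) A = bov (p * A * p), blk (Pp J) (Pm J) A = bov (p * A * q),
      blk (Pm J) (Pp J) A = bov (q * A * p) & blk (Pm J) (Pm J) A = bov (q * A * q)].
Proof. by rewrite /p /q -!lock. Qed.

Lemma addpq : p + q = 1.
Proof.
rewrite /p /q -!lock -scalerDr addrACA addNr addr0 -{1}[1 : bo]scale1r -{2}[1 : bo]scale1r.
by rewrite -scalerDl scalerA mulVf ?scale1r // pnatr_eq0.
Qed.

Lemma dE : d = - 'i%C *: bJ.
Proof.
rewrite /d /p /q -!lock -scalerBr opprD addrACA subrr add0r -opprD -scalerDl scalerN scalerA.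
rewrite -scaleNr; congr (_ *: _); by field.
Qed.

Lemma bJE : bJ = 'i%C *: d.
Proof. by rewrite dE scalerA (_ : _ * _ = 1) ?scale1r //; apply: eqC => /=; ring. Qed.

Lemma dd : d * d = 1.
Proof.
rewrite dE boZl boZr bJ_sqr scalerA scalerN -scaleNr (_ : - _ = 1) ?scale1r //.
by apply: eqC => /=; ring.
Qed.

Lemma pE' : p = 2^-1 *: (1 + d).
Proof. by rewrite dE scaleNr /p -lock. Qed.

Lemma qE' : q = 2^-1 *: (1 - d).
Proof. by rewrite dE scaleNr opprK /q -lock. Qed.

Lemma half_double (z : bo) : 2^-1 *: (z + z) = z.
Proof.
have -> : z + z = 2 *: z by rewrite scalerDl scale1r.
by rewrite scalerA mulVf ?scale1r // pnatr_eq0.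
Qed.

Lemma dp : d * p = p.
Proof. by rewrite pE' boZr mulrDr mulr1 dd addrC. Qed.
Lemma pd : p * d = p.
Proof. by rewrite pE' boZl mulrDl mul1r dd addrC. Qed.
Lemma dq : d * q = - q.
Proof. by rewrite qE' boZr mulrBr mulr1 dd -scalerN opprB. Qed.
Lemma qd : q * d = - q.
Proof. by rewrite qE' boZl mulrBl mul1r dd -scalerN opprB. Qed.
Lemma pp : p * p = p.
Proof. by rewrite {1}pE' boZl mulrDl mul1r dp half_double. Qed.
Lemma qq : q * q = q.
Proof. by rewrite {1}qE' boZl mulrBl mul1r dq opprK half_double. Qed.
Lemma pq : p * q = 0.
Proof. by rewrite {1}pE' boZl mulrDl mul1r dq subrr scaler0. Qed.
Lemma qp : q * p = 0.
Proof. by rewrite {1}qE' boZl mulrBl mul1r dp subrr scaler0. Qed.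

Lemma star_d : star d = d.
Proof.
rewrite dE starZ star_bJ scalerN -scaleNr; congr (_ *: _).
by apply: eqC => /=; ring.
Qed.
Lemma cb_d : cb d = - d.
Proof.
rewrite dE cbZ cb_bJ -scaleNr; congr (_ *: _).
by apply: eqC => /=; ring.
Qed.

Lemma conj2V : conjc (2^-1 : C) = 2^-1.
Proof. by rewrite conjc_inv conjc_nat. Qed.

Lemma star_p : star p = p.
Proof. by rewrite pE' starZ conj2V starD star1 star_d. Qed.
Lemma star_q : star q = q.
Proof. by rewrite qE' starZ conj2V starB star1 star_d. Qed.
Lemma cb_p : cb p = q.
Proof. by rewrite pE' qE' cbZ conj2V cbD cb1 cb_d. Qed.
Lemma cb_q : cb q = p.
Proof. by rewrite -cb_p cbK. Qed.

Lemma ddA (A : bo) : d * (d * A) = A. Proof. by rewrite mulrA dd mul1r. Qed.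
Lemma dpA (A : bo) : d * (p * A) = p * A. Proof. by rewrite mulrA dp. Qed.
Lemma pdA (A : bo) : p * (d * A) = p * A. Proof. by rewrite mulrA pd. Qed.
Lemma dqA (A : bo) : d * (q * A) = - (q * A). Proof. by rewrite mulrA dq mulNr. Qed.
Lemma qdA (A : bo) : q * (d * A) = - (q * A). Proof. by rewrite mulrA qd mulNr. Qed.
Lemma ppA (A : bo) : p * (p * A) = p * A. Proof. by rewrite mulrA pp. Qed.
Lemma qqA (A : bo) : q * (q * A) = q * A. Proof. by rewrite mulrA qq. Qed.
Lemma pqA (A : bo) : p * (q * A) = 0. Proof. by rewrite mulrA pq mul0r. Qed.
Lemma qpA (A : bo) : q * (p * A) = 0. Proof. by rewrite mulrA qp mul0r. Qed.
(** Normal form for products associated to the right: neighbouring factors among [p], [q], [d] are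
    multiplied out, the variants ending in [A] reaching inside a longer product. *)
Definition pqE := (dd, ddA, dp, dpA, pd, pdA, dq, dqA, qd, qdA, pp, ppA, qq, qqA,
  pq, pqA, qp, qpA, @mulr0 bo, @mul0r bo, @mulrN bo, @mulNr bo,
  @opprK bo, @oppr0 bo, @mulr1 bo, @mul1r bo).
Definition starE := (starM, star_p, star_q, star_d, starK).
Definition cbME := (cbM, cb_p, cb_q, cb_d, cbK).

Lemma blocks (A : bo) : A = p * A * p + p * A * q + (q * A * p + q * A * q).
Proof. by rewrite -!mulrDr addpq !mulr1 -mulrDl addpq mul1r. Qed.

(** Conjugation exchanges [p] and [q], hence exchanges the four blocks in pairs; the two conditions
    compare one block of each pair with the conjugate of the other. *)
Lemma real_blocksP (A : bo) : real_blocks J A <-> cb A = A.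
Proof.
have [b1 b2 b3 b4] := blkE A; rewrite /real_blocks b1 b2 b3 b4.
split=> [[/(@bo_val_inj _ (cb _)) h1 /(@bo_val_inj _ (cb _)) h2]|Ar].
  have := blocks A; rewrite h1 h2; set x := p * A * p; set y := p * A * q => ->.
  by rewrite !cbD !cbK addrC [y + _]addrC [cb y + _]addrC.
have e1 : q * A * p = cb (p * A * q) by rewrite !cbME Ar.
have e2 : q * A * q = cb (p * A * p) by rewrite !cbME Ar.
by rewrite e1 e2.
Qed.

Lemma hnorm_pq x : hnorm x ^+ 2 = hnorm (p x) ^+ 2 + hnorm (q x) ^+ 2.
Proof.
have {1}-> : x = p x + q x by rewrite -boDE addpq.
by rewrite hnormD_sqr starP star_p -boME pq boE herm0r mulr0 addr0.
Qed.

Lemma bnd_p : bnd p 1.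
Proof.
split=> // x; rewrite mul1r; apply: le_sqr; first exact: hnorm_ge0.
by rewrite (hnorm_pq x) lerDl sqr_ge0.
Qed.

Lemma bnd_q : bnd q 1.
Proof.
split=> // x; rewrite mul1r; apply: le_sqr; first exact: hnorm_ge0.
by rewrite (hnorm_pq x) lerDr sqr_ge0.
Qed.

Definition gl (A : bo) := [/\ cb A = A, tc (p * A * p) & hs (p * A * q)].

Lemma gl12P (A : bo) : gl12 ip J A <-> gl A.
Proof.
have [b1 b2 b3 b4] := blkE A; rewrite /gl12 /= b1 b2.
split=> [[_ /real_blocksP ? /tcP ? /hsP ?] //|[? ? ?]].
by split; [exact: bov_bop|exact/real_blocksP|exact/tcP|exact/hsP].
Qed.

Lemma gl_hs (A : bo) : gl A -> hs A.
Proof.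
move=> [Ar Atc Ahs]; rewrite [A]blocks.
have -> : q * A * p = cb (p * A * q) by rewrite !cbME Ar.
have -> : q * A * q = cb (p * A * p) by rewrite !cbME Ar.
have Atc' := tc_hs Atc.
by apply: hsD; apply: hsD => //; exact: hs_cb.
Qed.

Lemma gl_tc (A : bo) : cb A = A -> tc A -> gl A.
Proof.
move=> Ar At; split=> //; first by apply/tcMr/tcMl.
by apply/hsMr/hsMl/tc_hs.
Qed.

Lemma glD (A B : bo) : gl A -> gl B -> gl (A + B).
Proof.
move=> [Ar At Ah] [Br Bt Bh]; split; first by rewrite cbD Ar Br.
  by rewrite mulrDr mulrDl; exact: tcD.
by rewrite mulrDr mulrDl; exact: hsD.
Qed.

Lemma glZ (A : bo) (r : R) : gl A -> gl (r%:C *: A).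
Proof.
move=> [Ar At Ah]; split; first by rewrite cbZ conjc_real Ar.
  by rewrite boZr boZl; exact: tcZ.
by rewrite boZr boZl; exact: hsZ.
Qed.

Lemma glN (A : bo) : gl A -> gl (- A).
Proof.
move=> /(glZ (-1)); rewrite (_ : (-1)%:C = -1) ?scaleN1r //.
by apply: eqC => /=; rewrite ?oppr0.
Qed.

(** Both factors are Hilbert-Schmidt as a whole, so their product is trace class, and so is each of
    its blocks. *)
Lemma glM (A B : bo) : gl A -> gl B -> gl (A * B).
Proof.
move=> Ag Bg; apply: gl_tc; first by case: Ag Bg => [Ar _ _] [Br _ _]; rewrite cbM Ar Br.
by apply: tcM; exact: gl_hs.
Qed.

Lemma gl_star (A : bo) : gl A -> gl (star A).
Proof.
move=> [Ar At Ah]; split; first by rewrite -star_cb Ar.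
  have -> : p * star A * p = star (p * A * p) by rewrite !starE mulrA.
  exact: tc_star.
have -> : p * star A * q = star (cb (p * A * q)) by rewrite !cbME Ar !starE mulrA.
exact/hs_star/hs_cb.
Qed.

Lemma glJl (A : bo) : gl A -> gl (bJ * A).
Proof.
move=> [Ar At Ah]; split; first by rewrite cbM cb_bJ Ar.
  by rewrite bJE boZl boZr boZl mulrA pd; exact: tcZ.
by rewrite bJE boZl boZr boZl mulrA pd; exact: hsZ.
Qed.

Lemma glJr (A : bo) : gl A -> gl (A * bJ).
Proof.
move=> [Ar At Ah]; split; first by rewrite cbM cb_bJ Ar.
  by rewrite bJE boZr boZr boZl -!mulrA dp mulrA; exact: tcZ.
by rewrite bJE boZr boZr boZl -!mulrA dq !mulrN mulrA; exact: hsZ (hsN Ah).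
Qed.

Lemma gl_off (x : bo) : hs x -> p * x * q = x -> gl (x + cb x).
Proof.
move=> xh xpq; have cx : cb x = q * cb x * p by rewrite -{1}xpq !cbME.
split; first by rewrite cbD cbK addrC.
  have -> : p * (x + cb x) * p = 0; last exact: tc0.
  by rewrite cx -{1}xpq mulrDr mulrDl -!mulrA !pqE addr0.
by rewrite cx mulrDr mulrDl -!mulrA !pqE addr0 mulrA xpq.
Qed.

Definition norm12b (A : bo) := trnorm ip (p * A * p) + hsnorm ip (p * A * q).

Lemma norm12b_ge0 (A : bo) : 0 <= norm12b A.
Proof. by apply: addr_ge0; [exact: trnorm_ge0|exact: sqrtr_ge0]. Qed.

Lemma norm12_tc (A : bo) s M : nuc (p * A * p) s -> hsb (p * A * q) M ->
  norm12 ip J A <= s + M.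
Proof.
have [b1 b2 b3 b4] := blkE A; rewrite /norm12 b1 b2.
by move=> As AM; apply: lerD; [exact: (trnorm_le As) | exact: (hsb_hsnorm_le AM)]. Qed.

(** The two blocks measured by [norm12b] determine the other two by conjugation, whence the factor
    2. *)
Lemma gl_bnd (A : bo) : gl A -> bnd A (2 * norm12b A).
Proof.
move=> [Ar At Ah]; have b1 := tc_trnorm_bnd At.
have b2 : bnd (p * A * q) (hsnorm ip (p * A * q)) by apply/hsb_bnd/hs_hsb/hsP.
have bcb (B : bo) M : bnd B M -> bnd (cb B) M.
  by move=> [M0 BM]; split=> // x; rewrite cbE hnorm_cconj -[hnorm x]hnorm_cconj.
have := bndD (bndD b1 b2) (bndD (bcb _ _ b2) (bcb _ _ b1)).
have e1 : q * A * p = cb (p * A * q) by rewrite !cbME Ar.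
have e2 : q * A * q = cb (p * A * p) by rewrite !cbME Ar.
rewrite -e1 -e2 -blocks; congr bnd; rewrite /norm12b; ring.
Qed.

(** * The symplectic group and the disc *)

(** The second relation adds invertibility: the first alone makes [ainv a] a left inverse. *)
Definition sp (a : bo) := [/\ cb a = a, star a * d * a = d & a * d * star a = d].
Definition ainv (a : bo) : bo := locked (d * star a * d).

Lemma ainvE a : ainv a = d * star a * d.
Proof. by rewrite /ainv -lock. Qed.

Lemma ainvr a : sp a -> a * ainv a = 1.
Proof. by move=> [_ _ h]; rewrite ainvE !mulrA h dd. Qed.

Lemma ainvl a : sp a -> ainv a * a = 1.
Proof. by move=> [_ h _]; rewrite ainvE -!mulrA (mulrA (star a)) h dd. Qed.

Lemma sp_star a : sp a -> sp (star a).
Proof. by move=> [h1 h2 h3]; split; rewrite ?starK // -star_cb h1. Qed.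

Lemma sp_mul a b : sp a -> sp b -> sp (a * b).
Proof.
move=> [a1 a2 a3] [b1 b2 b3]; split; first by rewrite cbM a1 b1.
  by rewrite starM -!mulrA (mulrA d) (mulrA (star a)) (mulrA (star a)) a2 mulrA b2.
by rewrite starM !mulrA -(mulrA a) -(mulrA a) b3 a3.
Qed.

Lemma sp_star_d a x : sp a -> star a * (d * (a * x)) = d * x.
Proof. by move=> [_ h _]; rewrite !mulrA h. Qed.

Lemma hnorm_d x : Re (herm (d x) x) = hnorm (p x) ^+ 2 - hnorm (q x) ^+ 2.
Proof.
have h (r : bo) : star r = r -> r * r = r -> hnorm (r x) ^+ 2 = Re (herm (r x) x).
  move=> rs rr; have -> : herm (r x) x = herm (r x) (r x).
      by rewrite -{1}rr boE starP rs.
    by rewrite herm_sqr.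
rewrite (h _ star_p pp) (h _ star_q qq) -ReN -ReD -hermBl; congr (Re (herm _ _)).
by rewrite {1}/d -lock.
Qed.

(** For y in H_-, preservation of the indefinite form |p x|^2 - |q x|^2 gives |q a y|^2 = |y|^2 + |p
    a y|^2. *)
Lemma sp_block_ge a x : sp a -> hnorm x <= hnorm ((q * a * q + p) x).
Proof.
move=> sa; apply: le_sqr; first exact: hnorm_ge0.
rewrite (hnorm_pq ((q * a * q + p) x)) (hnorm_pq x).
have e1 : p ((q * a * q + p) x) = p x.
  by rewrite -boME mulrDr -!mulrA !pqE add0r.
have e2 : q ((q * a * q + p) x) = q (a (q x)).
  by rewrite -boME mulrDr -!mulrA !pqE addr0.
rewrite e1 e2 lerD2l.
have := hnorm_d (a (q x)).
have -> : herm (d (a (q x))) (a (q x)) = herm (d (q x)) (q x).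
  by rewrite starP' -(boME a q) -(boME d) -(boME (star a)) sp_star_d.
rewrite -boME dq boE hermNl herm_sqr ReN /=.
by have := sqr_ge0 (hnorm (p (a (q x)))); lra.
Qed.

(** Adding [p] extends the block to the whole space, and injectivity of the adjoint is the same
    estimate for [star a]. The bound 1, common to all [a], is what controls [ginv] along a curve. *)
Lemma ginv_exists a : sp a -> exists gi : bo,
  [/\ q * gi = gi, gi * q = gi, q * a * q * gi = q, gi * (q * a * q) = q & bnd gi 1].
Proof.
move=> sa; pose T := q * a * q + p.
have [//||B [TB BT] B1] := @inverse_bounded_below T 1 ler01.
- by move=> x; rewrite mul1r; exact: sp_block_ge.
- move=> x Tx; apply/hnorm_eq0/le_anti; rewrite hnorm_ge0 andbT.
  apply: le_trans (sp_block_ge x (sp_star sa)) _.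
  by move: Tx; rewrite /T starD !starE mulrA => ->; rewrite hnorm0.
have Tq : T * q = q * a * q by rewrite /T mulrDl -!mulrA !pqE addr0.
have qT : q * T = q * a * q by rewrite /T mulrDr -!mulrA !pqE addr0.
have qB : q * B = B * q.
  by rewrite -[LHS]mul1r -BT -mulrA (mulrA T) Tq -qT -!mulrA TB mulr1.
exists (q * B); split.
- by rewrite pqE.
- by rewrite -mulrA -qB pqE.
- by rewrite -Tq -!mulrA pqE qB mulrA TB mul1r.
- by rewrite -Tq -!mulrA (mulrA B) BT mul1r qq.
- by have := bndM bnd_q B1; rewrite mulr1.
Qed.

(* The inverse on H_- of the block conj g of a, extended by 0. *)
Definition ginv (a : bo) : bo := xget 0 [set gi : bo |
  [/\ q * gi = gi, gi * q = gi, q * a * q * gi = q, gi * (q * a * q) = q & bnd gi 1]].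

Lemma ginvP a : sp a -> [/\ q * ginv a = ginv a, ginv a * q = ginv a,
  q * a * q * ginv a = q, ginv a * (q * a * q) = q & bnd (ginv a) 1].
Proof. by move=> /ginv_exists[g hg]; rewrite /ginv; case: xgetP => [_ -> //|/(_ g)]. Qed.

(** Two-sided inverses relative to [P] are unique, so the choice made by [invop] can only be [B]. *)
Lemma invopE (P A B : bo) : P * B = B -> B * P = B -> A * B = P -> B * A = P ->
  invop ip P A = B.
Proof.
move=> PB BP AB BA; rewrite /invop; set S := [set _ | _].
have SB : S B.
  split; first exact: bov_bop.
  - by rewrite -[in RHS]BP -[in RHS]PB.
  - by have := congr1 bov AB.
  - by have := congr1 bov BA.
case: xgetP => [D _ [Db PDP AD DA]|/(_ _ SB)//].
have [D' DE] : exists D' : bo, bov D' = D by exists (Bo Db).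
subst D.
have PD : P * D' * P = D' by apply: bo_val_inj.
have {}AD : A * D' = P by apply: bo_val_inj.
have {}DA : D' * A = P by apply: bo_val_inj.
have PP : P * P = P by rewrite -{2}BA mulrA PB.
have D'P : D' * P = D' by rewrite -{1}PD -mulrA PP PD.
by congr bov; rewrite -D'P -AB mulrA DA PB.
Qed.

Definition ch (a : bo) : bo := locked (p * a * q * ginv a).

Lemma chE a : ch a = p * a * q * ginv a.
Proof. by rewrite /ch -lock. Qed.

Lemma chartE a : sp a -> chart ip J a = ch a.
Proof.
move=> sa; have [g1 g2 g3 g4 _] := ginvP sa; have [_ b2 _ b4] := blkE a.
by rewrite /chart b2 b4 qE (@invopE q _ (ginv a)) // chE.
Qed.

Lemma mobiusE (a Z Di : bo) (D := q * a * p * Z + q * a * q) :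
  q * Di = Di -> Di * q = Di -> D * Di = q -> Di * D = q ->
  mobius ip J a Z = bov ((p * a * p * Z + p * a * q) * Di).
Proof.
move=> qDi Diq DDi DiD; have [b1 b2 b3 b4] := blkE a.
rewrite /mobius b1 b2 b3 b4 qE.
by rewrite (_ : bov (q * a * p) \o Z + bov (q * a * q) = bov D) // (@invopE q D Di).
Qed.

Lemma mobius0E a : sp a -> mobius ip J a (fun=> 0) = ch a.
Proof.
move=> sa; have [g1 g2 g3 g4 _] := ginvP sa.
by rewrite (_ : (fun=> 0) = bov 0) // (@mobiusE a 0 (ginv a)) // !mulr0 !add0r // chE.
Qed.

(* v |-> Z v + v on H_-, the graph of Z. *)
Definition zt (Z : bo) : bo := locked (Z + q).

Lemma ztE Z : zt Z = Z + q.
Proof. by rewrite /zt -lock. Qed.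

(** The graph of Z is the image of H_- under [a]; both sides parametrise it by the component in
    H_-. *)
Lemma zt_ch a : sp a -> zt (ch a) = a * ginv a.
Proof.
move=> sa; have [g1 _ g3 _ _] := ginvP sa.
by rewrite ztE chE -[X in _ + X]g3 -mulrDl -mulrDl -mulrDl addpq mul1r -mulrA g1.
Qed.

Lemma zt_gb a : sp a -> zt (ch a) * (q * a * q) = a * q.
Proof. by move=> sa; have [_ _ _ g4 _] := ginvP sa; rewrite zt_ch // -mulrA g4. Qed.

Lemma ch_pq a : sp a -> p * ch a = ch a /\ ch a * q = ch a.
Proof.
move=> sa; have [_ g2 _ _ _] := ginvP sa.
by rewrite chE -!mulrA g2 !pqE.
Qed.

Lemma gb_inj a (x y : bo) : sp a -> x * q = x -> y * q = y ->
  x * (q * a * q) = y * (q * a * q) -> x = y.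
Proof.
move=> sa xq yq /(congr1 (fun z => z * ginv a)).
by have [_ _ g3 _ _] := ginvP sa; rewrite /= -(mulrA x) -(mulrA y) g3 xq yq.
Qed.

(* The relation [p a^* p a q = p a^* q a q] is the off-diagonal block of [a^* d a = d]. *)
Lemma sp_off a : sp a -> p * star a * p * a * q = p * star a * q * a * q.
Proof.
move=> [_ h _]; apply/eqP; rewrite -subr_eq0 -mulrBl -mulrBl.
have -> : p * star a * p - p * star a * q = p * star a * d by rewrite -mulrBr /d -lock.
by rewrite -!mulrA (mulrA d) (mulrA (star a)) (mulrA (star a)) h !pqE.
Qed.

(** The transpose of Z is [gs * (p * star a * q)], where [gs] is a left inverse of the block g^* of
    [star a]. After multiplication by conj g on the right, symmetry becomes [sp_off]. *)
Lemma ch_sym a : sp a -> star (cb (ch a)) = ch a.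
Proof.
move=> sa; have [g1 g2 g3 g4 _] := ginvP sa; have [ar _ _] := sa.
set gs := star (cb (ginv a)).
have gsE : gs * (p * star a * p) = p.
  by have := congr1 (fun z => star (cb z)) g3; rewrite /= !cbME ar !starE /gs !mulrA.
have -> : star (cb (ch a)) = gs * (p * star a * q).
  by rewrite chE !cbME ar !starE -!mulrA.
apply: (gb_inj sa); first by rewrite -!mulrA !pqE.
  by case: (ch_pq sa).
have -> : gs * (p * star a * q) * (q * a * q) = gs * (p * star a * q * a * q).
  by rewrite -!mulrA !pqE.
rewrite -(sp_off sa).
have -> : gs * (p * star a * p * a * q) = gs * (p * star a * p) * (p * a * q).
  by rewrite -!mulrA !pqE.
by rewrite gsE chE -(mulrA (p * a * q)) g4 -!mulrA !pqE.
Qed.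

Lemma zt_norm Z : p * Z = Z -> star (zt Z) * d * zt Z = star Z * Z - q.
Proof.
move=> pZ; rewrite ztE starD star_q.
have sZ : star Z * p = star Z by rewrite -[in RHS]pZ starM star_p.
have -> : (star Z + q) * d = star Z - q.
  by rewrite mulrDl qd -sZ -mulrA pd.
have sZq : star Z * q = 0 by rewrite -sZ -mulrA pq mulr0.
have qZ : q * Z = 0 by rewrite -pZ qpA.
by rewrite mulrBl !mulrDr sZq qZ qq addr0 add0r.
Qed.

(** The left side is minus the form [d] on the graph of Z. That graph is the image of H_-, where [a]
    preserves the form and [d] is - 1. Both the positivity defining the disc and the inverses in the
    trace formula rest on this. *)
Lemma one_sub_ZZ a : sp a -> q - star (ch a) * ch a = star (ginv a) * ginv a.
Proof.
move=> sa; have [pZ _] := ch_pq sa; have [g1 _ _ _ _] := ginvP sa.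
have dg : d * ginv a = - ginv a by rewrite -g1 dqA.
by rewrite -opprB -(zt_norm pZ) zt_ch // starM -!mulrA sp_star_d // dg mulrN opprK.
Qed.

Definition sym (U : bo) := [/\ hs U, p * U * q = U & star (cb U) = U].

Lemma symP (U : bo) : sym_hs ip J U <-> sym U.
Proof.
have [_ b2 _ _] := blkE U; rewrite /sym_hs /= b2.
split=> [[/hsP ? h1 h2]|[? h1 h2]]; split.
- by [].
- exact: bo_val_inj.
- by apply: bo_val_inj; exact: h2.
- exact/hsP.
- by rewrite h1.
- by have := congr1 bov h2.
Qed.

Lemma ch_in_sym a : sp a -> hs (p * a * q) -> sym (ch a).
Proof.
move=> sa ah; split; first by rewrite chE; apply: hsMr.
  by have [h1 h2] := ch_pq sa; rewrite h1 h2.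
exact: ch_sym.
Qed.

Lemma ch_disc a : sp a -> hs (p * a * q) -> siegel_disc ip J (ch a).
Proof.
move=> sa ah; split; first exact/symP/ch_in_sym.
move=> u Ju u0; have [g1 _ _ g4 _] := ginvP sa.
have qu : q u = u.
  rewrite -qE /Pm Ju scalerA (_ : _ * _ = 1); last by apply: eqC => /=; ring.
  rewrite scale1r; have -> : u + u = (2 : C) *: u by rewrite scalerDl scale1r.
  by rewrite scalerA mulVf ?scale1r // pnatr_eq0.
have -> : u - adj ip (ch a) (ch a u) = (q - star (ch a) * ch a) u.
  by rewrite boE boNE qu.
rewrite one_sub_ZZ // boE -starP' herm_sqr ltcR exprn_gt0 // lt0r hnorm_ge0 andbT.
apply/eqP => /hnorm_eq0 gu; apply: u0; rewrite -qu.
have [_ _ g3 _ _] := ginvP sa.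
by rewrite -g3 boE gu (lin0 (bo_linear _)).
Qed.

Lemma bJ_d (a : bo) : star a * bJ * a = bJ <-> star a * d * a = d.
Proof.
split=> h.
  rewrite dE boZr boZl h //.
by rewrite bJE boZr boZl h.
Qed.

Lemma sp_invertible a : sp a -> invertible ip a.
Proof.
move=> sa; exists (ainv a); split; first exact: bov_bop.
  by have := congr1 bov (ainvr sa).
by have := congr1 bov (ainvl sa).
Qed.

Lemma sp_intro (a : bo) : cb a = a -> star a * bJ * a = bJ -> invertible ip a -> sp a.
Proof.
move=> ar /bJ_d h [b [bb ab ba]]; split=> //.
pose b' := Bo bb.
have ab' : a * b' = 1 by apply: bo_val_inj.
have : ainv a = b'.
  rewrite -[LHS]mulr1 -ab' mulrA.
  have -> : ainv a * a = 1 by rewrite ainvE -!mulrA (mulrA (star a)) h dd.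
  by rewrite mul1r.
move=> b'E; rewrite -[LHS]mulr1 -dd mulrA.
have -> : a * d * star a * d = a * ainv a by rewrite ainvE !mulrA.
by rewrite b'E ab' mul1r.
Qed.

Lemma bop_sub_id (A : H -> H) : bop ip (A - idfun) -> bop ip A.
Proof. by move=> /bop_add/(_ bop_id); rewrite subrK. Qed.

Lemma GL12_bo (A : H -> H) : GL12 ip J A -> exists a : bo, bov a = A /\ gl (a - 1).
Proof.
move=> [gA _]; have Ab : bop ip A by case: gA => /bop_sub_id.
by exists (Bo Ab); split=> //; apply/gl12P.
Qed.

Lemma gl_sub1_real a : gl (a - 1) -> cb a = a.
Proof. by move=> [+ _ _]; rewrite cbB cb1 => /addIr. Qed.

Lemma Sp12P (A : H -> H) : Sp12 ip J A <-> exists a : bo, [/\ bov a = A, sp a & gl (a - 1)].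
Proof.
split=> [[AG AJ]|[a [<- sa ga]]].
  have [a [aA ga]] := GL12_bo AG; subst A; exists a; split=> //.
  apply: sp_intro; [exact: gl_sub1_real|exact: bo_val_inj|by case: AG].
split; first by split; [exact/(gl12P (a - 1))|exact: sp_invertible].
by have /bJ_d/(congr1 bov) := let: And3 _ h _ := sa in h.
Qed.

Lemma SpresP (A : H -> H) : Spres ip J A <-> exists a : bo, [/\ bov a = A, sp a & hs (p * a * q)].
Proof.
split=> [[[Ab Ar] Ai AJ Ah]|[a [<- sa ah]]].
  exists (Bo Ab); have [_ b2 _ _] := blkE (Bo Ab); split=> //.
    by apply: sp_intro => //; [exact/real_blocksP|exact: bo_val_inj].
  by apply/hsP; rewrite -b2.
have [_ b2 _ _] := blkE a; have [ar aJ _] := sa; split.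
- by split; [exact: bov_bop|exact/real_blocksP].
- exact: sp_invertible.
- by have /bJ_d/(congr1 bov) := aJ.
- by rewrite b2; exact/hsP.
Qed.

(** X = a^* J a - J is itself skew-adjoint and in [gl12]. Evaluated on it, the momentum map is a
    nonzero multiple of Tr (X X), which is minus the squared Hilbert-Schmidt norm of X; hence X =
    0. *)
Lemma muO_zeroP (A : H -> H) : muO_zero ip J A <-> Sp12 ip J A.
Proof.
split=> [[AG Amu]|/[dup] SA [AG AJ]]; last first.
  split=> // B [BG _]; have Bb : bop ip B by case: BG.
  rewrite /muO AJ subrr; have -> : 0 \o B = bov 0 :> (H -> H) by [].
  by rewrite (trcE trc0) mulr0.
have [a [aA ga]] := GL12_bo AG; subst A.
pose X := star a * bJ * a - bJ.
have sX : star X = - X.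
  by rewrite /X starB !starM starK star_bJ opprK opprB !mulNr !mulrN mulrA addrC.
have gX : gl X.
  pose m := a - 1; have -> : X = star m * bJ + bJ * m + star m * (bJ * m).
    have am : a = m + 1 by rewrite subrK.
    rewrite /X {1 2}am starD star1 !mulrDl !mulrDr !mul1r !mulr1 -!mulrA.
    by rewrite addrA addrK -addrA addrC.
  have gm := ga; have gsm := gl_star ga.
  by apply: glD; [apply: glD; [exact: glJr|exact: glJl]|apply: glM => //; exact: glJl].
have tXX : trc (X * X) (- (hssq X)%:C).
  have -> : X * X = - (star X * X) by rewrite sX mulNr opprK.
  exact/trcN/trc_hsnorm/gl_hs.
have X0 : hssq X = 0.
  have /Amu : o12 ip J X.
    split; first exact/gl12P.
    by have /(congr1 bov) : star X + X = 0 by rewrite sX addNr.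
  have -> : muO ip J a X = - 2^-1 * tr ip (X * X) by [].
  rewrite (trcE tXX) mulrN mulNr opprK => /eqP; rewrite mulf_eq0 invr_eq0 pnatr_eq0 /=.
  by move=> /eqP[].
have {}X0 := hssq_eq0 (gl_hs gX) X0.
split=> //; have : star a * bJ * a = bJ by apply/eqP; rewrite -subr_eq0 -/X X0.
by move=> /(congr1 bov).
Qed.

(* [a J a^-1 = i (bE a)]. *)
Definition bE (a : bo) : bo := locked (a * d * ainv a).

Lemma bEE a : bE a = a * d * ainv a.
Proof. by rewrite /bE -lock. Qed.

Lemma orbit_pointE (gamma : R) a : sp a ->
  orbit_point ip J gamma a = bov (gamma%:C *: ('i%C *: (bE a - d))).
Proof.
move=> sa; rewrite /orbit_point.
have -> : invop ip idfun a = ainv a.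
  have -> : idfun = bov 1 by [].
  by rewrite (@invopE 1 a (ainv a)) ?mul1r ?mulr1 ?ainvr ?ainvl.
have -> : 'i%C *: (bE a - d) = a * bJ * ainv a - bJ.
  by rewrite bEE bJE boZr boZl scalerBr.
by [].
Qed.

Lemma bE_real a : sp a -> cb (bE a) = - bE a.
Proof.
by move=> [ar _ _]; rewrite bEE ainvE !cbM cb_d -star_cb ar !mulrN !mulNr !mulrN opprK.
Qed.

Lemma bE_zt a : sp a -> bE a * zt (ch a) = - zt (ch a).
Proof.
move=> sa; have [g1 _ _ _ _] := ginvP sa.
rewrite zt_ch // bEE -!mulrA (mulrA (ainv a)) ainvl // mul1r.
by rewrite -g1 dqA mulrN.
Qed.

Lemma bE_unique a b : sp a -> sp b -> ch a = ch b -> bE a = bE b.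
Proof.
move=> sa sb ab.
have h c : sp c -> bE c * (zt (ch c) + cb (zt (ch c))) = cb (zt (ch c)) - zt (ch c).
  move=> sc; rewrite mulrDr bE_zt //.
  have -> : bE c * cb (zt (ch c)) = cb (zt (ch c)).
    by rewrite -[RHS]opprK -cbN -(bE_zt sc) cbM bE_real // mulNr opprK.
  by rewrite addrC.
have ha := h _ sa; have := h _ sb; rewrite -ab -ha => hb.
have [g1 g2 g3 g4 _] := ginvP sa; have [ar _ _] := sa.
(* The right inverse comes from [zt_gb] and its conjugate: the diagonal blocks of [a] turn the two
   graph maps into the two columns of [a], and [ainv a] then cancels their sum. *)
have e : (zt (ch a) + cb (zt (ch a))) * ((q * a * q + p * a * p) * ainv a) = 1.
  rewrite mulrA mulrDr !mulrDl zt_gb //.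
  have ca : cb (zt (ch a)) * (p * a * p) = a * p.
    by have := congr1 cb (zt_gb sa); rewrite !cbME ar.
  have cq : cb (zt (ch a)) = cb (zt (ch a)) * p.
    have : zt (ch a) = zt (ch a) * q by rewrite ztE mulrDl (ch_pq sa).2 qq.
    by move=> /(congr1 cb); rewrite !cbME.
  have zq : zt (ch a) = zt (ch a) * q by rewrite ztE mulrDl (ch_pq sa).2 qq.
  have -> : cb (zt (ch a)) * (q * a * q) = 0 by rewrite cq -!mulrA !pqE.
  have -> : zt (ch a) * (p * a * p) = 0 by rewrite zq -!mulrA !pqE.
  by rewrite mul0r addr0 add0r ca -mulrDl -mulrDr addrC addpq mulr1 ainvr.
by rewrite -(mulr1 (bE a)) -(mulr1 (bE b)) -e (mulrA (bE a)) (mulrA (bE b)) hb.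
Qed.

(** * Cayley curves *)

Lemma cvg0_at0P (f : R -> R) : (f t @[t --> (0 : R)^'] --> (0 : R)) <->
  forall e, 0 < e -> exists2 del, 0 < del & forall t, t != 0 -> `|t| <= del -> `|f t| <= e.
Proof.
split=> [/cvgrPdist_le h e ep|h].
  have [r /= r0 hr] := h _ ep; exists (r / 2); first by rewrite divr_gt0.
  move=> t t0 tr; have := hr t; rewrite /= !sub0r !normrN; apply=> //.
  by apply: le_lt_trans tr _; rewrite ltr_pdivrMr // ltr_pMr // ltr1n.
apply/cvgrPdist_le => e ep; have [r r0 hr] := h _ ep.
exists r => //= t; rewrite /= sub0r normrN => tr t0; rewrite sub0r normrN.
by apply: hr => //; exact: ltW.
Qed.

Lemma cvg0_lin (f : R -> R) (del M : R) : 0 < del -> 0 <= M ->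
  (forall t, t != 0 -> `|t| <= del -> 0 <= f t <= M * `|t|) ->
  f t @[t --> (0 : R)^'] --> (0 : R).
Proof.
move=> d0 M0 fM; apply/cvg0_at0P => e ep; have M1 : 0 < M + 1 by rewrite ltr_wpDl.
exists (Num.min del (e / (M + 1))); first by rewrite lt_min d0 divr_gt0.
move=> t t0; rewrite le_min => /andP[td te]; have /andP[f0 ft] := fM t t0 td.
rewrite ger0_norm //; apply: le_trans ft _.
move: te; rewrite ler_pdivlMr // mulrC; apply: le_trans.
by rewrite ler_wpM2r // lerDl.
Qed.

Lemma quotient_quad (c : R -> bo) (v Q : bo) t : t != 0 ->
  c t = c 0 + (t%:C *: v + (t ^+ 2)%:C *: Q) ->
  (t^-1)%:C *: (c t - c 0) - v = t%:C *: Q.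
Proof.
move=> t0 ->; rewrite [c 0 + _]addrC addrK scalerDr !scalerA.
have -> : (t^-1)%:C * t%:C = 1 :> C.
  by apply: eqC => /=; rewrite ?mulr0 ?mul0r ?addr0 ?subr0 // mulVf.
have -> : (t^-1)%:C * (t ^+ 2)%:C = t%:C :> C.
  apply: eqC => /=; rewrite ?mulr0 ?mul0r ?addr0 ?subr0 //.
  by rewrite expr2 mulrA mulVf // mul1r.
by rewrite scale1r addrAC subrr add0r.
Qed.

(** With an exact quadratic remainder, the error of the difference quotient is [t%:C *: Q t];
    nuclear and Hilbert-Schmidt bounds uniform in [t] make it O(t). *)
Lemma velocity_norm12 (c Q : R -> bo) v (del s M : R) : 0 < del ->
  (forall t, t != 0 -> `|t| <= del ->
    c t = c 0 + (t%:C *: v + (t ^+ 2)%:C *: Q t) /\ nuc (Q t) s /\ hsb (Q t) M) ->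
  norm12 ip J ((t^-1)%:C *: (bov (c t) - bov (c 0)) - bov v) @[t --> (0 : R)^'] --> (0 : R).
Proof.
move=> d0 h; have [_ [ns hM]] : c del = c 0 + (del%:C *: v + (del ^+ 2)%:C *: Q del) /\
   nuc (Q del) s /\ hsb (Q del) M by apply: h; rewrite ?gt_eqF // gtr0_norm.
apply: (@cvg0_lin _ del (s + M)) => //.
  by rewrite addr_ge0 ?(nuc_ge0 ns) // hM.1.
move=> t t0 td; have [ct [nt ht]] := h _ t0 td.
rewrite (_ : _ - bov v = bov ((t^-1)%:C *: (c t - c 0) - v)) // (quotient_quad t0 ct).
apply/andP; split.
  have [b1 b2 _ _] := blkE (t%:C *: Q t); rewrite /norm12 b1 b2; exact: norm12b_ge0.
have b1 := nucMr bnd_p (nucMl bnd_p (nucZ t%:C nt)).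
have b2 := hsbMr bnd_q (hsbMl bnd_p (hsbZ t%:C ht)).
apply: le_trans (norm12_tc b1 b2) _.
by rewrite cnormR !mul1r !mulr1 -mulrDr mulrC.
Qed.

Lemma velocity_hsnorm (c Q : R -> bo) v (del M : R) : 0 < del ->
  (forall t, t != 0 -> `|t| <= del ->
    c t = c 0 + (t%:C *: v + (t ^+ 2)%:C *: Q t) /\ hsb (Q t) M) ->
  hsnorm ip ((t^-1)%:C *: (bov (c t) - bov (c 0)) - bov v) @[t --> (0 : R)^'] --> (0 : R).
Proof.
move=> d0 h; have [_ hM] : c del = c 0 + (del%:C *: v + (del ^+ 2)%:C *: Q del) /\
   hsb (Q del) M by apply: h; rewrite ?gt_eqF // gtr0_norm.
apply: (@cvg0_lin _ del M) => //; first by rewrite hM.1.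
move=> t t0 td; have [ct ht] := h _ t0 td.
rewrite (_ : _ - bov v = bov ((t^-1)%:C *: (c t - c 0) - v)) // (quotient_quad t0 ct).
apply/andP; split; first exact: sqrtr_ge0.
apply: le_trans (hsb_hsnorm_le (hsbZ t%:C ht)) _.
by rewrite cnormR mulrC.
Qed.

Lemma inv_unique (A B D : bo) : A * B = 1 -> D * A = 1 -> B = D.
Proof. by move=> AB DA; rewrite -[B]mul1r -DA -mulrA AB mulr1. Qed.

Lemma cayley_resolvent (X : bo) : exists2 del : R, 0 < del &
  exists K : R -> bo, forall t, `|t| <= del ->
    [/\ (1 - t%:C *: X) * K t = 1, K t * (1 - t%:C *: X) = 1 & bnd (K t) 2].
Proof.
have [M [M0 XM]] := bnd_ex X; have M1 : 0 < M + 1 by rewrite ltr_wpDl.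
(* Below this radius t X has norm at most 1/2, as [inverse_near1] requires; the added 1 allows for
   [M = 0]. *)
exists (2 * (M + 1))^-1; first by rewrite invr_gt0 mulr_gt0.
suff : forall t : R, exists K : bo, `|t| <= (2 * (M + 1))^-1 ->
    [/\ (1 - t%:C *: X) * K = 1, K * (1 - t%:C *: X) = 1 & bnd K 2].
  by move=> /choice[K hK]; exists K.
move=> t; have [td|] := leP `|t| _; last by exists 0.
have [|K [K1 K2] K3] := @inverse_near1 (- (t%:C *: X)); last by exists K.
move=> x; rewrite !boE hnormN hnormZ cnormR.
apply: (@le_trans _ _ (`|t| * (M + 1) * hnorm x)).
  rewrite -mulrA ler_wpM2l //; apply: le_trans (XM x) _.
  by rewrite ler_wpM2r ?hnorm_ge0 // lerDl.
rewrite ler_wpM2r ?hnorm_ge0 // -ler_pdivlMr //.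
by apply: le_trans td _; rewrite invfM.
Qed.

(** Substituting K = 1 + Y K into itself gives expansions that stop at second order, the rest being
    carried by the factor [K]. The square of the transform is what enters the orbit, by [bE_mul]. *)
Lemma cayleyE (Y K : bo) : (1 - Y) * K = 1 -> K * (1 - Y) = 1 ->
  [/\ (1 + Y) * K = 1 + (Y *+ 2 + (Y * Y * K) *+ 2), K * (1 + Y) = (1 + Y) * K
    & ((1 + Y) * K) * ((1 + Y) * K) = 1 + (Y *+ 4 + (Y * Y * (K + K * K)) *+ 4)].
Proof.
move=> h1 h2.
have K1 : K = 1 + Y * K by rewrite -[X in X + _]h1 mulrBl mul1r subrK.
have K2 : K = 1 + K * Y by rewrite -[X in X + _]h2 mulrBr mulr1 subrK.
have YK : K * Y = Y * K by apply: (addrI 1); rewrite -K1 -K2.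
have e1 : (1 + Y) * K = 1 + (Y * K) *+ 2.
  by rewrite mulrDl mul1r {1}K1 -addrA -mulr2n.
have e2 : Y * K = Y + Y * Y * K by rewrite {1}K1 mulrDr mulr1 mulrA.
split.
- by rewrite e1 {1}e2 mulrnDl.
- by rewrite mulrDl mulrDr mul1r mulr1 YK.
rewrite e1 mulrDl mul1r mulrDr mulr1 -addrA; congr (1 + _).
have e3 : (Y * K) * (Y * K) = Y * Y * (K * K).
  by rewrite -mulrA (mulrA K) YK -!mulrA.
rewrite mulrnAl mulrnAr e3 -mulrnA addrA -mulrnDr [in RHS]mulrDr {1}e2.
by rewrite !mulrnDl -addrA.
Qed.

(** Self-adjointness of [X] and anticommutation with [d] make the transform self-adjoint and give c
    d c = d. Its second-order part contains X X, a product of two Hilbert-Schmidt operators, so c -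
    1 stays in [gl]. *)
Lemma cayley (X : bo) : cb X = X -> star X = X -> X * d = - (d * X) -> gl X ->
  exists c L L' : R -> bo, exists2 del : R, 0 < del <= 1 &
  [/\ c 0 = 1, forall t, [/\ sp (c t), star (c t) = c t & gl (c t - 1)] &
   forall t, `|t| <= del -> [/\ bnd (L t) 4, bnd (L' t) 24,
     c t = 1 + (t%:C *: (X *+ 2) + (t ^+ 2)%:C *: (X * X * L t)) &
     c t * c t = 1 + (t%:C *: (X *+ 4) + (t ^+ 2)%:C *: (X * X * L' t))]].
Proof.
move=> Xr Xs Xd Xg; have [del d0 [K hK]] := cayley_resolvent X.
pose del' := Num.min del 1.
have del'P : 0 < del' <= 1 by rewrite lt_min d0 ltr01 ge_min lexx orbT.
(* Beyond [del'] the curve is set to 1, because [velocity] asks it to stay in the group for every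
   real [t]. *)
pose c t := if `|t| <= del' then (1 + t%:C *: X) * K t else 1.
have hK' t : `|t| <= del' ->
    [/\ (1 - t%:C *: X) * K t = 1, K t * (1 - t%:C *: X) = 1 & bnd (K t) 2].
  by rewrite le_min => /andP[/hK].
exists c, (fun t => K t *+ 2), (fun t => (K t + K t * K t) *+ 4), del' => //.
have cE t : `|t| <= del' -> c t = (1 + t%:C *: X) * K t by rewrite /c => ->.
have sq (t : R) (A : bo) : (t%:C *: X) * (t%:C *: X) * A = (t ^+ 2)%:C *: (X * X * A).
  rewrite !boZl boZr !boZl scalerA; congr (_ *: _).
  by apply: eqC => /=; ring.
have big t : `|t| <= del' -> [/\ bnd (K t *+ 2) 4, bnd ((K t + K t * K t) *+ 4) 24,
     c t = 1 + (t%:C *: (X *+ 2) + (t ^+ 2)%:C *: (X * X * (K t *+ 2))) &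
     c t * c t = 1 + (t%:C *: (X *+ 4) + (t ^+ 2)%:C *: (X * X * ((K t + K t * K t) *+ 4)))].
  (* As [K t] has bound 2, the constants are 2 + 2 = 4 and four times 2 + 4, that is 24. *)
  move=> td; have [K1 K2 K3] := hK' _ td; have [e1 _ e2] := cayleyE K1 K2.
  rewrite cE // e2 e1 !sq; split.
  - have := bndD K3 K3; rewrite mulr2n; congr bnd; ring.
  - have b := bndD K3 (bndM K3 K3); have := bndD (bndD b b) (bndD b b).
    by rewrite -!mulr2n -mulrnA; congr bnd; ring.
  - by rewrite !scalerMnr mulrnAr.
  - by rewrite !scalerMnr mulrnAr.
split=> [||t td]; last exact: big.
  by rewrite cE ?normr0 ?(ltW (andP del'P).1) // scale0r addr0 mul1r;
    have [+ _ _] := hK' 0 (eq_ind_r (fun z => z <= del') (ltW (andP del'P).1) (normr0 R));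
    rewrite scale0r subr0 mul1r.
move=> t; have [td|td] := boolP (`|t| <= del'); last first.
  rewrite /c (negbTE td); split; last by rewrite subrr; apply: gl_tc;
    [rewrite -(subrr 1) cbB cb1|exact: tc0].
    by split; rewrite ?cb1 ?star1 ?mulr1 ?mul1r.
  exact: star1.
have [K1 K2 K3] := hK' _ td; have [_ Kc _] := cayleyE K1 K2.
set Y := t%:C *: X in K1 K2 Kc.
have Yr : cb Y = Y by rewrite /Y cbZ conjc_real Xr.
have Ys : star Y = Y by rewrite /Y starZ conjc_real Xs.
have Yd : Y * d = - (d * Y) by rewrite /Y boZl boZr Xd scalerN.
have Kr : cb (K t) = K t.
  by have := congr1 cb K1 => h; apply: (inv_unique _ K2); move: h; rewrite cbM cbB !cb1 Yr.
have Ks : star (K t) = K t.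
  by have := congr1 star K2 => h; apply: (inv_unique _ K2); move: h; rewrite starM starB !star1 Ys.
have cr : cb (c t) = c t by rewrite cE // cbM cbD cb1 Yr Kr.
have cs : star (c t) = c t by rewrite cE // starM starD star1 Ys Ks.
(* Moving [d] across 1 + Y turns it into 1 - Y, which cancels against a resolvent; this happens once
   on each side. *)
have cd : c t * d * c t = d.
  rewrite cE // -/Y -{1}Kc -!mulrA.
  have -> : (1 + Y) * (d * ((1 + Y) * K t)) = d * ((1 - Y) * ((1 + Y) * K t)).
    by rewrite !mulrA; congr (_ * _ * _); rewrite mulrDl mul1r Yd mulrBr mulr1.
  rewrite -Kc (mulrA (1 - Y)) K1 mul1r.
  have -> : d * (1 + Y) = (1 - Y) * d by rewrite mulrDr mulr1 mulrBl mul1r Yd opprK.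
  by rewrite mulrA K2 mul1r.
split=> //; first by split; rewrite ?cs.
have [_ _ -> _] := big _ td; rewrite addrAC subrr add0r; apply: glD.
  by apply: glZ; rewrite mulr2n; exact: glD.
apply: glZ; apply: gl_tc.
  by rewrite !cbM mulr2n cbD Kr Xr.
by apply/tcMr/tcM; exact: gl_hs.
Qed.

Lemma gl_mul1 a b : gl (a - 1) -> gl (b - 1) -> gl (a * b - 1).
Proof.
move=> ga gb; have -> : a * b - 1 = (a - 1) * (b - 1) + (a - 1) + (b - 1).
  by rewrite mulrBr mulr1 subrK mulrBl mul1r addrA subrK.
by apply: glD => //; apply: glD => //; exact: glM.
Qed.

Lemma gl_sp_hs a : gl (a - 1) -> hs (p * a * q).
Proof. by move=> [_ _]; rewrite mulrBr mulrBl mulr1 pq subr0. Qed.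

(** * Differences of the chart and the encoding of tangent vectors *)

Lemma ch_gb a : sp a -> ch a * (q * a * q) = p * a * q.
Proof.
by move=> sa; have [_ _ _ g4 _] := ginvP sa; rewrite chE -mulrA g4 -!mulrA !pqE.
Qed.

(** [p - ch a] sends Z v + v to Z v - Z v: it annihilates the graph of Z, which is the image of H_-
    under [a]. *)
Lemma p_sub_ch_q a : sp a -> (p - ch a) * a * q = 0.
Proof.
move=> sa; rewrite !mulrBl -(ch_gb sa) -[in X in _ - X](ch_pq sa).2 -!mulrA.
by rewrite subrr.
Qed.

(** An exact formula for increments of the chart. By [p_sub_ch_q] only the part [b - a] of [b]
    contributes on H_-, so one factor of the increment is explicit. *)
Lemma ch_sub a b : sp a -> sp b -> ch b - ch a = (p - ch a) * b * ginv b.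
Proof.
move=> sa sb; have [g1 _ g3 _ _] := ginvP sb; rewrite !mulrBl; congr (_ - _).
  by rewrite chE -!mulrA g1.
by rewrite -[in LHS](ch_pq sa).2 -g3 -[in RHS](ch_pq sa).2 -!mulrA g1.
Qed.

Lemma ginv_sub a b : sp a -> sp b ->
  ginv b = ginv a - ginv b * (q * (b - a) * q) * ginv a.
Proof.
move=> sa sb; have [a1 a2 a3 a4 _] := ginvP sa; have [b1 b2 b3 b4 _] := ginvP sb.
rewrite mulrBr mulrBl (mulrBr (ginv b)) mulrBl b4 a1 -(mulrA (ginv b)) a3 b2.
by rewrite opprB addrC subrK.
Qed.

(* g^* U conj g. *)
Definition symx a U : bo := locked (p * star a * U * (q * a * q)).

Lemma symxE a U : symx a U = p * star a * U * (q * a * q).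
Proof. by rewrite /symx -lock. Qed.

Lemma symx_pq a U : p * symx a U * q = symx a U.
Proof. by rewrite symxE -!mulrA !pqE. Qed.

Lemma cb_pq x : p * x * q = x -> cb x * p = cb x.
Proof. by move=> h; rewrite -{1}h -[in RHS]h !cbME -!mulrA pp. Qed.

Lemma symx_hs a U : sym U -> hs (symx a U).
Proof. by move=> [Uh _ _]; rewrite symxE; apply/hsMr/hsMl. Qed.

Lemma symx_sym a U : sp a -> sym U -> star (symx a U) = cb (symx a U).
Proof.
move=> [ar _ _] [_ Upq Us]; rewrite symxE !cbM !starM !starK star_p star_q cb_p cb_q ar.
have -> : cb U = star U by rewrite -[in RHS]Us starK.
have -> : star U = q * star U * p by rewrite -{1}Upq !starE mulrA.
by rewrite -star_cb ar -!mulrA !pqE.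
Qed.

Lemma p_sub_ch_star a : sp a -> (p - ch a) * a * p * star a = (p - ch a) * d.
Proof.
move=> sa; have [_ _ h] := sa.
have -> : (p - ch a) * a * p = (p - ch a) * a * d.
  have -> : d = p - q by rewrite /d -lock.
  by rewrite [RHS]mulrBr p_sub_ch_q // subr0.
by rewrite -2!(mulrA (p - ch a)) h.
Qed.

(** [(p - ch a) * w * ginv a] is the differential of the chart at [a] in the direction [w]; the
    direction a xi(U) is thus a lift of U. The factor a p a^* reduces to [d] by [p_sub_ch_star]. *)
Lemma symx_ch a U : sp a -> p * U = U -> U * q = U ->
  (p - ch a) * a * symx a U * ginv a = U.
Proof.
move=> sa pU Uq; have [g1 g2 g3 g4 _] := ginvP sa.
have -> : (p - ch a) * a * symx a U * ginv a =
    (p - ch a) * a * p * star a * U * (q * a * q * ginv a).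
  by rewrite symxE !mulrA.
rewrite g3 p_sub_ch_star // -!mulrA Uq -{1}pU dpA pU mulrBl pU.
by rewrite -(ch_pq sa).2 -pU -!mulrA qpA mulr0 subr0.
Qed.

Definition Xof a U : bo := 2^-1 *: (symx a U + cb (symx a U)).

Lemma Xof2 a U : Xof a U *+ 2 = symx a U + cb (symx a U).
Proof. by rewrite /Xof -scaler_nat scalerA mulfV ?scale1r // pnatr_eq0. Qed.

Lemma XofP a U : sp a -> sym U ->
  [/\ cb (Xof a U) = Xof a U, star (Xof a U) = Xof a U,
      Xof a U * d = - (d * Xof a U) & gl (Xof a U)].
Proof.
move=> sa sU; have xs := symx_sym sa sU; set x := symx a U in xs *.
have xpq : p * x * q = x by rewrite symx_pq.
have X2 : forall A : bo, 2^-1 *: A = (2^-1)%:C *: A.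
  by move=> A; congr (_ *: _); apply: eqC => /=; field.
rewrite /Xof -/x; split.
- by rewrite cbZ conj2V cbD cbK addrC.
- by rewrite starZ conj2V starD xs star_cb xs cbK addrC.
- rewrite boZl boZr -scalerN; congr (_ *: _).
  have cx : cb x = q * cb x * p by rewrite -{1}xpq !cbME.
  by rewrite cx -{1 3}xpq mulrDl mulrDr -!mulrA !pqE opprD !opprK.
rewrite X2; apply: glZ; apply: gl_off => //.
exact: symx_hs.
Qed.

Lemma symx_ch2 a U : sp a -> sym U ->
  (p - ch a) * (a * (symx a U + cb (symx a U))) * ginv a = U.
Proof.
move=> sa [_ Upq _]; have [g1 _ _ _ _] := ginvP sa.
have pU : p * U = U by rewrite -Upq -!mulrA ppA.
have Uq : U * q = U by rewrite -Upq -!mulrA qq.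
rewrite -[RHS](symx_ch sa pU Uq) mulrDr mulrDr mulrDl !mulrA.
rewrite -(cb_pq (symx_pq a U)).
by rewrite -g1 -!mulrA pqA !mulr0 addr0.
Qed.

(** [ch_sub] yields one factor t and [ginv_sub] the second. The remainder is bounded uniformly
    because every [ginv (alpha t)] has bound 1. *)
Lemma chart_quad (alpha S : R -> bo) (w : bo) (del MS : R) : 0 < del <= 1 ->
  (forall t, sp (alpha t)) -> hs w ->
  (forall t, `|t| <= del -> alpha t = alpha 0 + (t%:C *: w + (t ^+ 2)%:C *: S t) /\ hsb (S t) MS) ->
  exists Q M, forall t, `|t| <= del ->
    ch (alpha t) = ch (alpha 0) + (t%:C *: ((p - ch (alpha 0)) * w * ginv (alpha 0))
                                   + (t ^+ 2)%:C *: Q t) /\ hsb (Q t) M.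
Proof.
move=> /andP[d0 d1] sal [Mw wM] aS; set a := alpha 0; set P := p - ch a.
have sa : sp a by exact: sal.
have [g1 g2 g3 g4 g5] := ginvP sa.
pose W t := w + t%:C *: S t.
have aW t : `|t| <= del -> alpha t - a = t%:C *: W t.
  move=> td; rewrite (aS t td).1 [_ + (_ + _)]addrC addrK /W scalerDr scalerA.
  by congr (_ + _ *: _); apply: eqC => /=; ring.
have [NP PN] := bnd_ex P.
pose MW := 2 * (Mw + MS).
have WM t : `|t| <= del -> hsb (W t) MW.
  move=> td; have [_ h] := aS t td; apply: hsbD => //.
  by apply: hsb_le (hsbZ t%:C h); rewrite cnormR ler_piMl ?(le_trans td) // h.1.
exists (fun t => P * S t * ginv a - P * W t * (ginv (alpha t) * (q * W t * q) * ginv a)).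
exists (2 * (NP * MS * 1 + NP * MW * (1 * (1 * MW * 1) * 1))) => t td.
have [_ h] := aS t td; have [gt1 gt2 _ _ gt5] := ginvP (sal t).
split; last first.
  apply: hsbD; first by apply: hsbMr g5 _; apply: hsbMl PN _.
  rewrite -mulrN; apply: hsbMr; last by apply: hsbMl PN _; exact: WM.
  rewrite -mulNr -mulNr; apply: bndM g5; apply: bndM.
    by split=> // y; rewrite boNE hnormN; exact: gt5.2.
  by apply: bndM bnd_q; apply: bndM bnd_q _; exact/hsb_bnd/WM.
rewrite -[LHS](subrK (ch a)) [LHS]addrC; congr (_ + _).
rewrite (ch_sub sa (sal t)) -/P.
have -> : P * alpha t = P * a + t%:C *: (P * W t).
  by rewrite -boZr -aW // mulrBr addrC subrK.
have Pg : P * a * ginv (alpha t) = 0 by rewrite -gt1 mulrA p_sub_ch_q // mul0r.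
have tt (A : bo) : t%:C *: (t%:C *: A) = (t ^+ 2)%:C *: A.
  by rewrite scalerA; congr (_ *: _); apply: eqC => /=; ring.
have e : ginv (alpha t) = ginv a - t%:C *: (ginv (alpha t) * (q * W t * q) * ginv a).
  by rewrite {1}(ginv_sub sa (sal t)) aW // boZr boZl boZr boZl.
clearbody P; rewrite mulrDl Pg add0r boZl {1}e mulrBr boZr scalerBr. rewrite tt.
have e2 : P * W t * ginv a = P * w * ginv a + t%:C *: (P * S t * ginv a).
  by rewrite /W mulrDr mulrDl boZr boZl.
clearbody W; rewrite e2 scalerDr tt scalerBr.
by rewrite -addrA.
Qed.

(** Since E is [a * star a * d], a self-adjoint factor [c] enters only through its square. *)
Lemma bE_mul a c : sp a -> sp c -> star c = c ->
  bE (a * c) = a * (c * c) * star a * d.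
Proof.
move=> sa sc cs; have [_ h _] := sc; rewrite cs in h.
rewrite bEE ainvE starM cs -!mulrA; congr (_ * _).
have -> : c * (d * (d * (c * (star a * d)))) = c * (c * (star a * d)) by rewrite ddA.
by [].
Qed.

(** One curve realises three velocities at once: in the group, in the disc, and on the affine orbit
    for every [gamma]. *)
Lemma tangent_curve a U (x := symx a U) : sp a -> gl (a - 1) -> sym U ->
  exists alpha : R -> bo, [/\ alpha 0 = a,
    forall t, sp (alpha t) /\ gl (alpha t - 1),
    norm12 ip J ((t^-1)%:C *: (bov (alpha t) - bov (alpha 0)) - bov (a * (x + cb x)))
      @[t --> (0 : R)^'] --> (0 : R),
    hsnorm ip ((t^-1)%:C *: (bov (ch (alpha t)) - bov (ch (alpha 0))) - bov U)
      @[t --> (0 : R)^'] --> (0 : R) &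
    forall (gamma : R) (m := fun t => gamma%:C *: ('i%C *: (bE (alpha t) - d)) : bo),
    norm12 ip J ((t^-1)%:C *: (bov (m t) - bov (m 0)) -
       bov (gamma%:C *: ('i%C *: (a * ((x + cb x) *+ 2) * star a * d))))
      @[t --> (0 : R)^'] --> (0 : R)].
Proof.
move=> sa ga sU; have [Xr Xs Xd Xg] := XofP sa sU.
have [c [L [L' [del /andP[d0 d1] [c0 cP cL]]]]] := cayley Xr Xs Xd Xg.
have X2 := Xof2 a U; rewrite -/x in X2.
have X4 : Xof a U *+ 4 = (x + cb x) *+ 2 by rewrite -X2 -mulrnA.
have chU : (p - ch a) * (a * (x + cb x)) * ginv a = U := symx_ch2 sa sU.
set X := Xof a U in Xr Xs Xd Xg cL X2 X4; clearbody X x.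
have [M XM] := gl_hs Xg; have [N aN] := bnd_ex a; have XMb := hsb_bnd XM.
have dB : bnd d 1.
  split=> // y; rewrite mul1r dE boE hnormZ cnormN cnormi mul1r.
  by rewrite -[bJ y]/(JC J y) hnorm_JC.
have saN := bnd_star aN.
have sac t : sp (a * c t) by apply: sp_mul => //; case: (cP t).
have Qn (B : bo) b : bnd B b -> nuc (a * (X * X * B)) (N * ((M ^+ 2 + M ^+ 2) * b)).
  by move=> Bb; apply: nucMl aN _; apply: nucMr Bb _; apply: nuc_hs.
have Qh (B : bo) b : bnd B b -> hsb (a * (X * X * B)) (N * (M * M * b)).
  by move=> Bb; apply: hsbMl aN _; apply: hsbMr Bb _; apply: hsbMl.
have step t : `|t| <= del ->
    a * c t = a * c 0 + (t%:C *: (a * (x + cb x)) + (t ^+ 2)%:C *: (a * (X * X * L t))).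
  by move=> /cL[_ _ -> _]; rewrite c0 mulr1 mulrDr mulr1 mulrDr !boZr X2.
exists (fun t => a * c t); split.
- by rewrite c0 mulr1.
- by move=> t; split=> //; apply: gl_mul1 => //; case: (cP t).
- apply: (@velocity_norm12 _ (fun t => a * (X * X * L t)) _ del _ _ d0) => t _ td.
  have [bL _ _ _] := cL t td.
  by split; [exact: step|split; [exact: Qn bL|exact: Qh bL]].
- have [||||Q [MQ hQ]] :=
    @chart_quad (fun t => a * c t) (fun t => a * (X * X * L t)) (a * (x + cb x)) del
     (N * (M * M * 4)).
  + by rewrite d0.
  + exact: sac.
  + by rewrite -X2 mulr2n; apply/hsMl/hsD; exact: gl_hs.
  + by move=> t td; have [bL _ _ _] := cL t td; split; [exact: step|exact: Qh bL].
  apply: (@velocity_hsnorm (fun t => ch (a * c t)) Q _ del MQ d0) => t _ /hQ[-> hq].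
  by split=> //; rewrite c0 mulr1 chU.
- move=> gamma.
  pose Q t := gamma%:C *: ('i%C *: (a * (X * X * L' t) * star a * d)).
  apply: (@velocity_norm12 (fun t => gamma%:C *: ('i%C *: (bE (a * c t) - d))) Q _ del
    (`|gamma| * (1 * (N * ((M ^+ 2 + M ^+ 2) * 24) * N * 1)))
    (`|gamma| * (1 * (N * (M * M * 24) * N * 1))) d0) => t _ td.
  have [_ bL' _ cc] := cL t td.
  have [sc cs _] := cP t; have [sc0 cs0 _] := cP 0.
  split.
    rewrite !bE_mul // c0 cc !mulr1.
    have -> : a * (1 + (t%:C *: (X *+ 4) + (t ^+ 2)%:C *: (X * X * L' t))) * star a * d =
      a * star a * d + (t%:C *: (a * ((x + cb x) *+ 2) * star a * d) +
        (t ^+ 2)%:C *: (a * (X * X * L' t) * star a * d)).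
      rewrite X4; move: ((x + cb x) *+ 2) (X * X * L' t) => A B.
      by rewrite !mulrDr !mulrDl mulr1 !boZr !boZl.
    rewrite /Q addrAC scalerDr scalerDr; congr (_ + _).
    rewrite !scalerDr !scalerA; congr (_ *: _ + _ *: _);
      by apply: eqC => /=; ring.
  split.
    rewrite -(cnormR gamma) -cnormi; apply/nucZ/nucZ.
    by rewrite cnormi; apply: nucMr dB _; apply: nucMr saN _; exact: Qn bL'.
  rewrite -(cnormR gamma) -cnormi; apply/hsbZ/hsbZ.
  by rewrite cnormi; apply: hsbMr dB _; apply: hsbMr saN _; exact: Qh bL'.
Qed.

(** * The value of the symplectic form and the trace formula *)

(** [a] disappears by a^* d a = d. What remains is i (cb x y - x cb y), whose two blocks have traces
    z and - conj z; the constant is i (z - conj z) = - 2 Im z. *)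
Lemma omegaM_tangent a x y z : sp a -> p * x * q = x -> p * y * q = y ->
  star x = cb x -> trc (cb x * y) z ->
  omegaM ip J (a * (x + cb x)) (a * (y + cb y)) = (- 2 * Im z)%:C.
Proof.
move=> sa xpq ypq xs tz; have [_ h _] := sa.
have -> : omegaM ip J (a * (x + cb x)) (a * (y + cb y)) =
  tr ip (star (a * (x + cb x)) * bJ * (a * (y + cb y))) by [].
have sX : star (x + cb x) = x + cb x by rewrite starD xs star_cb xs cbK addrC.
have -> : star (a * (x + cb x)) * bJ * (a * (y + cb y)) = 'i%C *: (cb x * y - x * cb y).
  rewrite starM sX bJE boZr boZl; congr (_ *: _).
  rewrite -!mulrA sp_star_d //.
  have xq : x * q = x by rewrite -xpq -!mulrA qq.
  have py : p * y = y by rewrite -ypq -!mulrA ppA.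
  have cxp := cb_pq xpq.
  have qcy : q * cb y = cb y by rewrite -cb_p -cbM py.
  have xy : x * y = 0 by rewrite -xq -py -!mulrA qpA mulr0.
  have cxcy : cb x * cb y = 0 by rewrite -cxp -qcy -!mulrA pqA mulr0.
  have -> : d * (y + cb y) = y - cb y.
    by rewrite mulrDr -{1}py dpA py -{1}qcy dqA qcy.
  by rewrite mulrDl !mulrBr xy cxcy subr0 sub0r addrC.
have tz' : trc (x * cb y) (conjc z) by have := trc_cb tz; rewrite cbM cbK.
rewrite (trcE (trcZ _ (trcB tz tz'))).
by apply: eqC; rewrite !ReImE /=; ring.
Qed.

Lemma trc_symx a U W : sp a -> sym U -> sym W ->
  exists z, trc (cb (symx a U) * symx a W) z.
Proof.
move=> sa sU sW; have [z tz _] := trc_comm (hs_cb (symx_hs a sU)) (symx_hs a sW).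
by exists z.
Qed.

(** Cyclicity is used twice on products of Hilbert-Schmidt operators: it brings conj g next to its
    adjoint, which forms [N], and then moves [N * star U] back to the front. *)
Lemma tr_formula a U W z (Z := ch a) : sp a -> sym U -> sym W ->
  trc (cb (symx a U) * symx a W) z ->
  tr ip (invop ip (Pm J) (Pm J - (cbar Z \o Z)) \o adj ip U
     \o invop ip (Pp J) (Pp J - (Z \o cbar Z)) \o W) = z.
Proof.
move=> sa sU sW tz; have [g1 g2 g3 g4 _] := ginvP sa.
have [gb gbE] : exists gb, gb = q * a * q by exists (q * a * q).
rewrite -gbE in g3 g4; have [N NE] : exists N, N = gb * star gb by exists (gb * star gb).
have gbq : gb * q = gb by rewrite gbE -!mulrA qq.
have qgb : q * gb = gb by rewrite gbE -!mulrA qqA.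
have sgq : star gb * q = star gb by rewrite -star_q -starM qgb.
have qsg : q * star gb = star gb by rewrite -star_q -starM gbq.
have eZ : q - cb Z * Z = star (ginv a) * ginv a.
  have -> : cb Z = star Z by rewrite /Z -{2}(ch_sym sa) starK.
  exact: one_sub_ZZ.
have sgg : star (ginv a) * star gb = q by rewrite -starM g3 star_q.
have ggs : star gb * star (ginv a) = q by rewrite -starM g4 star_q.
have eN1 : (q - cb Z * Z) * N = q.
  by rewrite eZ NE -!mulrA (mulrA (ginv a)) g4 qsg sgg.
have eN2 : N * (q - cb Z * Z) = q.
  by rewrite eZ NE -!mulrA (mulrA (star gb)) ggs g1 g3.
have qN : q * N = N by rewrite NE mulrA qgb.
have Nq : N * q = N by rewrite NE -mulrA sgq.
have -> : invop ip (Pm J) (Pm J - (cbar Z \o Z)) = N.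
  by rewrite qE -(invopE qN Nq eN1 eN2).
have -> : invop ip (Pp J) (Pp J - (Z \o cbar Z)) = cb N.
  have h1 : p * cb N = cb N by rewrite -cb_q -cbM qN.
  have h2 : cb N * p = cb N by rewrite -cb_q -cbM Nq.
  have h3 : (p - Z * cb Z) * cb N = p.
    by have := congr1 cb eN1; rewrite cbM cbB cbM cbK cb_q.
  have h4 : cb N * (p - Z * cb Z) = p.
    by have := congr1 cb eN2; rewrite cbM cbB cbM cbK cb_q.
  by rewrite pE -(invopE h1 h2 h3 h4).
change (tr ip (N * star U * cb N * W) = z).
have [Uh Upq _] := sU; have [Wh Wpq _] := sW.
have [ar _ _] := sa.
have e : cb (symx a U) * symx a W = (star gb * star U) * (cb N * W * gb).
  rewrite -(symx_sym sa sU) !symxE.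
  have pW : W = p * W by rewrite -Wpq -!mulrA ppA.
  have sUp : star U = star U * p by rewrite -{1}Upq !starE -[in RHS]Upq !starE -!mulrA pp.
  rewrite NE -gbE !cbM -star_cb.
  have -> : cb gb = p * a * p by rewrite gbE !cbME ar.
  by rewrite !starM star_p starK {1}pW {1}sUp -!mulrA !ppA.
have [z1 t1 t1'] := trc_comm (hsMl (star gb) (hs_star Uh)) (hsMr gb (hsMl (cb N) Wh)).
have [z2 t2 t2'] := trc_comm (hsMl N (hs_star Uh)) (hsMl (cb N) Wh).
have z1z : z1 = z by apply: trc_unique t1 _; rewrite -e.
have z2z : z1 = z2.
  apply: trc_unique t1' _; move: t2'; congr trc.
  by rewrite NE !mulrA.
by rewrite -mulrA (trcE t2) -z2z.
Qed.

(** * The restricted trace and the value of the Kirillov-Kostant-Souriau form *)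

Definition trr (Y : bo) (z : C) := exists z1 z2,
  [/\ trc (p * Y * p) z1, trc (q * Y * q) z2 & z = z1 + z2].

Lemma trrE (Y : bo) z : trr Y z -> tr_res ip J Y = z.
Proof.
move=> [z1 [z2 [t1 t2 ->]]]; have [b1 _ _ b4] := blkE Y.
by rewrite /tr_res b1 b4 (trcE t1) (trcE t2).
Qed.

Lemma trrD (Y Y' : bo) z z' : trr Y z -> trr Y' z' -> trr (Y + Y') (z + z').
Proof.
move=> [z1 [z2 [t1 t2 ->]]] [w1 [w2 [s1 s2 ->]]]; exists (z1 + w1), (z2 + w2).
split; first by rewrite mulrDr mulrDl; exact: trcD.
  by rewrite mulrDr mulrDl; exact: trcD.
by rewrite addrACA.
Qed.

Lemma trrZ (Y : bo) c z : trr Y z -> trr (c *: Y) (c * z).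
Proof.
move=> [z1 [z2 [t1 t2 ->]]]; exists (c * z1), (c * z2).
by rewrite !boZr !boZl mulrDr; split=> //; exact: trcZ.
Qed.

Lemma trr0 : trr 0 0.
Proof. by exists 0, 0; rewrite !mulr0 !mul0r addr0; split=> //; exact: trc0. Qed.

Lemma trr_unique (Y : bo) z w : trr Y z -> trr Y w -> z = w.
Proof. by move=> /trrE <- /trrE <-. Qed.

Lemma trr_comm (A B : bo) : hs A -> hs B -> exists2 z, trr (A * B) z & trr (B * A) z.
Proof.
have aux (A' B' : bo) : hs A' -> hs B' -> exists2 z, trr (A' * B') z & trc (B' * A') z.
  move=> Ah Bh.
  have [z1 t1 t1'] := trc_comm (hsMl p Ah) (hsMr p Bh).
  have [z2 t2 t2'] := trc_comm (hsMl q Ah) (hsMr q Bh).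
  exists (z1 + z2); first by exists z1, z2; split; rewrite // !mulrA in t1 t2 *.
  have := trcD t1' t2'; congr trc.
  by rewrite -!mulrA ppA qqA -mulrDr -mulrDl addpq mul1r.
move=> Ah Bh; have [z1 r1 t1] := aux _ _ Ah Bh; have [z2 r2 t2] := aux _ _ Bh Ah.
have [w u1 u2] := trc_comm Ah Bh.
exists z1 => //; rewrite (trc_unique t1 u2) -(trc_unique t2 u1) //.
Qed.

(** Write a = 1 + m and a^-1 = 1 + m' with m and m' Hilbert-Schmidt. The three correction terms are
    products of two Hilbert-Schmidt operators; permuted cyclically they add up to (m + m' + m' m) T
    = 0. *)
Lemma trr_conj a (T : bo) z : gl (a - 1) -> sp a -> hs T -> trr T z -> trr (a * T * ainv a) z.
Proof.
move=> ga sa Th tT; pose m := a - 1; pose m' := ainv a - 1.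
have mh : hs m by exact: gl_hs.
have m'h : hs m'.
  have -> : m' = d * star m * d.
    by rewrite /m' /m starB star1 mulrBr mulrBl mulr1 dd ainvE.
  by apply/hsMr/hsMl/hs_star.
have aE : a = 1 + m by rewrite addrC subrK.
have a'E : ainv a = 1 + m' by rewrite addrC subrK.
clearbody m m'.
have [u t1 _] := trr_comm mh Th.
have [v t2 t2'] := trr_comm Th m'h.
have [w t3 t3'] := trr_comm (hsMr T mh) m'h.
have := trrD tT (trrD (trrD t1 t2) t3).
have -> : T + (m * T + T * m' + m * T * m') = a * T * ainv a.
  by rewrite a'E aE mulrDl mul1r mulrDr mulr1 mulrDl -!addrA.
have -> : u + v + w = 0.
  apply: trr_unique (trrD (trrD t1 t2') t3') _.
  have mm : m + m' + m' * m = 0.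
    have : ainv a * a = 1 by exact: ainvl.
    rewrite a'E aE mulrDl mul1r mulrDr mulr1 -addrA => /eqP.
    by rewrite -[X in _ == X]addr0 (inj_eq (addrI _)) addrA => /eqP.
  have -> : m * T + m' * T + m' * (m * T) = 0; last exact: trr0.
  by rewrite (mulrA m') -!mulrDl mm mul0r.
by rewrite addr0.
Qed.

Lemma comm_d (A : bo) : cb A = A ->
  d * A - A * d = (p * A * q - cb (p * A * q)) *+ 2.
Proof.
move=> Ar; rewrite !cbME Ar mulr2n {1 2}(blocks A).
rewrite !(mulrDr d) !(mulrDl _ _ d) !(mulrA d) !dp !dq -(mulrA _ q d) -(mulrA _ p d).
rewrite -(mulrA _ q d) -(mulrA _ p d) pd qd !mulrN !mulNr.
move: (p * A * p) (p * A * q) (q * A * p) (q * A * q) => x y y' w.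
rewrite !opprD !opprK addrACA [x + y + _]addrACA subrr add0r.
by rewrite [_ + (- y' + w)]addrACA addNr addr0 [RHS]addrACA.
Qed.

Lemma cb_ainv a : sp a -> cb (ainv a) = ainv a.
Proof. by move=> [ar _ _]; rewrite ainvE !cbM cb_d -star_cb ar mulNr mulNr mulrN opprK. Qed.

Lemma ainv_gl a : sp a -> gl (a - 1) -> hs (ainv a - 1).
Proof.
move=> sa ga; have -> : ainv a - 1 = d * star (a - 1) * d.
  by rewrite starB star1 mulrBr mulrBl mulr1 dd ainvE.
by apply/hsMr/hsMl/hs_star/gl_hs.
Qed.

(** The adjoint action of a^-1, which carries a Lie algebra element from the point of [a] to the
    base point 0 of the disc. *)
Definition pull a A : bo := ainv a * A * a.

(** [A] is merely bounded outside its off-diagonal blocks, but [a] and its inverse differ from 1 by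
    Hilbert-Schmidt operators, so conjugation changes [A] by a Hilbert-Schmidt operator. *)
Lemma pull_hs a A : sp a -> gl (a - 1) -> hs (p * A * q) -> hs (p * pull a A * q).
Proof.
move=> sa ga Ah; have [m mE] : exists m, m = a - 1 by exists (a - 1).
have [m' m'E] : exists m', m' = ainv a - 1 by exists (ainv a - 1).
have mh : hs m by rewrite mE; exact: gl_hs.
have m'h : hs m' by rewrite m'E; exact: ainv_gl.
have -> : pull a A = A + (m' * A + (A * m + m' * A * m)).
  have -> : pull a A = (1 + m') * A * (1 + m).
    by rewrite mE m'E ![1 + _]addrC !subrK.
  by rewrite mulrDl mul1r mulrDr mulr1 mulrDl -!addrA.
rewrite mulrDr mulrDl; apply: hsD => //.
by apply/hsMr/hsMl/hsD; [exact: hsMr | apply: hsD; [exact: hsMl | exact: hsMl]].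
Qed.

Lemma pull_real a A : sp a -> cb A = A -> cb (pull a A) = pull a A.
Proof. by move=> sa Ar; have [ar _ _] := sa; rewrite /pull !cbM cb_ainv // Ar ar. Qed.

(** Conjugation by [a] reduces mu + gamma J to gamma i d. The commutator with [d] doubles the
    off-diagonal blocks, and the two diagonal blocks of the product have traces conj z and - z,
    whence 2 gamma i (conj z - z) = 4 gamma Im z. *)
Lemma kks_value (gamma : R) a A B z : sp a -> gl (a - 1) -> cb A = A -> cb B = B ->
  hs (p * A * q) -> hs (p * B * q) ->
  trc (cb (p * pull a A * q) * (p * pull a B * q)) z ->
  kks ip J gamma (bov (gamma%:C *: ('i%C *: (bE a - d)))) A B = (4 * gamma * Im z)%:C.
Proof.
move=> sa ga Ar Br Ah Bh tz.
have pAr := pull_real sa Ar; have pBr := pull_real sa Br.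
have pAh := pull_hs sa ga Ah; have pBh := pull_hs sa ga Bh.
have AE : A = a * pull a A * ainv a.
  by rewrite /pull !mulrA ainvr // mul1r -mulrA ainvr // mulr1.
have BE : B = a * pull a B * ainv a.
  by rewrite /pull !mulrA ainvr // mul1r -mulrA ainvr // mulr1.
move: (pull a A) (pull a B) AE BE pAr pBr pAh pBh tz => A' B' AE BE A'r B'r A'h B'h tz.
set xi := p * A' * q in tz A'h; set eta := p * B' * q in tz B'h.
pose N := gamma%:C *: ('i%C *: bE a).
have -> : kks ip J gamma (bov (gamma%:C *: ('i%C *: (bE a - d)))) A B =
    tr_res ip J ((N * A - A * N) * B).
  have NE : gamma%:C *: ('i%C *: (bE a - d)) + gamma%:C *: bJ = N.
    by rewrite -scalerDr bJE scalerBr subrK.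
  by rewrite -NE.
have -> : (N * A - A * N) * B = gamma%:C *: ('i%C *: (a * ((d * A' - A' * d) * B') * ainv a)).
  rewrite /N !boZl !boZr -!scalerBr !boZl; congr (_ *: (_ *: _)).
  have -> : bE a * A - A * bE a = a * (d * A' - A' * d) * ainv a.
    rewrite mulrBr mulrBl AE bEE; congr (_ - _).
      by rewrite !mulrA -(mulrA (a * d)) ainvl // mulr1.
    by rewrite !mulrA -(mulrA (a * A')) ainvl // mulr1.
  by rewrite BE !mulrA -(mulrA (a * _) (ainv a)) ainvl // mulr1.
have TE := comm_d A'r; rewrite -/xi in TE.
have qB'p : q * B' * p = cb eta by rewrite /eta !cbME B'r.
have xipq : p * xi * q = xi by rewrite /xi -!mulrA qq ppA.
have etaq : eta = p * (B' * q) by rewrite /eta mulrA.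
clearbody xi eta.
have tT : trr ((d * A' - A' * d) * B') (2 * (conjc z - z)).
  have e1 : p * (xi - cb xi) * B' * p = xi * cb eta.
    rewrite -qB'p mulrBr; have -> : p * cb xi = 0 by rewrite -xipq !cbME -!mulrA pqA.
    by rewrite subr0 -{1}xipq -!mulrA ppA -[in RHS]xipq -!mulrA qqA.
  have e2 : q * (xi - cb xi) * B' * q = - (cb xi * eta).
    rewrite mulrBr; have -> : q * xi = 0 by rewrite -xipq -!mulrA qpA.
    by rewrite sub0r !mulNr -{1}xipq !cbME etaq -[in RHS]xipq !cbME -!mulrA ppA qqA.
  rewrite TE -scaler_nat boZl; apply: trrZ; exists (conjc z), (- z); split=> //.
  - by have := trc_cb tz; rewrite cbM cbK mulrA e1.
  - by rewrite mulrA e2; exact: trcN.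
have Th : hs ((d * A' - A' * d) * B').
  by rewrite TE mulr2n; apply/hsMr/hsD; apply: hsB => //; exact: hs_cb.
rewrite (trrE (trrZ gamma%:C (trrZ 'i%C (trr_conj ga sa Th tT)))).
by apply: eqC; rewrite !ReImE /=; ring.
Qed.

(** * Differentiation in operator norm *)

Definition small (F : R -> bo) := forall e, 0 < e -> exists2 del, 0 < del &
  forall t, t != 0 -> `|t| <= del -> bnd (F t) e.

Definition dquo (F : R -> bo) t : bo := (t^-1)%:C *: (F t - F 0).

(** Differentiability at 0 in operator norm: it follows from a velocity in [hsnorm] or in [norm12],
    and it admits a product rule. *)
Definition deriv (F : R -> bo) (f : bo) := small (fun t => dquo F t - f).

Lemma bnd_le (A : bo) M N : M <= N -> bnd A M -> bnd A N.
Proof.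
move=> MN [M0 AM]; split=> [|x]; first exact: le_trans MN.
by apply: le_trans (AM x) _; rewrite ler_wpM2r ?hnorm_ge0.
Qed.

Lemma bndN (A : bo) M : bnd A M -> bnd (- A) M.
Proof. by move=> [M0 AM]; split=> // x; rewrite boNE hnormN. Qed.

Lemma smallD F G : small F -> small G -> small (fun t => F t + G t).
Proof.
move=> sF sG e ep; have e2 : 0 < e / 2 by rewrite divr_gt0.
have [d1 d1p h1] := sF _ e2; have [d2 d2p h2] := sG _ e2.
exists (Num.min d1 d2); first by rewrite lt_min d1p.
move=> t t0; rewrite le_min => /andP[t1 t2].
by have := bndD (h1 t t0 t1) (h2 t t0 t2); rewrite -splitr.
Qed.

Lemma smallN F : small F -> small (fun t => - F t).
Proof.
move=> sF e /sF[d1 d1p h1]; exists d1 => // t t0 /(h1 t t0); exact: bndN.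
Qed.

Lemma small_ext F G : (exists2 del, 0 < del & forall t, t != 0 -> `|t| <= del -> F t = G t) ->
  small F -> small G.
Proof.
move=> [d0 d0p FG] sF e /sF[d1 d1p h1]; exists (Num.min d0 d1); first by rewrite lt_min d0p.
by move=> t t0; rewrite le_min => /andP[t1 t2]; rewrite -FG //; exact: h1.
Qed.

Lemma smallMl B F : small F -> small (fun t => B * F t).
Proof.
move=> sF e ep; have [b [b0 Bb]] := bnd_ex B; have b1 : 0 < b + 1 by rewrite ltr_wpDl.
have [|d1 d1p h1] := sF (e / (b + 1)); first by rewrite divr_gt0.
exists d1 => // t t0 /(h1 t t0) h; apply: bnd_le (bndM (conj b0 Bb) h).
by rewrite mulrA ler_pdivrMr // mulrC ler_wpM2l ?(ltW ep) // lerDl.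
Qed.

Lemma smallMr B F : small F -> small (fun t => F t * B).
Proof.
move=> sF e ep; have [b [b0 Bb]] := bnd_ex B; have b1 : 0 < b + 1 by rewrite ltr_wpDl.
have [|d1 d1p h1] := sF (e / (b + 1)); first by rewrite divr_gt0.
exists d1 => // t t0 /(h1 t t0) h; apply: bnd_le (bndM h (conj b0 Bb)).
by rewrite mulrAC ler_pdivrMr // ler_wpM2l ?(ltW ep) // lerDl.
Qed.

Lemma small_cst A : small (fun=> A) -> A = 0.
Proof.
move=> sA; apply: bo_eq => x; apply/hnorm_eq0/le_anti; rewrite hnorm_ge0 andbT.
apply: (@le_eps _ _ (hnorm x)); first exact: hnorm_ge0.
move=> e /sA[d1 d1p h1]; rewrite mulrC.
by case: (h1 d1 (lt0r_neq0 d1p) (eq_ind_r (fun z => z <= d1) (lexx d1) (gtr0_norm d1p))).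
Qed.

Lemma deriv_bnd F f : deriv F f -> exists M, exists2 del, 0 < del &
  forall t, t != 0 -> `|t| <= del -> bnd (dquo F t) M.
Proof.
move=> /(_ 1 ltr01)[d1 d1p h1]; have [M fM] := bnd_ex f.
exists (1 + M), d1 => // t t0 /(h1 t t0) h.
by have := bndD h fM; rewrite subrK.
Qed.

Lemma deriv_close F f : deriv F f -> forall e, 0 < e -> exists2 del, 0 < del &
  forall t, `|t| <= del -> bnd (F t - F 0) e.
Proof.
move=> /deriv_bnd[M [d1 d1p h1]] e ep; have M1 : 0 < `|M| + 1 by rewrite ltr_wpDl.
exists (Num.min d1 (e / (`|M| + 1))); first by rewrite lt_min d1p divr_gt0.
move=> t; rewrite le_min => /andP[t1 t2]; have [->|t0] := eqVneq t 0.
  split=> [|x]; first exact: ltW.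
  by rewrite subrr boE hnorm0 mulr_ge0 ?hnorm_ge0 ?ltW.
have -> : F t - F 0 = t%:C *: dquo F t.
  rewrite /dquo scalerA (_ : _ * _ = 1) ?scale1r //.
  by apply: eqC => /=; rewrite ?mulr0 ?mul0r ?subr0 ?addr0 // mulfV.
have [M0 _] := h1 t t0 t1.
apply: bnd_le (bndZ _ (h1 t t0 t1)); rewrite cnormR.
move: t2; rewrite ler_pdivlMr //; apply: le_trans; rewrite ler_wpM2l //.
by rewrite (le_trans (ler_norm M)) // lerDl.
Qed.

Lemma small_second F G f g : deriv F f -> deriv G g ->
  small (fun t => t%:C *: (dquo F t * dquo G t)).
Proof.
move=> /deriv_bnd[M [d1 d1p h1]] /deriv_bnd[N [d2 d2p h2]] e ep.
have M1 : 0 < `|M * N| + 1 by rewrite ltr_wpDl.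
exists (Num.min (Num.min d1 d2) (e / (`|M * N| + 1))); first by rewrite !lt_min d1p d2p divr_gt0.
move=> t t0; rewrite !le_min => /andP[/andP[t1 t2] t3].
apply: bnd_le (bndZ _ (bndM (h1 t t0 t1) (h2 t t0 t2))); rewrite cnormR.
move: t3; rewrite ler_pdivlMr //; apply: le_trans; rewrite ler_wpM2l //.
by rewrite (le_trans (ler_norm _)) // lerDl.
Qed.

(** All three derivatives are given and only the relation between them is extracted. This is how an
    implicit relation valid near 0 is differentiated. *)
Lemma product_rule F G P f g h : deriv F f -> deriv G g -> deriv P h ->
  (exists2 del, 0 < del & forall t, `|t| <= del -> F t * G t = P t) ->
  h = f * G 0 + F 0 * g.
Proof.
move=> dF dG dP [del dp FG]; apply/eqP; rewrite -subr_eq0; apply/eqP/small_cst.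
apply: (small_ext (F := fun t => (dquo F t - f) * G 0 + (F 0 * (dquo G t - g) +
  (t%:C *: (dquo F t * dquo G t) + - (dquo P t - h))))); last first.
  apply: smallD; first exact: smallMr.
  apply: smallD; first exact: smallMl.
  by apply: smallD; [exact: small_second dF dG | exact: smallN].
exists del => // t t0 td.
have -> : dquo P t = dquo F t * G 0 + (F 0 * dquo G t + t%:C *: (dquo F t * dquo G t)).
  rewrite /dquo -(FG t td) -(FG 0) ?normr0 ?ltW //.
  have tK (A : bo) : t%:C *: ((t^-1)%:C *: ((t^-1)%:C *: A)) = (t^-1)%:C *: A.
    rewrite scalerA (_ : _ * _ = 1) ?scale1r //.
    by apply: eqC => /=; rewrite ?mulr0 ?mul0r ?subr0 ?addr0 // mulfV.
  rewrite !boZl !boZr tK.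
  rewrite -!scalerDr; congr (_ *: _).
  move: (F t) (F 0) (G t) (G 0) => a b c e.
  by rewrite -mulrDl [b + _]addrC subrK mulrBl mulrBr [RHS]addrC addrA subrK.
rewrite mulrBl mulrBr.
move: (dquo F t * G 0) (f * G 0) (F 0 * dquo G t) (F 0 * g) (t%:C *: _) => A B D E' K.
rewrite opprB (addrA (A - B)) (addrACA A (- B)) -opprD (addrA A D K); move: (A + D) (B + E') => S T.
by rewrite [K + _]addrCA (opprD S K) [K + _]addrCA subrr addr0 [LHS]addrC addrA subrK.
Qed.

Lemma derivMl B F f : deriv F f -> deriv (fun t => B * F t) (B * f).
Proof.
move=> dF; apply: (small_ext (F := fun t => B * (dquo F t - f))); last exact: smallMl.
by exists 1 => // t _ _; rewrite /dquo mulrBr boZr mulrBr.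
Qed.

Lemma derivN F f : deriv F f -> deriv (fun t => - F t) (- f).
Proof.
move=> dF; apply: (small_ext (F := fun t => - (dquo F t - f))); last exact: smallN.
by exists 1 => // t _ _; rewrite /dquo opprB -opprD scalerN opprK addrC.
Qed.

Lemma deriv_add F f A : deriv F f -> deriv (fun t => F t + A) f.
Proof.
move=> dF; apply: (small_ext (F := fun t => dquo F t - f)) => //.
by exists 1 => // t _ _; rewrite /dquo opprD addrACA subrr addr0.
Qed.

Lemma deriv_ext F G f : F 0 = G 0 ->
  (exists2 del, 0 < del & forall t, t != 0 -> `|t| <= del -> F t = G t) ->
  deriv F f -> deriv G f.
Proof.
move=> FG0 [del dp FG]; apply: small_ext; exists del => // t t0 td.
by rewrite /dquo FG0 FG.
Qed.

Lemma velocity_deriv (F : R -> bo) f : (forall t, hs (F t)) -> hs f ->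
  hsnorm ip ((t^-1)%:C *: (bov (F t) - bov (F 0)) - bov f) @[t --> (0 : R)^'] --> (0 : R) ->
  deriv F f.
Proof.
move=> Fh fh /cvg0_at0P h e /h[del dp hd]; exists del => // t t0 td.
have := hd t t0 td; rewrite ger0_norm ?sqrtr_ge0 // => le.
apply: bnd_le le _; apply/hsb_bnd/hs_hsb/hsP.
by apply: hsB => //; apply/hsZ/hsB.
Qed.

Lemma velocity12_deriv (F : R -> bo) f : (forall t, gl (F t)) -> gl f ->
  norm12 ip J ((t^-1)%:C *: (bov (F t) - bov (F 0)) - bov f) @[t --> (0 : R)^'] --> (0 : R) ->
  deriv F f.
Proof.
move=> Fg fg /cvg0_at0P h e ep; have [|del dp hd] := h (e / 2); first by rewrite divr_gt0.
exists del => // t t0 td; have := hd t t0 td.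
have [b1 b2 _ _] := blkE (dquo F t - f).
have -> : norm12 ip J ((t^-1)%:C *: (bov (F t) - bov (F 0)) - bov f) = norm12b (dquo F t - f).
  by rewrite /norm12b -b1 -b2.
rewrite ger0_norm ?norm12b_ge0 // ler_pdivlMr // mulrC => le.
apply: bnd_le le _; apply: gl_bnd; apply: glD; last exact: glN.
by apply: glZ; apply: glD => //; exact: glN.
Qed.

(** * The derivative of the Mobius action *)

(** [D + p] commutes with [q], hence so does its inverse, which can therefore be cut down to H_-. *)
Lemma corner_inverse (D B : bo) : q * D = D -> D * q = D ->
  (D + p) * B = 1 -> B * (D + p) = 1 ->
  [/\ q * (q * B) = q * B, q * B * q = q * B, D * (q * B) = q & q * B * D = q].
Proof.
move=> qD Dq TB BT.
have Tq : (D + p) * q = D by rewrite mulrDl Dq pq addr0.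
have qT : q * (D + p) = D by rewrite mulrDr qD qp addr0.
have qB : q * B = B * q.
  by rewrite -[LHS]mul1r -BT -mulrA (mulrA (D + p)) Tq -{1}qT -(mulrA q) TB mulr1.
split; first by rewrite qqA.
- by rewrite qB -mulrA qq.
- by rewrite -{1}Tq -mulrA qqA qB mulrA TB mul1r.
- by rewrite qB -mulrA qD -{1}Tq mulrA BT mul1r.
Qed.

Lemma mobius_zt b Z Di : p * Z = Z -> Z * q = Z -> q * Di = Di -> Di * q = Di ->
  q * b * zt Z * Di = q -> Di * (q * b * zt Z) = q ->
  mobius ip J b Z = bov (p * b * zt Z * Di) /\
  p * b * zt Z * Di * (q * b * zt Z) = p * b * zt Z.
Proof.
move=> pZ Zq qDi Diq DDi DiD.
have e r : r * b * p * Z + r * b * q = r * b * zt Z.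
  by rewrite ztE mulrDr -mulrA pZ.
split; last by rewrite -mulrA DiD -mulrA ztE mulrDl Zq qq.
by rewrite (@mobiusE b Z Di) // !e.
Qed.

(** The last hypothesis is the derivative of z' (conj h z + conj g) = g z + h, with the blocks of
    [b]. It says that U' times the denominator is (p - Z') b U, where Z' is the chart of c = b a;
    [sp_off] turns p c^* (p - Z') into p c^* d, and b drops out by b^* d b = d. *)
Lemma symx_mul b a U U' : sp b -> sp a -> p * U = U ->
  p * b * U = U' * (q * b * zt (ch a)) + ch (b * a) * (q * b * U) ->
  symx (b * a) U' = symx a U.
Proof.
move=> sb sa pU h; have sc := sp_mul sb sa; rewrite !symxE.
have [c cE] : exists c, c = b * a by exists (b * a).
have gE : q * c * q = q * b * zt (ch a) * (q * a * q).
  by rewrite -(mulrA (q * b)) zt_gb // cE !mulrA.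
have -> : p * star (b * a) * U' * (q * (b * a) * q) =
    p * star c * (U' * (q * b * zt (ch a))) * (q * a * q).
  by rewrite -cE gE !mulrA.
have -> : U' * (q * b * zt (ch a)) = (p - ch c) * b * U.
  rewrite -[LHS](addrK (ch (b * a) * (q * b * U))) -h -cE.
  by rewrite !mulrBl !mulrA (ch_pq (eq_ind_r sp sc cE)).2.
have -> : p * star c * ((p - ch c) * b * U) = p * star c * d * b * U.
  suff key : p * star c * (p - ch c) = p * star c * d by rewrite !mulrA key.
  have [g1 _ g3 _ _] := ginvP sc; rewrite -cE in g1 g3 sc.
  have -> : d = p - q by rewrite /d -lock.
  rewrite !mulrBr; congr (_ - _).
  have -> : p * star c * ch c = p * star c * p * c * q * ginv c.
    by rewrite chE !mulrA.
  by rewrite (sp_off sc) -!(mulrA (p * star c)) g3.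
congr (_ * _); rewrite cE starM -!mulrA sp_star_d //.
by rewrite -{1}pU dpA pU.
Qed.

(** Near t = 0 the denominator [D t] is shown to be invertible on H_-, so that [invop] is a genuine
    inverse there; the relation [z' t * D t = p * b * zt (z t)] can then be differentiated. *)
Lemma mobius_deriv b a (z z' : R -> bo) U U' : sp b -> sp a ->
  deriv z U -> deriv z' U' -> z 0 = ch a -> (forall t, sym (z t)) -> (forall t, sym (z' t)) ->
  sym U -> (forall t, bov (z' t) = mobius ip J b (z t)) ->
  symx (b * a) U' = symx a U.
Proof.
move=> sb sa dz dz' z0 zs zs' [_ Upq _] zz'.
have symE Z : sym Z -> p * Z = Z /\ Z * q = Z.
  by move=> [_ Zpq _]; split; rewrite -Zpq -!mulrA ?ppA ?qq.
have sc := sp_mul sb sa.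
have [a1 a2 a3 a4 _] := ginvP sa; have [c1 c2 c3 c4 _] := ginvP sc.
pose D t := q * b * zt (z t).
have ztD : deriv (fun t => zt (z t)) U.
  apply: deriv_ext (deriv_add q dz); first by rewrite ztE.
  by exists 1 => // t _ _; rewrite ztE.
have dD : deriv D (q * b * U) by exact: derivMl.
have qD t : q * D t = D t by rewrite /D !mulrA qq.
have Dq t : D t * q = D t by rewrite /D -mulrA ztE mulrDl (symE _ (zs t)).2 qq.
have D0 : D 0 = q * (b * a) * ginv a by rewrite /D z0 zt_ch // !mulrA.
(* [D 0] is the block [q * (b * a) * q] times [ginv a], so its inverse on H_- is [S]. *)
set gb := q * a * q in a3 a4; set S := gb * ginv (b * a).
have qS : q * S = S by rewrite /S /gb !mulrA qq.
have Sq : S * q = S by rewrite /S -mulrA c2.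
have DS : D 0 * S = q.
  by rewrite D0 /S mulrA -(mulrA _ (ginv a)) a4 c3.
have SD : S * D 0 = q.
  have e : gb * ginv (b * a) * (q * (b * a) * ginv a) =
      gb * (ginv (b * a) * (q * (b * a) * q)) * ginv a.
    by rewrite -{1}a1 !mulrA.
  have gbq : gb * q = gb by rewrite /gb -!mulrA qq.
  by rewrite D0 /S e c4 gbq a3.
have DSi : (D 0 + p) * (S + p) = 1.
  rewrite mulrDl !mulrDr DS pp -(Dq 0) -mulrA qp mulr0 addr0 -qS mulrA pq mul0r add0r.
  by rewrite addrC addpq.
have SDi : (S + p) * (D 0 + p) = 1.
  rewrite mulrDl !mulrDr SD pp -Sq -mulrA qp mulr0 addr0 -(qD 0) mulrA pq mul0r add0r.
  by rewrite addrC addpq.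
have [s [s0 sS]] := bnd_ex (S + p); have s1 : 0 < 2 * (s + 1) by rewrite mulr_gt0 ?ltr_wpDl.
(* This radius makes [(S + p) * (D t - D 0)] at most 1/2 in norm, as [inverse_near1] requires. *)
have [|del dp hd] := deriv_close dD (e := (2 * (s + 1))^-1); first by rewrite invr_gt0.
have prod t : `|t| <= del -> z' t * D t = p * b * zt (z t).
  move=> td; have [_ hE] := hd t td.
  have [|B [EB BE] _] := @inverse_near1 ((S + p) * (D t - D 0)).
    move=> x; rewrite boE; apply: le_trans (sS _) _.
    apply: le_trans (_ : (s + 1) * hnorm ((D t - D 0) x) <= _).
      by rewrite ler_wpM2r ?hnorm_ge0 // lerDl.
    apply: le_trans (_ : (s + 1) * ((2 * (s + 1))^-1 * hnorm x) <= _).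
      by rewrite ler_wpM2l ?hE // addr_ge0.
    by rewrite mulrA invfM mulrCA mulfV ?mulr1 // gt_eqF // ltr_wpDl.
  have TE : D t + p = (D 0 + p) * (1 + (S + p) * (D t - D 0)).
    by rewrite mulrDr mulr1 mulrA DSi mul1r [RHS]addrC addrA subrK.
  have TB : (D t + p) * (B * (S + p)) = 1.
    by rewrite TE -mulrA (mulrA _ B) EB mul1r DSi.
  have BT : B * (S + p) * (D t + p) = 1.
    by rewrite TE -mulrA (mulrA (S + p)) SDi mul1r BE.
  have [h1 h2 h3 h4] := corner_inverse (qD t) (Dq t) TB BT.
  have [pZ Zq] := symE _ (zs t).
  have [m1 m2] := mobius_zt pZ Zq h1 h2 h3 h4.
  have -> : z' t = p * b * zt (z t) * (q * (B * (S + p))) by apply: bo_val_inj; rewrite zz' m1.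
  exact: m2.
have z'0 : z' 0 = ch (b * a).
  have := prod 0; rewrite normr0 => /(_ (ltW dp)) /(congr1 (fun y => y * S)) /=.
  rewrite -mulrA DS (symE _ (zs' 0)).2 => ->.
  rewrite z0 zt_ch //.
  have -> : p * b * (a * ginv a) * S = p * (b * a) * (ginv a * gb) * ginv (b * a).
    by rewrite /S !mulrA.
  by rewrite a4 chE.
have pr : exists2 del : R, 0 < del & forall t, `|t| <= del -> z' t * D t = p * b * zt (z t).
  by exists del.
have := product_rule dz' dD (derivMl (p * b) ztD) pr.
rewrite z'0 /D z0; apply: symx_mul => //.
by rewrite -Upq -!mulrA ppA.
Qed.

(** * The affine coadjoint orbit *)

Lemma bE_star a : bE a = a * star a * d.
Proof. by rewrite bEE ainvE -!mulrA ddA. Qed.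

(** From a p a^* = d + a q a^* the block of E - d on H_+ is twice [p * a * q] times its adjoint, a
    product of two Hilbert-Schmidt operators. So it is trace class even though the diagonal blocks
    of [a] are merely bounded. *)
Lemma bE_gl a (gamma : R) : sp a -> hs (p * a * q) ->
  gl (gamma%:C *: ('i%C *: (bE a - d))).
Proof.
move=> sa ah; apply: glZ; have [ar _ h] := sa.
have ah' : hs (q * a * p).
  have -> : q * a * p = cb (p * a * q) by rewrite !cbME ar.
  exact: hs_cb.
have split_a : a * star a = a * p * star a + a * q * star a.
  by rewrite -mulrDl -mulrDr addpq mulr1.
split.
- rewrite cbZ cbB bE_real // cb_d (_ : conjc 'i%C = - 'i%C); last by apply: eqC => /=; ring.
  by rewrite scaleNr -scalerN opprB opprK addrC.
- rewrite boZr boZl; apply: tcZ.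
  have -> : p * (bE a - d) * p = 2 *: ((p * a * q) * star (p * a * q)).
    have h' : a * d * star a = a * p * star a - a * q * star a.
      by rewrite -mulrBl -mulrBr /d -lock.
    have e : a * p * star a = d + a * q * star a by rewrite -h h' subrK.
    rewrite bE_star mulrBr mulrBl split_a e -!mulrA dp.
    rewrite !mulrDl !mulrDr !pqE !starE -!mulrA !pqE.
    by rewrite -[p + _ + _]addrA addrAC subrr add0r scalerDl scale1r.
  by apply/tcZ/tcM => //; exact: hs_star.
rewrite boZr boZl; apply: hsZ; rewrite bE_star mulrBr mulrBl.
apply: hsB; last by rewrite pd pq; exact: hs0.
have -> : p * (a * star a * d) * q =
    - ((p * a * p) * star (q * a * p) + (p * a * q) * (star a * q)).
  by rewrite split_a !starE -!mulrA dq !mulrN mulrDl mulrDr -!mulrA ppA.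
by apply/hsN/hsD; [apply/hsMl/hs_star | apply: hsMr].
Qed.

Lemma one_plus_bE a : sp a -> ainv a * (1 + bE a) = p *+ 2 * ainv a.
Proof.
move=> sa; rewrite mulrDr mulr1 bEE !mulrA ainvl // mul1r.
have -> : p *+ 2 = 1 + d.
  have -> : d = p - q by rewrite /d -lock.
  by rewrite -addpq [RHS]addrC addrACA addNr addr0.
by rewrite mulrDl mul1r.
Qed.

(** The last hypothesis says that 1 + E annihilates A (Z + 1) - U. As 1 + E is 2 a p a^-1, applying
    p a^-1 kills the difference too, and multiplying by conj g on the right gives the two sides. *)
Lemma sp_tangent a A U : sp a -> p * U = U -> U * q = U ->
  - U = (A * bE a - bE a * A) * zt (ch a) + bE a * U ->
  p * pull a A * q = symx a U.
Proof.
move=> sa pU Uq h.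
have e : (1 + bE a) * (A * zt (ch a) - U) = 0.
  move: h; rewrite mulrBl -(mulrA A) bE_zt // mulrN -(mulrA (bE a)) => h.
  rewrite mulrDl mul1r mulrBr {1}h.
  move: (A * zt (ch a)) => X; move: (bE a * X) (bE a * U) => Y Z.
  by rewrite -(addrA (- X)) (addrA X) subrr add0r addrACA addNr subrr addr0.
have sc := sp_star sa; have [g1 _ g3 g4 _] := ginvP sa.
have e2 : p * ainv a * (A * zt (ch a)) = p * ainv a * U.
  apply/eqP; rewrite -subr_eq0 -mulrBr; apply/eqP.
  have := congr1 (fun y => 2^-1 *: (ainv a * y)) e.
  by rewrite /= mulr0 scaler0 mulrA one_plus_bE // mulr2n !mulrDl half_double.
have e3 : p * ainv a * U = p * star a * U.
  by rewrite ainvE -!mulrA pdA; congr (_ * (_ * _)); rewrite -{1}pU dpA.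
rewrite symxE -e3 -e2.
have -> : p * ainv a * (A * zt (ch a)) * (q * a * q) =
    p * ainv a * A * (zt (ch a) * (q * a * q)) by rewrite !mulrA.
by rewrite zt_gb // /pull !mulrA.
Qed.

Lemma spres_elim (A : H -> H) : spres ip J A ->
  exists A' : bo, [/\ bov A' = A, cb A' = A' & hs (p * A' * q)].
Proof.
move=> [[Ab Ar] _ _ Ah]; have [_ b2 _ _] := blkE (Bo Ab).
exists (Bo Ab); split=> //; first exact/real_blocksP.
by apply/hsP; rewrite -b2.
Qed.

Lemma spres_intro (A : bo) : cb A = A -> star A = - (d * A * d) -> hs (p * A * q) ->
  spres ip J A.
Proof.
move=> Ar As Ah; have [b1 b2 _ _] := blkE A; split.
- by split; [exact: bov_bop | exact/real_blocksP].
- have : star (p * A * p) = - (p * A * p).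
    by rewrite !starE As !mulNr !mulrN -!mulrA dp pdA.
  by rewrite b1 => /(congr1 bov).
- have : star (cb (p * A * q)) = p * A * q.
    by rewrite !cbME Ar !starE As !mulNr !mulrN -!mulrA dq pdA !mulrN opprK.
  by rewrite b2 => /(congr1 bov).
- by rewrite b2; exact/hsP.
Qed.

Lemma gl_conj a (Y : bo) : gl (a - 1) -> gl Y -> gl (a * Y * star a).
Proof.
move=> ga gY; have gm : gl (a * Y).
  have -> : a * Y = Y + (a - 1) * Y by rewrite mulrBl mul1r addrC subrK.
  by apply: glD => //; exact: glM.
have -> : a * Y * star a = a * Y + (a * Y) * star (a - 1).
  by rewrite starB star1 mulrBr mulr1 addrC subrK.
by apply: glD => //; apply: glM => //; exact: gl_star.
Qed.

Lemma inf_actE (gamma : R) a A :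
  inf_act J gamma A (bov (gamma%:C *: ('i%C *: (bE a - d)))) =
  bov (gamma%:C *: ('i%C *: (A * bE a - bE a * A))).
Proof.
have NE : gamma%:C *: ('i%C *: (bE a - d)) + gamma%:C *: bJ = gamma%:C *: ('i%C *: bE a).
  by rewrite -scalerDr bJE scalerBr subrK.
have -> : gamma%:C *: ('i%C *: (A * bE a - bE a * A)) =
    A * (gamma%:C *: ('i%C *: bE a)) - (gamma%:C *: ('i%C *: bE a)) * A.
  by rewrite !boZr !boZl -!scalerBr.
by rewrite -NE.
Qed.

Lemma disc_orbit_bo (gamma : R) (Z mu : H -> H) : disc_orbit ip J gamma Z mu ->
  exists a, [/\ sp a, hs (p * a * q), Z = ch a &
    mu = bov (gamma%:C *: ('i%C *: (bE a - d)))].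
Proof.
move=> [A /SpresP[a [<- sa ah]] [<- ->]]; exists a; split=> //.
  exact: mobius0E.
exact: orbit_pointE.
Qed.

(** Only the base point of the curves is related to [a]: [bE_unique] replaces E at t = 0 by [bE a],
    after which the differentiated relation between E and the graph map applies. *)
Lemma kks_tangent (gamma : R) a (z m : R -> H -> H) (A U : H -> H) mu : gamma != 0 ->
  sp a -> (forall t, disc_orbit ip J gamma (z t) (m t)) ->
  z 0 = ch a -> m 0 = mu -> disc_velocity ip J z U -> spres ip J A ->
  velocity (affine_orbit ip J gamma) (sp12 ip J) (norm12 ip J) m (inf_act J gamma A mu) ->
  mu = bov (gamma%:C *: ('i%C *: (bE a - d))) /\
  exists A' U', [/\ bov A' = A, bov U' = U, cb A' = A' & hs (p * A' * q)] /\
     p * pull a A' * q = symx a U'.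
Proof.
move=> g0 sa zm z0 m0 [zs Us zU] /spres_elim[A' [AE Ar Ah]] [ms [_ vg] mv]; subst A.
(* These representatives have no continuity in [t]; only [ch (at' t)] and [bE (at' t)], which depend
   on the point alone, are differentiated. *)
have /choice[at' atP] : forall t, exists a', [/\ sp a', hs (p * a' * q), z t = ch a' &
    m t = bov (gamma%:C *: ('i%C *: (bE a' - d)))] by move=> t; exact: disc_orbit_bo (zm t).
have Ub : bop ip U by case: Us => -[].
pose U' := Bo Ub; have sU : sym U' by apply/symP.
have s0 : sp (at' 0) by case: (atP 0).
have ch0 : ch (at' 0) = ch a.
  by apply: bo_val_inj; rewrite -z0; have [_ _ ->] := atP 0.
have E0 : bE (at' 0) = bE a by exact: bE_unique.
have muE : mu = bov (gamma%:C *: ('i%C *: (bE a - d))).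
  by rewrite -m0; have [_ _ _ ->] := atP 0; rewrite E0.
split=> //; exists A', U'; split=> //.
have zt' t : sym (ch (at' t)) by have [? ? _ _] := atP t; exact: ch_in_sym.
have dz : deriv (fun t => ch (at' t)) U'.
  apply: velocity_deriv; first by move=> t; case: (zt' t).
    by case: sU.
  have zE : z = fun t => bov (ch (at' t)) by apply: funext => t; have [_ _ ->] := atP t.
  by rewrite zE in zU.
rewrite muE inf_actE in vg mv.
have dm : deriv (fun t => gamma%:C *: ('i%C *: (bE (at' t) - d)))
    (gamma%:C *: ('i%C *: (A' * bE a - bE a * A'))).
  apply: velocity12_deriv; first by move=> t; have [? ? _ _] := atP t; exact: bE_gl.
    exact/gl12P.
  have mE : m = fun t => bov (gamma%:C *: ('i%C *: (bE (at' t) - d))).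
    by apply: funext => t; have [_ _ _ ->] := atP t.
  by rewrite mE in mv.
(* The orbit is gamma i (E - d), so E is recovered on dividing by gamma i. *)
have dE' : deriv (fun t => bE (at' t)) (A' * bE a - bE a * A').
  have k1 (B : bo) : (gamma%:C * 'i%C)^-1 *: (1 : bo) * (gamma%:C *: ('i%C *: B)) = B.
    rewrite boZl mul1r !scalerA mulVf ?scale1r //.
    rewrite mulf_neq0 //; first by apply: contra_neq g0 => /complexI.
    by apply/eqP => /(congr1 (@complex.Im R)) /= /eqP; rewrite oner_eq0.
  have := deriv_add d (derivMl ((gamma%:C * 'i%C)^-1 *: (1 : bo)) dm).
  rewrite k1; apply: deriv_ext; first by rewrite k1 subrK.
  by exists 1 => // t _ _; rewrite k1 subrK.
have dzt : deriv (fun t => zt (ch (at' t))) U'.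
  apply: deriv_ext (deriv_add q dz); first by rewrite ztE.
  by exists 1 => // t _ _; rewrite ztE.
have pr : exists2 del : R, 0 < del & forall t, `|t| <= del ->
    bE (at' t) * zt (ch (at' t)) = - zt (ch (at' t)).
  by exists 1 => // t _; have [? _ _ _] := atP t; exact: bE_zt.
have := product_rule dE' dzt (derivN dzt) pr; rewrite ch0 E0.
have [_ Upq _] := sU; apply: sp_tangent => //.
  by rewrite -Upq -!mulrA ppA.
by rewrite -Upq -!mulrA qq.
Qed.

(** * The three conclusions *)

Lemma gl_tangent a Y : gl (a - 1) -> gl Y -> gl (a * Y).
Proof.
move=> ga gY; have -> : a * Y = Y + (a - 1) * Y by rewrite mulrBl mul1r addrC subrK.
by apply: glD => //; exact: glM.
Qed.

Lemma disc_velocity_intro (alpha : R -> bo) U : (forall t, sp (alpha t) /\ gl (alpha t - 1)) ->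
  sym U ->
  hsnorm ip ((t^-1)%:C *: (bov (ch (alpha t)) - bov (ch (alpha 0))) - bov U)
    @[t --> (0 : R)^'] --> (0 : R) ->
  disc_velocity ip J (fun t => bov (ch (alpha t))) U.
Proof.
move=> al sU v; split=> //; last exact/symP.
by move=> t; have [sa ga] := al t; apply: ch_disc => //; exact: gl_sp_hs.
Qed.

(** [reduced_form] prescribes values only on velocities of curves; [tangent_curve] realises every
    pair of tangent vectors. *)
Lemma reduced_form_val (omega : set (H -> H) -> (H -> H) -> (H -> H) -> R) a U W z :
  reduced_form ip J omega -> sp a -> gl (a - 1) -> sym U -> sym W ->
  trc (cb (symx a U) * symx a W) z ->
  omega (pi_Q ip J a) U W = - 2 * Im z.
Proof.
move=> [_ red] sa ga sU sW tz.
have [al [al0 alP alv alc _]] := tangent_curve sa ga sU.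
have [be [be0 beP bev bec _]] := tangent_curve sa ga sW.
have aux (c : R -> bo) X : (forall t, sp (c t) /\ gl (c t - 1)) -> sym X ->
    norm12 ip J ((t^-1)%:C *: (bov (c t) - bov (c 0)) - bov (a * (symx a X + cb (symx a X))))
      @[t --> (0 : R)^'] --> (0 : R) ->
    velocity (muO_zero ip J) (gl12 ip J) (norm12 ip J) (fun t => bov (c t))
      (a * (symx a X + cb (symx a X))).
  move=> cP sX v; split=> //.
    by move=> t; apply/muO_zeroP/Sp12P; exists (c t); have [? ?] := cP t.
  apply/gl12P/gl_tangent => //; apply: gl_off; last exact: symx_pq.
  exact: symx_hs.
have chc (c : R -> bo) : (forall t, sp (c t) /\ gl (c t - 1)) ->
    chart ip J \o (fun t => bov (c t)) = fun t => bov (ch (c t)).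
  by move=> cP; apply: funext => t; have [? _] := cP t; rewrite /= chartE.
have := red (fun t => bov (al t)) (fun t => bov (be t)) a _ _ U W
  (congr1 bov al0) (congr1 bov be0) (aux _ _ alP sU alv) (aux _ _ beP sW bev).
rewrite !chc //; move=> /(_ (disc_velocity_intro alP sU alc) (disc_velocity_intro beP sW bec)).
rewrite (omegaM_tangent sa (symx_pq a U) (symx_pq a W) (symx_sym sa sU) tz).
exact: complexI.
Qed.

Lemma Sp12_mul b a : sp b -> gl (b - 1) -> sp a -> gl (a - 1) ->
  sp (b * a) /\ gl (b * a - 1).
Proof. by move=> sb gb sa ga; split; [exact: sp_mul | exact: gl_mul1]. Qed.

Lemma disc_velocity_elim (z : R -> H -> H) (U : H -> H) : disc_velocity ip J z U ->
  exists z' U', [/\ forall t, bov (z' t) = z t, bov U' = U, forall t, sym (z' t), sym U'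
    & deriv z' U'].
Proof.
move=> [zs Us zU].
have zb t : bop ip (z t) by case: (zs t) => -[[]].
have Ub : bop ip U by case: Us => -[].
exists (fun t => Bo (zb t)), (Bo Ub); split=> //.
- by move=> t; apply/symP; case: (zs t).
- exact/symP.
- apply: velocity_deriv => //; last by apply/hsP; case: Us.
  by move=> t; apply/hsP; case: (zs t) => -[].
Qed.

Lemma reduced_form_invariant (omega : set (H -> H) -> (H -> H) -> (H -> H) -> R) :
  reduced_form ip J omega -> Sp12_invariant ip J omega.
Proof.
move=> red B A z w U W U' W' /Sp12P[b [<- sb gb]] /muO_zeroP/Sp12P[a [<- sa ga]].
rewrite chartE // => z0 w0 /disc_velocity_elim[zb [Ub [zE <- zs sU dz]]].
move=> /disc_velocity_elim[wb [Wb [wE <- ws sW dw]]].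
move=> /disc_velocity_elim[zb' [Ub' [zE' <- zs' sU' dz']]].
move=> /disc_velocity_elim[wb' [Wb' [wE' <- ws' sW' dw']]].
have eU : symx (b * a) Ub' = symx a Ub.
  apply: (mobius_deriv sb sa dz dz') => //; first by apply: bo_val_inj; rewrite zE.
  by move=> t; rewrite zE' /= zE.
have eW : symx (b * a) Wb' = symx a Wb.
  apply: (mobius_deriv sb sa dw dw') => //; first by apply: bo_val_inj; rewrite wE.
  by move=> t; rewrite wE' /= wE.
have [x tx] := trc_symx sa sU sW.
rewrite (reduced_form_val red sa ga sU sW tx).
rewrite -eU -eW in tx; have [sc gc] := Sp12_mul sb gb sa ga.
exact: (reduced_form_val red sc gc sU' sW' tx).
Qed.

(** [A X] is built so that its pull-back by [a] is off-diagonal with upper block xi(X); its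
    infinitesimal action is then the orbit velocity of the curve from [tangent_curve]. *)
Lemma kks_exists (gamma : R) a U W z : gamma != 0 -> sp a -> gl (a - 1) -> sym U -> sym W ->
  trc (cb (symx a U) * symx a W) z ->
  kks_disc ip J gamma (ch a) U W (4 * gamma * Im z)%:C.
Proof.
move=> g0 sa ga sU sW tz.
have [al [al0 alP _ alc alm]] := tangent_curve sa ga sU.
have [be [be0 beP _ bec bem]] := tangent_curve sa ga sW.
pose A X := a * (symx a X + cb (symx a X)) * ainv a.
pose m (c : R -> bo) (t : R) : bo := gamma%:C *: ('i%C *: (bE (c t) - d)).
have [ar _ _] := sa; have ah := gl_sp_hs ga.
have orb (c : R -> bo) : (forall t, sp (c t) /\ gl (c t - 1)) ->
    forall t, disc_orbit ip J gamma (ch (c t)) (m c t).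
  move=> cP t; have [sc gc] := cP t; exists (bov (c t)).
    by apply/SpresP; exists (c t); split=> //; exact: gl_sp_hs.
  by split; [exact: mobius0E | rewrite orbit_pointE].
have Apull X : pull a (A X) = symx a X + cb (symx a X).
  by rewrite /pull /A !mulrA ainvl // mul1r -mulrA ainvl // mulr1.
have Xgl X : sym X -> gl (symx a X + cb (symx a X)).
  by move=> sX; apply: gl_off; [exact: symx_hs | exact: symx_pq].
have Xs X : sym X -> star (symx a X + cb (symx a X)) = symx a X + cb (symx a X).
  by move=> sX; rewrite starD symx_sym // star_cb symx_sym // cbK addrC.
have Xd X : (symx a X + cb (symx a X)) * d = - (d * (symx a X + cb (symx a X))).
  have := symx_pq a X; move: (symx a X) => x xpq.
  have cx : cb x = q * cb x * p by rewrite -{1}xpq !cbME.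
  by rewrite cx -{1 3}xpq mulrDl mulrDr -!mulrA !pqE opprD !opprK.
have Ar X : cb (A X) = A X.
  by rewrite /A !cbM cb_ainv // ar cbD cbK [cb _ + _]addrC.
have Ah X : sym X -> hs (p * A X * q).
  by move=> sX; apply/hsMr/hsMl/hsMr/hsMl/gl_hs/Xgl.
have Asp X : sym X -> spres ip J (A X).
  move=> sX; apply: spres_intro; [exact: Ar| |exact: Ah].
  have Ad : A X = - (a * d * (symx a X + cb (symx a X)) * star a * d).
    rewrite /A ainvE -!mulrA (mulrA _ d) Xd !mulNr !mulrN.
    by rewrite -!mulrA.
  rewrite {1}Ad starN !starE (Xs X sX) /A ainvE -!mulrA dd mulr1.
  by rewrite !mulrA.
have inf X : inf_act J gamma (A X) (m (fun=> a) 0) =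
    bov (gamma%:C *: ('i%C *: (a * ((symx a X + cb (symx a X)) *+ 2) * star a * d))).
  rewrite /m inf_actE; congr (bov (_ *: (_ *: _))).
  have -> : A X * bE a - bE a * A X = a * ((symx a X + cb (symx a X)) * d
      - d * (symx a X + cb (symx a X))) * ainv a.
    rewrite mulrBr mulrBl bEE /A; congr (_ - _).
      by rewrite !mulrA -(mulrA (a * _) (ainv a)) ainvl // mulr1.
    by rewrite !mulrA -(mulrA (a * d) (ainv a)) ainvl // mulr1.
  rewrite -[d * _]opprK -Xd opprK -mulr2n -mulrnAl ainvE -!mulrA.
  by rewrite ddA.
have vel (c : R -> bo) X : c 0 = a -> (forall t, sp (c t) /\ gl (c t - 1)) -> sym X ->
    norm12 ip J ((t^-1)%:C *: (bov (m c t) - bov (m c 0)) - bov (gamma%:C *: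
      ('i%C *: (a * ((symx a X + cb (symx a X)) *+ 2) * star a * d))))
      @[t --> (0 : R)^'] --> (0 : R) ->
    velocity (affine_orbit ip J gamma) (sp12 ip J) (norm12 ip J) (fun t => bov (m c t))
      (inf_act J gamma (A X) (m (fun=> a) 0)).
  move=> c0 cP sX v; rewrite inf; split=> //.
    move=> t; have [sc gc] := cP t; exists (bov (c t)).
      by apply/SpresP; exists (c t); split=> //; exact: gl_sp_hs.
    by rewrite orbit_pointE.
  set Y := (symx a X + cb (symx a X)) *+ 2.
  have gY : gl Y by rewrite /Y mulr2n; apply: glD; exact: Xgl.
  have gC := gl_conj ga gY.
  have vE : gamma%:C *: ('i%C *: (a * Y * star a * d)) = gamma%:C *: (a * Y * star a * bJ).
    by rewrite bJE boZr.
  have gv : gl (gamma%:C *: ('i%C *: (a * Y * star a * d))).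
    by rewrite vE; apply/glZ/glJr.
  split; last exact/gl12P.
  have sY : star Y = Y by rewrite /Y mulr2n starD Xs.
  apply: spres_intro; [by case: gv| |exact/hsMr/hsMl/gl_hs].
  rewrite !starZ !starE sY conjc_real boZr boZl boZr boZl -!mulrA dd mulr1.
  rewrite (_ : conjc 'i%C = - 'i%C); last by apply: eqC => /=; ring.
  by rewrite scaleNr scalerN.
exists (fun t => bov (ch (al t))), (fun t => bov (ch (be t))),
  (fun t => bov (m al t)), (fun t => bov (m be t)), (bov (m (fun=> a) 0)), (bov (A U)), (bov (A W)).
split.
- by split; exact: orb.
- by rewrite /m al0 be0.
- by split; exact: disc_velocity_intro.
- by split; [exact: Asp|exact: Asp|exact: vel (alm gamma)|exact: vel (bem gamma)].
- rewrite (@kks_value gamma a (A U) (A W) z) //; try exact: Ah.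
  have xe X : p * (symx a X + cb (symx a X)) * q = symx a X.
    have := symx_pq a X; move: (symx a X) => x xpq.
    have cx : cb x = q * cb x * p by rewrite -{1}xpq !cbME.
    by rewrite cx mulrDr mulrDl -!mulrA !pqE addr0 mulrA.
  by rewrite !Apull !xe.
Qed.

Lemma kks_disc_val (gamma : R) a (U W : bo) z r : gamma != 0 -> sp a -> gl (a - 1) ->
  trc (cb (symx a U) * symx a W) z ->
  kks_disc ip J gamma (ch a) U W r -> r = (4 * gamma * Im z)%:C.
Proof.
move=> g0 sa ga tz [zc [wc [m [n [mu [A [B [[zm wn] [z0 w0 m0 n0] [zU wW] [As Bs mv nv] ->]]]]]]]].
have [muE [A' [U' [[AE UE Ar Ah] eA]]]] := kks_tangent g0 sa zm z0 m0 zU As mv.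
have [_ [B' [W' [[BE WE Br Bh] eB]]]] := kks_tangent g0 sa wn w0 n0 wW Bs nv.
have {}UE : U' = U by apply: bo_val_inj.
have {}WE : W' = W by apply: bo_val_inj.
subst U' W' A B; rewrite muE (@kks_value gamma a A' B' z) //.
by rewrite eA eB.
Qed.

Lemma sym_bo (U : H -> H) : sym_hs ip J U -> exists U' : bo, bov U' = U /\ sym U'.
Proof.
move=> sU; have Ub : bop ip U by case: sU => -[].
by exists (Bo Ub); split=> //; exact/symP.
Qed.

Lemma reduced_form_kks (omega : set (H -> H) -> (H -> H) -> (H -> H) -> R) (gamma : R) :
  reduced_form ip J omega -> gamma != 0 ->
  exists2 c : R, c != 0 &
  forall a U W, muO_zero ip J a -> sym_hs ip J U -> sym_hs ip J W ->
  forall r : C, kks_disc ip J gamma (chart ip J a) U W r <->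
    (omega (pi_Q ip J a) U W)%:C = c%:C * r.
Proof.
move=> red g0; have g20 : 2 * gamma != 0 by rewrite mulf_neq0.
(* The quotient of - 2, from [reduced_form_val], by 4 gamma, from [kks_value]. *)
exists (- (2 * gamma)^-1); first by rewrite oppr_eq0 invr_eq0.
move=> A U' W' /muO_zeroP/Sp12P[a [<- sa ga]] /sym_bo[U [<- sU]] /sym_bo[W [<- sW]] r.
have [z tz] := trc_symx sa sU sW; rewrite chartE // (reduced_form_val red sa ga sU sW tz).
have e : (- 2 * Im z)%:C = (- (2 * gamma)^-1)%:C * (4 * gamma * Im z)%:C :> C.
  apply: eqC => /=; last by ring.
  by field.
split=> [/(kks_disc_val g0 sa ga tz) ->|]; first exact: e.
rewrite e => /mulfI <-; first exact: kks_exists.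
by apply: contra_neq g20 => /complexI/eqP; rewrite oppr_eq0 invr_eq0 => /eqP.
Qed.

Lemma reduced_form_formula (omega : set (H -> H) -> (H -> H) -> (H -> H) -> R) a U W :
  reduced_form ip J omega -> Sp12 ip J a -> sym_hs ip J U -> sym_hs ip J W ->
  let Z := chart ip J a in
  omega (pi_Q ip J a) U W =
    - 2 * Im (tr ip
      (invop ip (Pm J) (Pm J - (cbar Z \o Z)) \o adj ip U
       \o invop ip (Pp J) (Pp J - (Z \o cbar Z)) \o W)).
Proof.
move=> red /Sp12P[b [<- sb gb]] /sym_bo[X [<- sX]] /sym_bo[Y [<- sY]] Z.
have [z tz] := trc_symx sb sX sY.
by rewrite /Z chartE // (tr_formula sb sX sY tz) (reduced_form_val red sb gb sX sY tz).
Qed.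

End Hilbert.

Theorem theorem5 (R : realType) (V : completeNormedModType R)
    (ip : {dot V for idfun}) (J : {linear V -> V})
    (ip_norm : forall u : V, ip u u = `|u| ^+ 2)
    (V_separable : exists s : nat -> V, dense (range s))
    (V_infinite_dim : ~ exists (n : nat) (b : 'I_n -> V), forall u : V,
        exists c : 'I_n -> R, u = \sum_i c i *: b i)
    (J_bounded : continuous J)
    (J_square : forall u : V, J (J u) = - u)
    (J_isometry : forall u v : V, ip (J u) (J v) = ip u v)
    (omegaQ : set (op V) -> op V -> op V -> R)
    (omegaQ_reduced : reduced_form ip J omegaQ) :
  [/\ Sp12_invariant ip J omegaQ,
      forall gamma : R, gamma != 0 ->
        exists2 c : R, c != 0 &
        forall a U W, muO_zero ip J a -> sym_hs ip J U -> sym_hs ip J W ->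
        forall r : R[i], kks_disc ip J gamma (chart ip J a) U W r <->
          (omegaQ (pi_Q ip J a) U W)%:C = c%:C * r
    & forall a U W, Sp12 ip J a -> sym_hs ip J U -> sym_hs ip J W ->
        let Z := chart ip J a in
        omegaQ (pi_Q ip J a) U W =
          - 2 * complex.Im (tr ip
            (invop ip (Pm J) (Pm J - (cbar Z \o Z)) \o adj ip U
             \o invop ip (Pp J) (Pp J - (Z \o cbar Z)) \o W))].
Proof.
have [s s_dense] := V_separable.
(* Separability and infinite dimension enter through this basis, on which the uniqueness of all
   basis sums and traces rests. *)
have [e0 e0_onb] := onb_exists ip_norm s_dense V_infinite_dim.
split.
- exact: (reduced_form_invariant ip_norm e0_onb J_square J_isometry).
- by move=> gamma; exact: (reduced_form_kks ip_norm e0_onb J_square J_isometry).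
- by move=> a U W; exact: (reduced_form_formula ip_norm e0_onb J_square J_isometry).
Qed.
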